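(* Let $Q_N\succeq P^*$ and run the algorithm RHPG-RL (see context) with the horizon $N$, step sizes $\alpha_{h,i}$ and iteration numbers $T_h$ given in the context. Then the algorithm achieves a sample complexity bound of at most $$\sum_{h=0}^{N-1}T_h=\widetilde{\mathcal O}\left(\epsilon^{-2}\right).$$
   Context: Norms: $\|X\|$ is the spectral norm, $\|X\|_F$ the Frobenius norm, $\sigma_{\min}$ the minimum singular value, $\lambda_{\min}$ the minimum eigenvalue, $\kappa_X$ the condition number; $\|X\|_*^2:=\sup_{z\ne0}\frac{z^\top X^\top P^*Xz}{z^\top P^*z}$. $e$ is Euler's number. Setting: system $x_{t+1}=Ax_t+Bu_t$, $A\in\mathbb{R}^{n\times n}$, $B\in\mathbb{R}^{n\times m}$, $(A,B)$ stabilizable; $Q\in\mathbb{R}^{n\times n}$, $R\in\mathbb{R}^{m\times m}$ symmetric positive definite. The initial state distribution $\mathcal D$ on $\mathbb{R}^n$ satisfies $\mathbb E[x_0]=0$, $\mathbb E[x_0x_0^\top]=\Sigma_0\succ0$, $\|x_0\|^2\le C_m$ a.s. for some $C_m>0$. $P^*$ is the unique positive definite solution of $P=A^\top PA-A^\top PB(R+B^\top PB)^{-1}B^\top PA+Q$, $K^*:=(R+B^\top P^*B)^{-1}B^\top P^*A$, $A_K^*:=A-BK^*$. $Q_N$ is the symmetric terminal cost matrix, $\epsilon>0$ is the target accuracy, $\sigma>0$ is the exploration parameter, and $\zeta\in(0,1)$ is arbitrary. Riccati difference equation: $P_N^*:=Q_N$ and, for $t=N-1,\dots,0$, $K_t^*:=(R+B^\top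 P_{t+1}^*B)^{-1}B^\top P_{t+1}^*A$, $P_t^*:=(A-BK_t^* )^\top P_{t+1}^*(A-BK_t^* )+(K_t^* )^\top RK_t^*+Q$. Algorithm RHPG-RL: set $\widetilde P_N:=Q_N$. For $h=N-1,\dots,0$: initialize $K_{h,0}\in\mathbb{R}^{m\times n}$ arbitrarily (e.g. $K_{h,0}=0$); for $i=0,\dots,T_h-1$ draw fresh $x_0\sim\mathcal D$, $\eta\sim\mathcal N(0,I_m)$, simulate one new trajectory with $u_0=-K_{h,i}x_0+\sigma\eta$ and $u_t=-\widetilde K_{h+t}x_t$ for $t\ge1$, observe the cost-to-go $Q_h(x_0,u_0)=x_0^\top Qx_0+u_0^\top Ru_0+(Ax_0+Bu_0)^\top\widetilde P_{h+1}(Ax_0+Bu_0)$, and update $K_{h,i+1}=K_{h,i}+\frac{\alpha_{h,i}}{\sigma}Q_h(x_0,u_0)\,\eta x_0^\top$. Then set $\widetilde K_h:=K_{h,T_h}$ and $\widetilde P_h:=(A-B\widetilde K_h)^\top\widetilde P_{h+1}(A-B\widetilde K_h)+\widetilde K_h^\top R\widetilde K_h+Q$. Output $\widetilde K_0$. Each inner iteration uses one trajectory, so the number of samples is $\sum_hT_h$. The parameters below are the ones chosen so that the output satisfies $\|\widetilde K_0-K^*\|\le\epsilon$ with probability at least $1-N\zeta$. $\widetilde{\mathcal O}$ suppresses logarithmic factors in $1/\epsilon$; the exponent of $1/\epsilon$ does not depend on problem-specific constants. Surrogate cost: $\widetilde J_h(K):=\mathbb E_{x_0\sim\mathcal D}\big[x_0^\top\big(Q+K^\top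 RK+(A-BK)^\top\widetilde P_{h+1}(A-BK)\big)x_0\big]$, with minimizer $\widetilde K_h^*=(R+B^\top\widetilde P_{h+1}B)^{-1}B^\top\widetilde P_{h+1}A$. Constants: $P_{\max}:=\|P^*\|+\kappa_{P^*}\|Q_N-P^*\|_*$, $a:=\sigma_{\min}(Q)/2$, $\varphi:=\max_{0\le t\le N-1}\|A-BK_t^*\|$, $C_1:=\varphi\|B\|/\lambda_{\min}(R)$, $C_3:=2(\|R\|+(P_{\max}+a)\|B\|^2)$, $\mu:=4\sigma_{\min}(\Sigma_0)\sigma_{\min}(R)$, $L:=C_3\|\Sigma_0\|$, $\widetilde C_h:=\frac{10\zeta^{-1}\widetilde J_h(K_{h,0})+\widetilde J_h(\widetilde K_h^* )}{\sigma_{\min}(\Sigma_0)\sigma_{\min}(R)}$, $\xi_{h,1}:=\big(\|Q\|+2\|R\|\widetilde C_h+2(P_{\max}+a)(\|A\|^2+2\|B\|^2\widetilde C_h)\big)C_m^{3/2}$, $\xi_{h,2}:=2(\|R\|+2(P_{\max}+a)\|B\|^2)C_m^{1/2}$, $\xi_{h,3}:=\frac1{\sigma^2}\xi_{h,1}^2m+2\xi_{h,1}\xi_{h,2}m(m+2)+\sigma^2\xi_{h,2}^2m(m+2)(m+4)$. Target accuracies: $\varsigma_{0,\epsilon}:=\epsilon/4$ and, for $h\ge1$, $\varsigma_{h,\epsilon}:=\min\big\{\sqrt{\tfrac{a}{C_3}\tfrac1N},\sqrt{\tfrac{a}{C_3}\tfrac{a}{2eNP_{\max}}},\sqrt{\tfrac{a}{C_3}\tfrac{\epsilon}{8eNC_1P_{\max}}},\sqrt{\tfrac{\epsilon}{4C_1C_3}}\big\}$.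 Parameter choices: $N=\frac12\frac{\log\left(2\|Q_N-P^*\|_*\kappa_{P^*}\|A_K^*\|\|B\|/(\epsilon\lambda_{\min}(R))\right)}{\log(1/\|A_K^*\|_* )}+1$, $\ \alpha_{h,i}=\frac2\mu\frac1{i+\theta_h}$ with $\theta_h=\max\{2,\frac{2L\xi_{h,3}}{\mu^2\widetilde J_h(K_{h,0})}\}$, and $T_h=\frac{40}{7\mu\varsigma_{h,\epsilon}^2\zeta}\theta_h\widetilde J_h(K_{h,0})$, where $N$ and $T_h$ are rounded up to integers.
   Formalization: The initial gains K_{h,0} are deterministic and uniformly bounded in norm by an arbitrary fixed constant (for unbounded ones the bound fails); as the T_h are random, the bound is stated on an event of probability at least 1-Nζ, for small ε, with a factor polynomial in 1/ζ. *)

(* Defs.v *)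
From HB Require Import structures.
From mathcomp Require Import all_boot all_order all_algebra.
From mathcomp Require Import complex.
From mathcomp Require Import all_classical all_reals all_analysis.

Set Implicit Arguments.
Unset Strict Implicit.
Unset Printing Implicit Defensive.

Import Order.TTheory GRing.Theory Num.Theory.
Import numFieldNormedType.Exports.

Local Open Scope classical_set_scope.
Local Open Scope ring_scope.

Section matrices.
Context {R : realType}.

Definition vnorm k (x : 'cV[R]_k) : R := Num.sqrt (\sum_i x i 0 ^+ 2).

Definition quadform k (X : 'M[R]_k) (x : 'cV[R]_k) : R :=
  (x^T *m X *m x) 0 0.

Definition posdef k (X : 'M[R]_k) : Prop :=
  X^T = X /\ forall x : 'cV[R]_k, x != 0 -> 0 < quadform X x.

Definition possemidef k (X : 'M[R]_k) : Prop :=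
  X^T = X /\ forall x : 'cV[R]_k, 0 <= quadform X x.

(* The suprema and infima below are over nonempty bounded sets as soon as the
   dimensions are positive and, for [lambda_min], the matrix is symmetric. *)
Definition specnorm k l (X : 'M[R]_(k, l)) : R :=
  sup [set r | exists2 z : 'cV[R]_l, z != 0 & r = vnorm (X *m z) / vnorm z].

Definition lambda_min k (X : 'M[R]_k) : R := inf [set a | eigenvalue X a].

Definition sigma_min k (X : 'M[R]_k) : R :=
  inf [set s | 0 <= s /\ eigenvalue (X^T *m X) (s ^+ 2)].

Definition cond k (X : 'M[R]_k) : R := specnorm X * specnorm (invmx X).

Definition starnorm k (P X : 'M[R]_k) : R :=
  Num.sqrt (sup [set r | exists2 z : 'cV[R]_k, z != 0 &
    r = quadform (X^T *m P *m X) z / quadform P z]).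

Definition stabilizable n m (A : 'M[R]_n) (B : 'M[R]_(n, m)) : Prop :=
  exists K : 'M[R]_(m, n), forall a : R[i],
    eigenvalue (map_mx (real_complex R) (A - B *m K)) a -> `|a| < 1.

(* Tuples carry the product Borel sigma-algebra, matrices carry none in the
   library: random vectors are tuples, converted for the linear algebra. *)
Definition colvec k (x : k.-tuple R) : 'cV[R]_k := \col_i tnth x i.

Definition nat_ceil (x : R) : nat := absz (Num.ceil (Num.max 0 x)).

End matrices.

Record lqr (R : realType) (n m : nat) := LQR {
  sysA : 'M[R]_n;
  sysB : 'M[R]_(n, m);
  costQ : 'M[R]_n;
  costR : 'M[R]_m;
  termQ : 'M[R]_n;
  initD : probability (n.-tuple R) R;
  Sigma0 : 'M[R]_n;
  Cm : R;
  Pstar : 'M[R]_n;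
  explore : R }.

Section problem.
Context {R : realType} {n m : nat} (pb : lqr R n m).

Local Notation A := (sysA pb).
Local Notation B := (sysB pb).
Local Notation Q := (costQ pb).
Local Notation Rc := (costR pb).
Local Notation QN := (termQ pb).
Local Notation D := (initD pb).
Local Notation S0 := (Sigma0 pb).
Local Notation Ps := (Pstar pb).
Local Notation sigma := (explore pb).

Definition gain (P : 'M[R]_n) : 'M[R]_(m, n) :=
  invmx (Rc + B^T *m P *m B) *m B^T *m P *m A.

Definition policy_cost (P : 'M[R]_n) (K : 'M[R]_(m, n)) : 'M[R]_n :=
  (A - B *m K)^T *m P *m (A - B *m K) + K^T *m Rc *m K + Q.

Definition dare (P : 'M[R]_n) : Prop :=
  P = A^T *m P *m A
      - A^T *m P *m B *m invmx (Rc + B^T *m P *m B) *m B^T *m P *m A + Q.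

Definition lqr_setting : Prop :=
  [/\ stabilizable A B,
      posdef Q /\ posdef Rc,
      [/\ forall i : 'I_n, ('E_D[fun x => tnth x i] = 0)%E,
          forall i j : 'I_n, ('E_D[fun x => (tnth x i * tnth x j)%R] = (S0 i j)%:E)%E,
          posdef S0,
          0 < Cm pb &
          {ae D, forall x, vnorm (colvec x) ^+ 2 <= Cm pb}],
      posdef Ps /\ dare Ps &
      QN^T = QN /\ 0 < sigma].

Definition Kstar : 'M[R]_(m, n) := gain Ps.
Definition AKstar : 'M[R]_n := A - B *m Kstar.

(* P*_t and K*_t of the Riccati difference equation with P*_N = Q_N *)
Definition Pric (N t : nat) : 'M[R]_n :=
  iter (N - t) (fun P => policy_cost P (gain P)) QN.
Definition Kric (N t : nat) : 'M[R]_(m, n) := gain (Pric N t.+1).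

(* If Q_N = P*, B = 0 or A_K* = 0, the conventions ln 0 = 0 and 0^-1 = 0 give
   horizon 1, for which the first Riccati gain is already K*. *)
Definition horizon (eps : R) : nat :=
  nat_ceil (2^-1 *
    (ln (2 * starnorm Ps (QN - Ps) * cond Ps * specnorm AKstar * specnorm B
          / (eps * lambda_min Rc))
     / ln (1 / starnorm Ps AKstar)) + 1).

Definition Pmax : R := specnorm Ps + cond Ps * starnorm Ps (QN - Ps).
Definition acst : R := sigma_min Q / 2.
Definition phi (N : nat) : R :=
  \big[Num.max/0]_(t < N) specnorm (A - B *m Kric N t).
Definition C1 (N : nat) : R := phi N * specnorm B / lambda_min Rc.
Definition C3 : R := 2 * (specnorm Rc + (Pmax + acst) * specnorm B ^+ 2).
Definition mu : R := 4 * sigma_min S0 * sigma_min Rc.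
Definition Lcst : R := C3 * specnorm S0.

Definition accuracy (eps : R) (N h : nat) : R :=
  if h is 0 then eps / 4 else
  Num.min (Num.sqrt (acst / C3 * (1 / N%:R)))
  (Num.min (Num.sqrt (acst / C3 * (acst / (2 * expR 1 * N%:R * Pmax))))
  (Num.min (Num.sqrt (acst / C3 * (eps / (8 * expR 1 * N%:R * C1 N * Pmax))))
           (Num.sqrt (eps / (4 * C1 N * C3))))).

(* The quantities of stage h depend on the (random) matrix P~_{h+1}, passed as
   [P], and on the initial gain K_{h,0}, passed as [K0]. *)
Section stage.
Variables (zeta : R) (P : 'M[R]_n) (K0 : 'M[R]_(m, n)).

Definition Jtil (K : 'M[R]_(m, n)) : R :=
  fine ('E_D[fun x => quadform
    (Q + K^T *m Rc *m K + (A - B *m K)^T *m P *m (A - B *m K))%R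
    (colvec x)])%E.

Definition Ctil : R :=
  (10 * zeta^-1 * Jtil K0 + Jtil (gain P)) / (sigma_min S0 * sigma_min Rc).

Definition xi1 : R :=
  (specnorm Q + 2 * specnorm Rc * Ctil
   + 2 * (Pmax + acst) * (specnorm A ^+ 2 + 2 * specnorm B ^+ 2 * Ctil))
  * (Cm pb `^ (3 / 2)).
Definition xi2 : R :=
  2 * (specnorm Rc + 2 * (Pmax + acst) * specnorm B ^+ 2) * (Cm pb `^ (1 / 2)).
Definition xi3 : R :=
  1 / sigma ^+ 2 * xi1 ^+ 2 * m%:R
  + 2 * xi1 * xi2 * m%:R * (m%:R + 2)
  + sigma ^+ 2 * xi2 ^+ 2 * m%:R * (m%:R + 2) * (m%:R + 4).

Definition theta : R := Num.max 2 (2 * Lcst * xi3 / (mu ^+ 2 * Jtil K0)).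

Definition stepsize (i : nat) : R := 2 / mu * (1 / (i%:R + theta)).

Definition iterations (vs : R) : nat :=
  nat_ceil (40 / (7 * mu * vs ^+ 2 * zeta) * theta * Jtil K0).

Definition cost_to_go (x : 'cV[R]_n) (u : 'cV[R]_m) : R :=
  quadform Q x + quadform Rc u + quadform P (A *m x + B *m u).

(* [z i] is the pair (x_0, eta) drawn at iteration i *)
Fixpoint sgd (z : nat -> n.-tuple R * m.-tuple R) (i : nat) : 'M[R]_(m, n) :=
  if i is j.+1 then
    let K := sgd z j in
    let x := colvec (z j).1 in
    let eta := colvec (z j).2 in
    let u := - (K *m x) + sigma *: eta in
    K + (stepsize j / sigma * cost_to_go x u) *: (eta *m x^T)
  else K0.

End stage.

Section algorithm.
Variables (eps zeta : R) (K0 : nat -> 'M[R]_(m, n)).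
Variable z : nat -> nat -> n.-tuple R * m.-tuple R.

Let N := horizon eps.

Definition stage_iterations (h : nat) (P : 'M[R]_n) : nat :=
  iterations zeta P (K0 h) (accuracy eps N h).

Definition stage_gain (h : nat) (P : 'M[R]_n) : 'M[R]_(m, n) :=
  sgd zeta P (K0 h) (z h) (stage_iterations h P).

(* [Pback k] is P~_{N-k} *)
Fixpoint Pback (k : nat) : 'M[R]_n :=
  if k is l.+1 then policy_cost (Pback l) (stage_gain (N - k) (Pback l))
  else QN.

Definition rhpg_P (h : nat) : 'M[R]_n := Pback (N - h).
Definition rhpg_T (h : nat) : nat := stage_iterations h (rhpg_P h.+1).
Definition rhpg_K (h : nat) : 'M[R]_(m, n) := stage_gain h (rhpg_P h.+1).

Definition sample_count : nat := (\sum_(h < N) rhpg_T h)%N.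

End algorithm.
End problem.

Section samples.
Context d (T : measurableType d) (R : realType) (P : probability T R).

Definition mutually_independent d' (T' : measurableType d') (I : choiceType)
    (X : I -> T -> T') : Prop :=
  forall (s : seq I) (V : I -> set T'), uniq s ->
    (forall k, measurable (V k)) ->
    P (\bigcap_(k in [set` s]) (X k @^-1` V k))
    = (\prod_(k <- s) P (X k @^-1` V k))%E.

(* [Z h i] is the pair (x_0, eta) drawn at iteration i of stage h: x_0 has law
   D, eta has law N(0, I_m) (the product of m standard normal laws), they are
   independent, and draws at different (h, i) are mutually independent. *)
Definition fresh_samples n m (D : probability (n.-tuple R) R)
    (Z : nat -> nat -> {mfun T >-> (n.-tuple R * m.-tuple R)%type}) : Prop :=
  [/\ forall h i V, measurable V -> P [set w | V (Z h i w).1] = D V,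
      forall h i (V : 'I_m -> set R), (forall j, measurable (V j)) ->
        P [set w | forall j, V j (tnth (Z h i w).2 j)]
        = (\prod_(j < m) normal_prob 0 1 (V j))%E,
      forall h i V W, measurable V -> measurable W ->
        P [set w | V (Z h i w).1 /\ W (Z h i w).2]
        = (P [set w | V (Z h i w).1] * P [set w | W (Z h i w).2])%E &
      mutually_independent (fun k : nat * nat => Z k.1 k.2 : T -> _)].

End samples.

(* Main.v *)
Require Import Defs.
From HB Require Import structures.
From mathcomp Require Import all_boot all_order all_algebra.
From mathcomp Require Import ring lra.
From mathcomp Require Import all_classical all_reals all_analysis.
From mathcomp Require Import measurable_realfun.

(* With G the optimal gain of stage h, the surrogate cost exceeds its minimum by
   gap K = tr ((K - G)^T (R + B^T P B) (K - G) S_0), a gradient-dominated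
   quadratic, and the stochastic direction is minus an unbiased estimate of its
   gradient. The cost is a polynomial of degree two in the Gaussian noise, so only
   Gaussian moments of order at most six enter. Stopping the recursion when the
   gap exceeds 10 J(K_0)/zeta makes the constants of the algorithm valid bounds.
   A supermartingale argument and Markov's inequality bound the probability of
   stopping by 3 zeta/10; the O(1/T) rate of the gap and Markov's inequality bound
   that of a final inaccuracy by 7 zeta/10. The samples of stage h are independent
   of those of the stages executed before it, so conditioning on the past reduces
   every expectation to an integral over one sample.

   On the intersection of the good events the value matrices satisfy
   (1 - d) P_t <= P~_t <= (1 + d) P_t for a relative error d that an exact
   Riccati step does not increase and an inaccurate gain increases by at most
   C_3 vs^2 / (4 a); the horizon makes the exact recursion forget Q_N. Each T_h
   is then O(zeta^-3 eps^-2 N), and N is O(log (1/eps)). *)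

Set Implicit Arguments.
Unset Strict Implicit.
Unset Printing Implicit Defensive.

Import Order.TTheory GRing.Theory Num.Theory.
Import numFieldNormedType.Exports.

Local Open Scope classical_set_scope.
Local Open Scope ring_scope.

(** * Quadratic forms and spectral quantities *)

(** The value matrix met at a stage is random, and with it the step sizes, the exit threshold and
    the number of iterations. Every estimate inside a stage is therefore integrated against an
    arbitrary nonnegative weight determined before the stage. This replaces conditional
    expectations, and random contraction factors and thresholds are absorbed into the weight. Value
    errors are relative because the Riccati map is monotone and adds nonnegative terms; an additive
    error would be multiplied by squared closed-loop norms, which may exceed 1. One power of 1/zeta
    is explicit in T_h and two come from theta through xi1^2. The order eps^-2 is forced by stage 0,
    of accuracy eps/4; the squared accuracies of the other stages are of order eps/N. *)

Section frobenius.
Context {R : realType}.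
Implicit Types k l p : nat.

(** The Frobenius product. Vectors being one-column matrices, it is also the Euclidean product, so
    one set of rules serves both norms. *)
Definition fdot k l (X Y : 'M[R]_(k, l)) : R := \tr (X^T *m Y).

Lemma fdotE k l (X Y : 'M[R]_(k, l)) :
  fdot X Y = \sum_i \sum_j X i j * Y i j.
Proof.
rewrite exchange_big /fdot /mxtrace; apply: eq_bigr => j _.
by rewrite mxE; apply: eq_bigr => i _; rewrite mxE.
Qed.

Lemma fdotC k l (X Y : 'M[R]_(k, l)) : fdot X Y = fdot Y X.
Proof. by rewrite !fdotE; do 2![apply: eq_bigr => ? _]; rewrite mulrC. Qed.

Lemma fdotDr k l (X Y Z : 'M[R]_(k, l)) : fdot X (Y + Z) = fdot X Y + fdot X Z.
Proof. by rewrite /fdot mulmxDr raddfD. Qed.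

Lemma fdotDl k l (X Y Z : 'M[R]_(k, l)) : fdot (X + Y) Z = fdot X Z + fdot Y Z.
Proof. by rewrite !(fdotC _ Z) fdotDr. Qed.

Lemma fdotZr k l a (X Y : 'M[R]_(k, l)) : fdot X (a *: Y) = a * fdot X Y.
Proof. by rewrite /fdot -scalemxAr linearZ. Qed.

Lemma fdotZl k l a (X Y : 'M[R]_(k, l)) : fdot (a *: X) Y = a * fdot X Y.
Proof. by rewrite fdotC fdotZr fdotC. Qed.

Lemma fdotNr k l (X Y : 'M[R]_(k, l)) : fdot X (- Y) = - fdot X Y.
Proof. by rewrite -scaleN1r fdotZr mulN1r. Qed.

Lemma fdotNl k l (X Y : 'M[R]_(k, l)) : fdot (- X) Y = - fdot X Y.
Proof. by rewrite fdotC fdotNr fdotC. Qed.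

Definition fdotBr k l (X Y Z : 'M[R]_(k, l)) :
  fdot X (Y - Z) = fdot X Y - fdot X Z.
Proof. by rewrite fdotDr fdotNr. Qed.

Lemma fdot0r k l (X : 'M[R]_(k, l)) : fdot X 0 = 0.
Proof. by rewrite /fdot mulmx0 raddf0. Qed.

Lemma fdot0l k l (X : 'M[R]_(k, l)) : fdot 0 X = 0.
Proof. by rewrite fdotC fdot0r. Qed.

Lemma fdot_ge0 k l (X : 'M[R]_(k, l)) : 0 <= fdot X X.
Proof.
by rewrite fdotE; do 2![apply: sumr_ge0 => ? _]; rewrite -expr2 sqr_ge0.
Qed.

Lemma fdot_eq0 k l (X : 'M[R]_(k, l)) : (fdot X X == 0) = (X == 0).
Proof.
apply/eqP/eqP => [|->]; last by rewrite fdot0r.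
move=> X0; apply/matrixP => i j; rewrite mxE; move: X0; rewrite fdotE.
have ge0 a b : 0 <= X a b * X a b by rewrite -expr2 sqr_ge0.
move/eqP; rewrite psumr_eq0; last by move=> *; apply: sumr_ge0.
move=> /allP/(_ i); rewrite mem_index_enum => /(_ isT) /=.
rewrite psumr_eq0 // => /allP/(_ j); rewrite mem_index_enum => /(_ isT) /=.
by rewrite mulf_eq0 orbb => /eqP.
Qed.

Lemma fdot_gt0 k l (X : 'M[R]_(k, l)) : (0 < fdot X X) = (X != 0).
Proof. by rewrite lt_neqAle fdot_ge0 andbT eq_sym fdot_eq0. Qed.

(* Nonnegativity of [s^2 a + 2 s b + c] for all [s] bounds the discriminant. *)
Lemma discr_le (a b c : R) : 0 <= a ->
  (forall s, 0 <= s ^+ 2 * a + 2 * s * b + c) -> b ^+ 2 <= a * c.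
Proof.
move=> a0 H; have [a_eq0|an0] := eqVneq a 0.
  rewrite a_eq0 mul0r; have [->|bn0] := eqVneq b 0; first by rewrite expr0n.
  have := H (- (c + 1) / (2 * b)).
  have -> : 2 * (- (c + 1) / (2 * b)) * b = - (c + 1) by field.
  by rewrite a_eq0; lra.
have ap : 0 < a by rewrite lt_neqAle eq_sym an0.
have := H (- b / a).
have -> : (- b / a) ^+ 2 * a + 2 * (- b / a) * b + c = (a * c - b ^+ 2) / a.
  by field.
by rewrite pmulr_lge0 ?invr_gt0// subr_ge0.
Qed.

Lemma fdot_CS k l (X Y : 'M[R]_(k, l)) : fdot X Y ^+ 2 <= fdot X X * fdot Y Y.
Proof.
apply: discr_le; first exact: fdot_ge0.
move=> s; have := fdot_ge0 (s *: X + Y).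
rewrite !(fdotDl, fdotDr, fdotZl, fdotZr) (fdotC Y X); lra.
Qed.

(** Cauchy-Schwarz on each entry of the product. When [Y] is a vector, this bounds the spectral norm
    by the Frobenius norm. *)
Lemma fdot_mul k l p (X : 'M[R]_(k, l)) (Y : 'M[R]_(l, p)) :
  fdot (X *m Y) (X *m Y) <= fdot X X * fdot Y Y.
Proof.
rewrite (fdotE (X *m Y)) (fdotE X) mulr_suml; apply: ler_sum => i _.
rewrite (fdotE Y) [X in _ <= _ * X]exchange_big mulr_sumr.
apply: ler_sum => j _; rewrite mxE -expr2.
set a : 'M[R]_(l, 1) := \col_h X i h; set b : 'M[R]_(l, 1) := \col_h Y h j.
have fab (u v : 'cV[R]_l) : fdot u v = \sum_h u h 0 * v h 0.
  by rewrite fdotE; apply: eq_bigr => h _; rewrite big_ord1.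
have := fdot_CS a b; rewrite !fab.
have ab : \sum_h a h 0 * b h 0 = \sum_h X i h * Y h j.
  by apply: eq_bigr => h _; rewrite !mxE.
have aa : \sum_h a h 0 * a h 0 = \sum_h X i h * X i h.
  by apply: eq_bigr => h _; rewrite !mxE.
have bb : \sum_h b h 0 * b h 0 = \sum_h Y h j * Y h j.
  by apply: eq_bigr => h _; rewrite !mxE.
by rewrite ab aa bb.
Qed.

Lemma fdot_adj k l p (M : 'M[R]_(k, l)) (X : 'M[R]_(k, p)) (Y : 'M[R]_(l, p)) :
  fdot X (M *m Y) = fdot (M^T *m X) Y.
Proof. by rewrite /fdot trmx_mul trmxK mulmxA. Qed.

Lemma vnormE k (x : 'cV[R]_k) : vnorm x = Num.sqrt (fdot x x).
Proof.
rewrite /vnorm fdotE; congr Num.sqrt; apply: eq_bigr => i _.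
by rewrite big_ord1 expr2.
Qed.

Lemma vnorm_ge0 k (x : 'cV[R]_k) : 0 <= vnorm x. Proof. exact: sqrtr_ge0. Qed.

Lemma sqr_vnorm k (x : 'cV[R]_k) : vnorm x ^+ 2 = fdot x x.
Proof. by rewrite vnormE sqr_sqrtr// fdot_ge0. Qed.

Lemma vnorm_gt0 k (x : 'cV[R]_k) : x != 0 -> 0 < vnorm x.
Proof. by move=> x0; rewrite vnormE sqrtr_gt0 fdot_gt0. Qed.

Lemma vnorm0 k : vnorm (0 : 'cV[R]_k) = 0.
Proof. by rewrite vnormE fdot0l sqrtr0. Qed.

Lemma vnorm_le k l (x : 'cV[R]_k) (y : 'cV[R]_l) c : 0 <= c ->
  (vnorm x <= c * vnorm y) = (fdot x x <= c ^+ 2 * fdot y y).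
Proof.
move=> c0; rewrite -(ler_pXn2r (n := 2))// ?nnegrE ?vnorm_ge0 ?mulr_ge0 ?vnorm_ge0//.
by rewrite exprMn !sqr_vnorm.
Qed.

Lemma fdot_vnorm k (x y : 'cV[R]_k) : `|fdot x y| <= vnorm x * vnorm y.
Proof.
rewrite -(ler_pXn2r (n := 2))// ?nnegrE ?mulr_ge0 ?vnorm_ge0//.
by rewrite exprMn !sqr_vnorm real_normK ?num_real// fdot_CS.
Qed.

Lemma vnormD k (x y : 'cV[R]_k) : vnorm (x + y) <= vnorm x + vnorm y.
Proof.
rewrite -(ler_pXn2r (n := 2))// ?nnegrE ?addr_ge0 ?vnorm_ge0//.
rewrite sqrrD !sqr_vnorm fdotDl !fdotDr (fdotC y x).
have := le_trans (ler_norm _) (fdot_vnorm x y); rewrite mulr2n; lra.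
Qed.

Lemma fdotD_le k (x y : 'cV[R]_k) :
  fdot (x + y) (x + y) <= 2 * fdot x x + 2 * fdot y y.
Proof.
have := fdot_ge0 (x - y).
rewrite !(fdotDl, fdotDr, fdotNl, fdotNr) (fdotC y x); lra.
Qed.

Lemma specnorm_has_sup k l (X : 'M[R]_(k, l)) : has_ubound
  [set r | exists2 z : 'cV[R]_l, z != 0 & r = vnorm (X *m z) / vnorm z].
Proof.
exists (Num.sqrt (fdot X X)) => _ [z z0 ->].
rewrite ler_pdivrMr ?vnorm_gt0// vnorm_le ?sqrtr_ge0//.
by rewrite sqr_sqrtr ?fdot_ge0// fdot_mul.
Qed.

Lemma specnorm_ub k l (X : 'M[R]_(k, l)) (z : 'cV[R]_l) :
  vnorm (X *m z) <= specnorm X * vnorm z.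
Proof.
have [->|z0] := eqVneq z 0; first by rewrite mulmx0 !vnorm0 mulr0.
rewrite -ler_pdivrMr ?vnorm_gt0//.
by apply: ub_le_sup; [exact: specnorm_has_sup|exists z].
Qed.

Lemma specnorm_le k l (X : 'M[R]_(k, l)) c : 0 <= c ->
  (forall z : 'cV[R]_l, vnorm (X *m z) <= c * vnorm z) -> specnorm X <= c.
Proof.
move=> c0 H; rewrite /specnorm; set S := [set r | _].
have [->|/set0P S0] := eqVneq S set0; first by rewrite sup0.
apply: ge_sup => // _ [z z0 ->].
by rewrite ler_pdivrMr ?vnorm_gt0.
Qed.

Lemma specnorm_ge0 k l (X : 'M[R]_(k, l)) : 0 <= specnorm X.
Proof.
rewrite /specnorm; set S := [set r | _].
have [->|/set0P[r Sr]] := eqVneq S set0; first by rewrite sup0.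
apply: le_trans (ub_le_sup (specnorm_has_sup X) Sr).
by case: Sr => z _ ->; rewrite divr_ge0 ?vnorm_ge0.
Qed.

Lemma specnorm_ub2 k l (X : 'M[R]_(k, l)) (z : 'cV[R]_l) :
  fdot (X *m z) (X *m z) <= specnorm X ^+ 2 * fdot z z.
Proof. by rewrite -vnorm_le ?specnorm_ge0 ?specnorm_ub. Qed.

Lemma specnorm_le2 k l (X : 'M[R]_(k, l)) c : 0 <= c ->
  (forall z : 'cV[R]_l, fdot (X *m z) (X *m z) <= c ^+ 2 * fdot z z) ->
  specnorm X <= c.
Proof. by move=> c0 H; apply: specnorm_le => // z; rewrite vnorm_le. Qed.

Lemma specnorm_fdot k l (X : 'M[R]_(k, l)) : specnorm X <= Num.sqrt (fdot X X).
Proof.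
apply: specnorm_le2; first exact: sqrtr_ge0.
by move=> z; rewrite sqr_sqrtr ?fdot_ge0// fdot_mul.
Qed.

Lemma specnormM k l p (X : 'M[R]_(k, l)) (Y : 'M[R]_(l, p)) :
  specnorm (X *m Y) <= specnorm X * specnorm Y.
Proof.
apply: specnorm_le => [|z]; first by rewrite mulr_ge0 ?specnorm_ge0.
rewrite -mulmxA; apply: le_trans (specnorm_ub _ _) _.
by rewrite -mulrA ler_wpM2l ?specnorm_ge0 ?specnorm_ub.
Qed.

Lemma specnormD k l (X Y : 'M[R]_(k, l)) :
  specnorm (X + Y) <= specnorm X + specnorm Y.
Proof.
apply: specnorm_le => [|z]; first by rewrite addr_ge0 ?specnorm_ge0.
rewrite mulmxDl mulrDl; apply: le_trans (vnormD _ _) _.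
by rewrite lerD ?specnorm_ub.
Qed.

Lemma specnorm_eq0 k l (X : 'M[R]_(k, l)) : specnorm X = 0 -> X = 0.
Proof.
move=> X0; apply/matrixP => i j; rewrite [RHS]mxE.
have := specnorm_ub2 X (delta_mx j 0); rewrite X0 expr0n mul0r => H.
have : X *m delta_mx j (0 : 'I_1) == 0 by rewrite -fdot_eq0 eq_le H fdot_ge0.
by rewrite -colE => /eqP/matrixP/(_ i 0); rewrite !mxE.
Qed.

(** With [y = X^T z], [|y|^2 = <z, X y> <= |z| |X| |y|]; divide by [|y|]. *)
Lemma specnorm_tr k l (X : 'M[R]_(k, l)) : specnorm X^T <= specnorm X.
Proof.
apply: specnorm_le2 => [|z]; first exact: specnorm_ge0.
set y := X^T *m z.
have h : fdot y y = fdot z (X *m y) by rewrite fdot_adj.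
have := fdot_CS z (X *m y); rewrite -h.
have [->|y0] := eqVneq (fdot y y) 0.
  by rewrite mulr_ge0 ?sqr_ge0 ?fdot_ge0.
have yp : 0 < fdot y y by rewrite lt_neqAle eq_sym y0 fdot_ge0.
move=> H; rewrite -(ler_pM2l yp) -expr2; apply: le_trans H _.
rewrite [leRHS](_ : _ = fdot z z * (specnorm X ^+ 2 * fdot y y)); last by ring.
by rewrite ler_wpM2l ?fdot_ge0 ?specnorm_ub2.
Qed.

Lemma quadformE k (X : 'M[R]_k) (x : 'cV[R]_k) : quadform X x = fdot x (X *m x).
Proof. by rewrite /quadform /fdot /mxtrace big_ord1 mulmxA. Qed.

Lemma quadformD k (X Y : 'M[R]_k) (x : 'cV[R]_k) :
  quadform (X + Y) x = quadform X x + quadform Y x.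
Proof. by rewrite !quadformE mulmxDl fdotDr. Qed.

Lemma quadformN k (X : 'M[R]_k) (x : 'cV[R]_k) : quadform (- X) x = - quadform X x.
Proof. by rewrite !quadformE mulNmx fdotNr. Qed.

Lemma quadformB k (X Y : 'M[R]_k) (x : 'cV[R]_k) :
  quadform (X - Y) x = quadform X x - quadform Y x.
Proof. by rewrite quadformD quadformN. Qed.

Lemma quadformZ k a (X : 'M[R]_k) (x : 'cV[R]_k) :
  quadform (a *: X) x = a * quadform X x.
Proof. by rewrite !quadformE -scalemxAl fdotZr. Qed.

Lemma quadform_scal k a (x : 'cV[R]_k) : quadform a%:M x = a * fdot x x.
Proof. by rewrite quadformE mul_scalar_mx fdotZr. Qed.

Lemma quadform_conj k l (X : 'M[R]_k) (Y : 'M[R]_(k, l)) (x : 'cV[R]_l) :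
  quadform (Y^T *m X *m Y) x = quadform X (Y *m x).
Proof. by rewrite !quadformE -!mulmxA fdot_adj trmxK. Qed.

Lemma quadform_specnorm k (X : 'M[R]_k) (x : 'cV[R]_k) :
  `|quadform X x| <= specnorm X * fdot x x.
Proof.
rewrite quadformE; apply: le_trans (fdot_vnorm _ _) _.
rewrite -sqr_vnorm expr2 mulrCA ler_wpM2l ?vnorm_ge0//.
exact: specnorm_ub.
Qed.

Lemma quadform_le_specnorm k (X : 'M[R]_k) (x : 'cV[R]_k) :
  quadform X x <= specnorm X * fdot x x.
Proof. exact: le_trans (ler_norm _) (quadform_specnorm _ _). Qed.

Lemma quadform_vecD k (X : 'M[R]_k) (x y : 'cV[R]_k) : X^T = X ->
  quadform X (x + y) = quadform X x + 2 * fdot (X *m x) y + quadform X y.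
Proof.
move=> sX; rewrite !quadformE mulmxDr !(fdotDl, fdotDr).
rewrite (fdot_adj X x y) sX (fdotC y); ring.
Qed.

Lemma quadform_vecZ k (X : 'M[R]_k) a (x : 'cV[R]_k) :
  quadform X (a *: x) = a ^+ 2 * quadform X x.
Proof. by rewrite !quadformE -scalemxAr fdotZl fdotZr mulrA expr2. Qed.

Lemma psd_CS k (X : 'M[R]_k) (x y : 'cV[R]_k) : possemidef X ->
  fdot x (X *m y) ^+ 2 <= quadform X x * quadform X y.
Proof.
move=> [sX pX]; apply: discr_le => // s.
have := pX (s *: x + y); rewrite quadform_vecD// quadform_vecZ.
by rewrite -scalemxAr fdotZl fdot_adj sX; lra.
Qed.

(** The inequality [X^2 <= c X] for [0 <= X <= c I], without square roots of matrices:
    Cauchy-Schwarz for the form [X] at [X z] and [z], divided by [|X z|^2]. *)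
Lemma psd_le_sqr k (X : 'M[R]_k) c (z : 'cV[R]_k) : possemidef X ->
  (forall z, quadform X z <= c * fdot z z) ->
  fdot (X *m z) (X *m z) <= c * quadform X z.
Proof.
move=> pX H; have := psd_CS (X *m z) z pX; set y := X *m z.
have [->|y0] := eqVneq (fdot y y) 0.
  move=> _; have [z0|z0] := eqVneq (fdot z z) 0.
    move/eqP: z0; rewrite fdot_eq0 => /eqP ->.
    by rewrite quadformE fdot0l mulr0.
  rewrite mulr_ge0 ?(proj2 pX)//; have := le_trans (proj2 pX z) (H z).
  by rewrite pmulr_lge0// lt_neqAle eq_sym z0 fdot_ge0.
have yp : 0 < fdot y y by rewrite lt_neqAle eq_sym y0 fdot_ge0.
move=> h; rewrite -(ler_pM2l yp) -expr2; apply: le_trans h _.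
rewrite mulrCA mulrA; apply: ler_wpM2r; first exact: (proj2 pX).
exact: H.
Qed.

Lemma psd_specnorm_le k (X : 'M[R]_k) c : 0 <= c -> possemidef X ->
  (forall z, quadform X z <= c * fdot z z) -> specnorm X <= c.
Proof.
move=> c0 pX H; apply: specnorm_le2 => // z.
apply: le_trans (psd_le_sqr z pX H) _.
by rewrite expr2 -mulrA ler_wpM2l.
Qed.

Lemma posdef_psd k (X : 'M[R]_k) : posdef X -> possemidef X.
Proof.
move=> [sX pX]; split=> // x; have [->|/pX/ltW//] := eqVneq x 0.
by rewrite quadformE fdot0l.
Qed.

Lemma cV_neq0 k : (0 < k)%N -> exists z : 'cV[R]_k, z != 0.
Proof.
move=> k0; exists (const_mx 1); apply/eqP => /matrixP/(_ (Ordinal k0) 0).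
by rewrite !mxE => /eqP; rewrite oner_eq0.
Qed.

Lemma posdef_unit k (X : 'M[R]_k) : posdef X -> X \in unitmx.
Proof.
move=> [sX pX]; rewrite -row_free_unit -kermx_eq0; apply/eqP/row_matrixP => i.
rewrite row0; apply/eqP; apply: contraT => v0; set v := row i _ in v0.
have vX : v *m X = 0 by rewrite /v -row_mul mulmx_ker row0.
have := pX v^T; rewrite trmx_eq0 => /(_ v0).
by rewrite /quadform trmxK vX mul0mx mxE ltxx.
Qed.

(* If the form minus its infimum were invertible, Cauchy-Schwarz would bound
   it from below by a positive multiple of the identity. *)
Lemma sym_min_eigen k (X : 'M[R]_k) : (0 < k)%N -> X^T = X ->
  exists2 a, eigenvalue X a & forall z, a * fdot z z <= quadform X z.
Proof.
move=> k0 sX.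
pose S := [set r | exists2 z : 'cV[R]_k, z != 0 & r = quadform X z / fdot z z].
have S0 : S !=set0.
  by have [z z0] := cV_neq0 k0; exists (quadform X z / fdot z z), z.
have Slb : has_lbound S.
  exists (- specnorm X) => _ [z z0 ->]; rewrite ler_pdivlMr ?fdot_gt0//.
  by have := quadform_specnorm X z; rewrite ler_norml mulNr => /andP[].
have Xge z : inf S * fdot z z <= quadform X z.
  have [->|z0] := eqVneq z 0; first by rewrite quadformE !fdot0l mulr0.
  rewrite -ler_pdivlMr ?fdot_gt0//; apply: ge_inf => //; exists z => //.
exists (inf S) => //.
pose Y := X - (inf S)%:M.
have qY z : quadform Y z = quadform X z - inf S * fdot z z.
  by rewrite quadformB quadform_scal.
have pY : possemidef Y.
  split; first by rewrite /Y linearB /= sX tr_scalar_mx.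
  by move=> z; rewrite qY subr_ge0.
have [uY|nuY] := boolP (Y \in unitmx); last first.
  move: nuY; rewrite -row_free_unit -kermx_eq0 => nz.
  rewrite /eigenvalue /eigenspace; exact: nz.
exfalso; pose a := specnorm (invmx Y); pose b := specnorm Y.
have a_gt0 : 0 < a.
  rewrite lt_neqAle specnorm_ge0 andbT eq_sym; apply/eqP => /specnorm_eq0 iY0.
  have [z /eqP[]] := cV_neq0 k0.
  by rewrite -[z]mul1mx -(mulVmx uY) iY0 !mul0mx.
have b_gt0 : 0 < b.
  rewrite lt_neqAle specnorm_ge0 andbT eq_sym; apply/eqP => /specnorm_eq0 iY0.
  have [z /eqP[]] := cV_neq0 k0.
  by rewrite -[z]mul1mx -(mulVmx uY) iY0 mulmx0 !mul0mx.
have lowY z : fdot z z <= a ^+ 2 * b * quadform Y z.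
  rewrite -[in leLHS](mul1mx z) -(mulVmx uY) -!mulmxA.
  apply: le_trans (specnorm_ub2 _ _) _; rewrite -mulrA ler_wpM2l ?sqr_ge0//.
  apply: psd_le_sqr => // y; exact: quadform_le_specnorm.
have c_gt0 : 0 < a ^+ 2 * b by rewrite mulr_gt0 ?exprn_gt0.
have : inf S + (a ^+ 2 * b)^-1 <= inf S.
  apply: lb_le_inf => // _ [z z0 ->]; rewrite ler_pdivlMr ?fdot_gt0//.
  have := lowY z; rewrite qY -ler_pdivrMl// mulrDl; lra.
by rewrite gerDl leNgt invr_gt0 c_gt0.
Qed.

Lemma sym_eigenP k (X : 'M[R]_k) a : X^T = X -> eigenvalue X a ->
  exists2 v : 'cV[R]_k, v != 0 & X *m v = a *: v.
Proof.
move=> sX /eigenvalueP[v vX v0]; exists v^T; first by rewrite trmx_eq0.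
by rewrite -[in LHS]sX -trmx_mul vX linearZ.
Qed.

Lemma eigen_ge k (X : 'M[R]_k) a c : X^T = X -> eigenvalue X a ->
  (forall z, c * fdot z z <= quadform X z) -> c <= a.
Proof.
move=> sX /(sym_eigenP sX)[v v0 Xv] /(_ v).
by rewrite quadformE Xv fdotZr ler_pM2r// fdot_gt0.
Qed.

Lemma lambda_min_eigen k (X : 'M[R]_k) : (0 < k)%N -> X^T = X ->
  eigenvalue X (lambda_min X).
Proof.
move=> k0 sX; have [a ea Ha] := sym_min_eigen k0 sX.
suff -> : lambda_min X = a by [].
apply/eqP; rewrite eq_le; apply/andP; split.
  apply: ge_inf; last exact: ea.
  by exists a => b eb; apply: eigen_ge eb Ha.
by apply: lb_le_inf; [exists a|move=> b eb; apply: eigen_ge eb Ha].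
Qed.

Lemma lambda_min_le k (X : 'M[R]_k) z : (0 < k)%N -> X^T = X ->
  lambda_min X * fdot z z <= quadform X z.
Proof.
move=> k0 sX; have [a ea Ha] := sym_min_eigen k0 sX.
apply: le_trans (Ha z); rewrite ler_wpM2r ?fdot_ge0//.
by apply: ge_inf => //; exists a => b eb; apply: eigen_ge eb Ha.
Qed.

Lemma lambda_min_gt0 k (X : 'M[R]_k) : (0 < k)%N -> posdef X ->
  0 < lambda_min X.
Proof.
move=> k0 [sX pX]; have := lambda_min_eigen k0 sX.
move=> /(sym_eigenP sX)[v v0 Xv].
by have := pX v v0; rewrite quadformE Xv fdotZr pmulr_lgt0// fdot_gt0.
Qed.

(** If [X^2 v = s^2 v] then [s |v| = |X v|], and [|v| |X v| >= <v, X v> >= a |v|^2] gives [a <= s].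
    An eigenvector of [X] for [a] shows that [a] is attained. *)
Lemma sigma_min_posdef k (X : 'M[R]_k) : (0 < k)%N -> posdef X ->
  sigma_min X = lambda_min X.
Proof.
move=> k0 pX; have [sX _] := pX; have a0 := lambda_min_gt0 k0 pX.
set a := lambda_min X in a0 *.
pose S := [set s | 0 <= s /\ eigenvalue (X^T *m X) (s ^+ 2)].
have lb s : S s -> a <= s.
  move=> [s0]; rewrite sX => es.
  have sX2 : (X *m X)^T = X *m X by rewrite trmx_mul sX.
  have [v v0 Xv] := sym_eigenP sX2 es.
  rewrite -(ler_pXn2r (n := 2))// ?nnegrE ?(ltW a0)//.
  rewrite -(ler_pM2r (_ : 0 < fdot v v)) ?fdot_gt0//.
  rewrite -[leRHS]fdotZr -Xv -mulmxA fdot_adj sX.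
  have h := lambda_min_le v k0 sX; rewrite -/a in h.
  rewrite quadformE in h; have h2 := fdot_CS v (X *m v).
  have vp : 0 < fdot v v by rewrite fdot_gt0.
  rewrite -(ler_pM2l vp); apply: le_trans h2.
  have av : 0 < a * fdot v v by rewrite mulr_gt0.
  have -> : fdot v v * (a ^+ 2 * fdot v v) = (a * fdot v v) ^+ 2 by ring.
  by rewrite ler_pXn2r ?nnegrE ?(ltW av)// (le_trans (ltW av)).
have Sa : S a.
  split; first exact: ltW.
  have /eigenvalueP[v vX v0] := lambda_min_eigen k0 sX.
  apply/eigenvalueP; exists v => //.
  by rewrite sX mulmxA vX -scalemxAl vX scalerA.
apply/eqP; rewrite eq_le; apply/andP; split.
  by apply: ge_inf => //; exists a.
by apply: lb_le_inf => //; exists a.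
Qed.

Lemma psd_max_eigen k (X : 'M[R]_k) : (0 < k)%N -> X^T = X ->
  exists2 v : 'cV[R]_k, v != 0 &
  exists2 b, X *m v = b *: v & forall z, quadform X z <= b * fdot z z.
Proof.
move=> k0 sX; have sNX : (- X)^T = - X by rewrite linearN /= sX.
have [a ea Ha] := sym_min_eigen k0 sNX.
have [v v0 Xv] := sym_eigenP sNX ea.
exists v => //; exists (- a); first by rewrite scaleNr -Xv mulNmx opprK.
by move=> z; have := Ha z; rewrite quadformN; lra.
Qed.

Lemma posdef_of_lb k (X : 'M[R]_k) c : 0 < c -> X^T = X ->
  (forall z, c * fdot z z <= quadform X z) -> posdef X.
Proof.
move=> c0 sX H; split=> // x x0; apply: lt_le_trans (H x).
by rewrite mulr_gt0 ?fdot_gt0.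
Qed.

(** Coercivity and Cauchy-Schwarz give [c |y| <= |X y|], applied to [y = X^-1 z]. *)
Lemma specnorm_inv_le k (X : 'M[R]_k) c : 0 < c -> X^T = X ->
  (forall z, c * fdot z z <= quadform X z) -> specnorm (invmx X) <= c^-1.
Proof.
move=> c0 sX H; have uX := posdef_unit (posdef_of_lb c0 sX H).
apply: specnorm_le2 => [|z]; first by rewrite invr_ge0 ltW.
set y := invmx X *m z.
have -> : z = X *m y by rewrite /y mulmxA mulmxV// mul1mx.
have [->|y0] := eqVneq (fdot y y) 0.
  by rewrite mulr_ge0 ?sqr_ge0 ?fdot_ge0.
have yp : 0 < fdot y y by rewrite lt_neqAle eq_sym y0 fdot_ge0.
rewrite exprVn -ler_pdivrMl ?invr_gt0 ?exprn_gt0// invrK.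
rewrite -(ler_pM2l yp); apply: le_trans (fdot_CS y (X *m y)).
have := H y; rewrite quadformE => Hy.
have cy : 0 < c * fdot y y by rewrite mulr_gt0.
have -> : fdot y y * (c ^+ 2 * fdot y y) = (c * fdot y y) ^+ 2 by ring.
by rewrite ler_pXn2r ?nnegrE ?(ltW cy)// (le_trans (ltW cy)).
Qed.

(** Cauchy-Schwarz for the form [X] at [X^-1 z] and [z] reads [|z|^4 <= <z, X^-1 z> <z, X z>]. *)
Lemma posdef_inv_lb k (X : 'M[R]_k) z : posdef X ->
  fdot z z <= specnorm (invmx X) * quadform X z.
Proof.
move=> pX; have uX := posdef_unit pX; have [sX _] := pX.
have [->|z0] := eqVneq z 0; first by rewrite fdot0l quadformE fdot0l mulr0.
have zp : 0 < fdot z z by rewrite fdot_gt0.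
have := psd_CS (invmx X *m z) z (posdef_psd pX).
rewrite fdot_adj sX mulmxA mulmxV// mul1mx.
rewrite (quadformE _ (_ *m z)) mulmxA mulmxV// mul1mx => h.
rewrite -(ler_pM2l zp) -expr2; apply: le_trans h _.
rewrite mulrA ler_wpM2r ?(proj2 (posdef_psd pX))//.
by rewrite fdotC -quadformE mulrC quadform_le_specnorm.
Qed.

Lemma starnorm_ub k (P X : 'M[R]_k) z : posdef P ->
  quadform P (X *m z) <= starnorm P X ^+ 2 * quadform P z.
Proof.
move=> pP; have [->|z0] := eqVneq z 0.
  by rewrite mulmx0 quadformE fdot0l mulr_ge0 ?sqr_ge0 ?(proj2 (posdef_psd pP)).
rewrite /starnorm; set S := [set r | _].
have Sz : S (quadform P (X *m z) / quadform P z).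
  by exists z; rewrite // quadform_conj.
have Sge0 r : S r -> 0 <= r.
  case=> y _ ->; rewrite quadform_conj.
  by rewrite divr_ge0 ?(proj2 (posdef_psd pP)).
have uS : has_ubound S.
  exists (specnorm P * specnorm X ^+ 2 * specnorm (invmx P)) => _ [y y0 ->].
  rewrite quadform_conj ler_pdivrMr ?(proj2 pP)//.
  apply: le_trans (quadform_le_specnorm _ _) _.
  rewrite -mulrA -mulrA ler_wpM2l ?specnorm_ge0// -mulrA.
  apply: le_trans (specnorm_ub2 _ _) _.
  by rewrite ler_wpM2l ?sqr_ge0 ?posdef_inv_lb.
have h := ub_le_sup uS Sz.
rewrite sqr_sqrtr; last exact: le_trans (Sge0 _ Sz) h.
by rewrite -ler_pdivrMr ?(proj2 pP).
Qed.

Lemma starnorm_le k (P X : 'M[R]_k) c : 0 <= c -> posdef P ->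
  (forall z, quadform P (X *m z) <= c ^+ 2 * quadform P z) -> starnorm P X <= c.
Proof.
move=> c0 pP H; rewrite /starnorm -[leRHS](ger0_norm c0) -sqrtr_sqr ler_wsqrtr//; set S := [set r | _].
have [->|/set0P S0] := eqVneq S set0; first by rewrite sup0 sqr_ge0.
apply: ge_sup => // _ [z z0 ->].
by rewrite quadform_conj ler_pdivrMr ?(proj2 pP).
Qed.

Lemma starnorm_ge0 k (P X : 'M[R]_k) : 0 <= starnorm P X.
Proof. exact: sqrtr_ge0. Qed.

(* A symmetric operator has an eigenvector for its spectral radius, and the
   spectral radius is a lower bound for every operator norm. *)
Lemma psd_le_starnorm k (P X : 'M[R]_k) z : (0 < k)%N -> posdef P ->
  possemidef X -> quadform X z <= starnorm P X * fdot z z.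
Proof.
move=> k0 pP [sX pX]; have [v v0 [b Xv Hb]] := psd_max_eigen k0 sX.
apply: le_trans (Hb z) _; rewrite ler_wpM2r ?fdot_ge0//.
have b0 : 0 <= b.
  by have := pX v; rewrite quadformE Xv fdotZr pmulr_lge0// fdot_gt0.
have := starnorm_ub X v pP; rewrite Xv quadform_vecZ ler_pM2r ?(proj2 pP)//.
by rewrite ler_pXn2r ?nnegrE ?starnorm_ge0.
Qed.

End frobenius.

(** * Gaussian moments *)

Section gaussian_moments.
Context {R : realType}.
Local Notation mu := (@lebesgue_measure R).
Local Notation N01 := (@normal_prob R 0 1).
Let g := @normal_pdf R 0 1.

Let gE x : g x = normal_peak 1 * expR (- (x ^+ 2 / 2)).
Proof.
by rewrite /g normal_pdfE ?oner_neq0// /normal_fun subr0 expr1n mulNr.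
Qed.

Let g_cont : continuous g.
Proof. by apply: continuous_normal_pdf; rewrite oner_neq0. Qed.

Let g_ge0 x : 0 <= g x. Proof. exact: normal_pdf_ge0. Qed.

Let g_meas : measurable_fun setT g. Proof. exact: measurable_normal_pdf. Qed.

Let g_even x : g (- x) = g x. Proof. by rewrite !gE sqrrN. Qed.

(** The Radon-Nikodym derivative of the normal law is only almost everywhere equal to the density,
    hence the passage through integrals over measurable sets. *)
Lemma normal_prob_ge0_integral (f : R -> \bar R) : measurable_fun setT f ->
  (forall x, 0 <= f x)%E ->
  (\int[N01]_x f x = \int[mu]_x (f x * (g x)%:E))%E.
Proof.
move=> mf f0; have dom : N01 `<< mu by exact: normal_prob_dominates.
rewrite -(Radon_Nikodym_SigmaFinite.change_of_variables dom)//.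
apply: ae_eq_integral => //.
- apply: emeasurable_funM => //; apply: (measurable_int mu).
  exact: Radon_Nikodym_SigmaFinite.f_integrable.
- by apply: emeasurable_funM => //; exact/measurable_EFinP.
- apply: ae_eqe_mul2l => /=; apply: integral_ae_eq => //=.
  + exact: Radon_Nikodym_SigmaFinite.f_integrable.
  + exact/measurable_EFinP.
  + by move=> E _ mE; rewrite -Radon_Nikodym_SigmaFinite.f_integral.
Qed.

(** The source of the moment recursion: [- g] is a primitive of [x g]. *)
Let is_derive_g (x : R) : is_derive x 1 g (- (x * g x)).
Proof.
rewrite (_ : g = fun x => normal_peak 1 * expR (- (x ^+ 2 / 2))); last first.
  by apply/funext => y; rewrite gE.
rewrite /=; apply: is_derive_eq.
transitivity (normal_peak 1 * (expR (- (x ^+ 2 / 2)) *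
   - (x ^+ 2 * (- 2 ^- 2 * 0) + 2^-1 * (x * 1 + x * 1)))); first by [].
by field.
Qed.

Let is_derive_Xn k (x : R) : is_derive x 1 (fun y : R => y ^+ k) (k%:R * x ^+ k.-1).
Proof.
have := @is_deriveX _ R^o id k x 1 1 (is_derive_id _ _).
rewrite [_ ^+ k](_ : _ = fun y => y ^+ k); last by rewrite exprfctE.
move=> /is_derive_eq; apply; transitivity (k%:R * x ^+ k.-1 * 1) => //.
by rewrite mulr1.
Qed.

Let pow_cont k : continuous (fun x : R => x ^+ k).
Proof. exact: exprn_continuous. Qed.

(** Integration by parts of [x^(k+1)] against [x g]. The boundary terms are kept here and removed in
    the limit by [tail]. *)
Let parts k (n : R) : 0 < n ->
  (\int[mu]_(x in `[(- n)%R, n]) (x ^+ k.+2 * g x)%:E =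
  ((- n) ^+ k.+1 * g n - n ^+ k.+1 * g n)%R%:E +
  k.+1%:R%:E * \int[mu]_(x in `[(- n)%R, n]) (x ^+ k * g x)%:E)%E.
Proof.
move=> n0; have nn : - n < n by lra.
have := @integration_by_parts R (fun x => x ^+ k.+1) (fun x => - g x)
  (fun x => k.+1%:R * x ^+ k) (fun x => x * g x) (- n) n nn.
have D1 (x : R) : is_derive x 1 (fun y => - g y) (x * g x).
  by rewrite -[X in is_derive _ _ _ X]opprK; exact: is_deriveN.
have ec (F : R -> R) : continuous F -> {within `[- n, n], continuous F}.
  by move=> cF; exact: continuous_subspaceT.
have dv (F : R -> R) (dF : R -> R) : (forall x : R, is_derive x 1 F (dF x)) -> continuous F ->
    derivable_oo_LRcontinuous F (- n) n.
  move=> H cF; split; first by move=> x _; exact: ex_derive.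
  - by apply: cvg_at_right_filter; exact: cF.
  - by apply: cvg_at_left_filter; exact: cF.
have dv1 (F : R -> R) (dF : R -> R) : (forall x : R, is_derive x 1 F (dF x)) ->
    {in `]- n, n[, F^`()%classic =1 dF}.
  by move=> H x _; rewrite derive1E; exact: derive_val.
have -> : (\int[mu]_(x in `[(- n)%R, n]) (x ^+ k.+2 * g x)%:E =
    \int[mu]_(x in `[(- n)%R, n]) (x ^+ k.+1 * (x * g x))%:E)%E.
  by apply: eq_integral => x _; rewrite exprSr -mulrA.
move=> ->//; last first.
- exact: dv1.
- by apply: (dv _ (fun x => x * g x)) => // x; apply: cvgN; exact: g_cont.
- by apply: ec => x; apply: cvgM; [exact: cvg_id|exact: g_cont].
- by apply: dv1 => x; exact: is_derive_Xn.
- by apply: (dv _ (fun x => k.+1%:R * x ^+ k)) => // x; exact: is_derive_Xn.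
- by apply: ec => x; apply: cvgM; [exact: cvg_cst|exact: pow_cont].
rewrite g_even; congr (_ + _)%E.
  by congr EFin; ring.
rewrite -[RHS]oppeK; congr (- _)%E; rewrite -mulNe -EFinN -integralZl//.
  by apply: eq_integral => x _; rewrite -EFinM; congr EFin; ring.
apply: continuous_compact_integrable; first exact: segment_compact.
by apply: ec => x; apply: cvgM; [exact: pow_cont|exact: g_cont].
Qed.

Let I_cvg (f : R -> R) : measurable_fun setT f -> (forall x, 0 <= f x) ->
  (\int[mu]_(x in `[(- i%:R)%R, i%:R]) (f x)%:E)%E @[i --> \oo] -->
  (\int[mu]_x (f x)%:E)%E.
Proof.
move=> mf f0; pose F i : set R := `[(- i%:R)%R, i%:R]%classic.
rewrite (_ : setT = \bigcup_i F i); last first.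
  apply/seteqP; split=> // x _; exists (Num.bound `|x|) => //=.
  have h : `|x| <= (Num.bound `|x|)%:R by exact/ltW/archi_boundP.
  by rewrite /F/= in_itv/=; move: h; rewrite ler_norml.
apply: ge0_nondecreasing_set_cvg_integral => //.
- move=> i j ij; apply/subsetPset => x; rewrite /F/= !in_itv/= => /andP[h1 h2].
  have : i%:R <= j%:R :> R by rewrite ler_nat.
  by move=> h; apply/andP; split; lra.
- by move=> i; apply/measurable_EFinP; exact: measurable_funTS.
- by move=> i x _; rewrite lee_fin.
Qed.

Let pow_g_meas k : measurable_fun setT (fun x : R => x ^+ k * g x).
Proof. by apply: measurable_funM => //; exact: measurable_funX. Qed.

Let tail k : (n%:R ^+ k.+1 * g n%:R) @[n --> \oo] --> (0 : R).
Proof.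
(* From [exp y >= y^(k+1) / (k+1)!] at [y = n^2 / 2], the term is at most [C / n^(k+1) <= C / n]. *)
pose C : R := normal_peak 1 * (k.+1)`!%:R * 2 ^+ k.+1.
have C0 : 0 <= C by rewrite !mulr_ge0 ?normal_peak_ge0 ?exprn_ge0.
apply: (@squeeze_cvgr _ _ _ _ (cst 0) (fun n => C * n%:R^-1)); last 2 first.
- exact: cvg_cst.
- rewrite -[X in _ --> X](mulr0 C); apply: cvgM; first exact: cvg_cst.
  apply/cvgrPdist_lt => e e0; near=> n.
  rewrite sub0r normrN ger0_norm ?invr_ge0// invf_plt ?posrE//; last first.
    by rewrite ltr0n; near: n; exists 1%N.
  near: n; exact: nbhs_infty_gtr.
near=> n; have n0 : 0 < n%:R :> R by rewrite ltr0n; near: n; exists 1%N.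
apply/andP; split; first by rewrite mulr_ge0 ?exprn_ge0.
rewrite gE expRN; have y0 : (0 : R) <= n%:R ^+ 2 / 2 by rewrite divr_ge0 ?sqr_ge0.
have := expR_ge1Dxn k y0.
set E := expR _; set F : R := _`!%:R => h.
have F0 : 0 < F by rewrite ltr0n fact_gt0.
have E0 : 0 < E by exact: expR_gt0.
have {}h : (n%:R ^+ 2 / 2) ^+ k.+1 / F <= E by lra.
have p0 : 0 < (n%:R : R) ^+ k.+1 by rewrite exprn_gt0.
have e2 : ((n%:R : R) ^+ 2 / 2) ^+ k.+1 = n%:R ^+ k.+1 * n%:R ^+ k.+1 / 2 ^+ k.+1.
  by rewrite expr_div_n -exprMn -expr2.
rewrite e2 in h.
have t0 : 0 < (2 : R) ^+ k.+1 by rewrite exprn_gt0.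
have nk : n%:R <= n%:R ^+ k.+1 :> R.
  by rewrite exprS ler_peMr ?(ltW n0)// exprn_ege1// ler1n; near: n; exists 1%N.
rewrite /C -/F mulrCA -!mulrA ler_wpM2l ?normal_peak_ge0//.
rewrite ler_pdivrMr// -mulrA -mulrA.
have h2 : n%:R ^+ k.+1 * n%:R ^+ k.+1 <= E * F * 2 ^+ k.+1.
  by move: h; rewrite !ler_pdivrMr.
have -> : F * (2 ^+ k.+1 * (n%:R^-1 * E)) = E * F * 2 ^+ k.+1 / n%:R.
  by rewrite mulrCA; ring.
rewrite ler_pdivlMr//; apply: le_trans h2.
by rewrite ler_wpM2l// ltW.
Unshelve. all: by end_near.
Qed.

Let integral_pow_g k := (\int[mu]_x (x ^+ k * g x)%:E)%E.

Let even_ge0 k (x : R) : ~~ odd k -> 0 <= x ^+ k * g x.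
Proof. by move=> ek; rewrite mulr_ge0// exprn_even_ge0. Qed.

(** For even [k] both integrands are nonnegative, so monotone convergence applies to the truncated
    integrals on each side of [parts]. *)
Let even_rec k : ~~ odd k -> integral_pow_g k \is a fin_num ->
  integral_pow_g k.+2 = (k.+1%:R%:E * integral_pow_g k)%E.
Proof.
move=> ek fk.
have ek2 : ~~ odd k.+2 by rewrite /= negbK.
have c1 := I_cvg (pow_g_meas k.+2) (fun x => even_ge0 x ek2).
have c2 := I_cvg (pow_g_meas k) (fun x => even_ge0 x ek).
apply: (cvg_unique _ c1) => //; rewrite -/(integral_pow_g k).
have -> : (k.+1%:R%:E * integral_pow_g k)%E =
    ((- 2 * 0)%:E + k.+1%:R%:E * integral_pow_g k)%E by rewrite mulr0 add0e.
have c3 : ((- 2 * (n%:R ^+ k.+1 * g n%:R))%:E +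
     k.+1%:R%:E * \int[mu]_(x in `[(- n%:R)%R, n%:R]) (x ^+ k * g x)%:E)%E
     @[n --> \oo] --> ((- 2 * 0)%:E + k.+1%:R%:E * integral_pow_g k)%E.
  apply: cvgeD; first by rewrite fin_num_adde_defr.
    apply: cvg_EFin; first exact: nearW.
    by apply: cvgM; [exact: cvg_cst|exact: tail].
  by apply: cvgeZl.
apply: cvg_trans c3; apply: near_eq_cvg; near=> n.
have n0 : 0 < n%:R :> R by rewrite ltr0n; near: n; exists 1%N.
rewrite parts//; congr (_%:E + _)%E.
by rewrite exprNn -signr_odd /= ek expr1; ring.
Unshelve. all: by end_near.
Qed.

Lemma normal_moment_even k : ~~ odd k -> exists2 c : R,
  (\int[N01]_x (x ^+ k)%:E)%E = c%:E &
  (\int[N01]_x (x ^+ k.+2)%:E)%E = (k.+1%:R * c)%:E.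
Proof.
move=> ek0.
have nE j : ~~ odd j -> (\int[N01]_x (x ^+ j)%:E)%E = integral_pow_g j.
  move=> ej; rewrite normal_prob_ge0_integral//.
    by apply/measurable_EFinP; exact: measurable_funX.
  by move=> x; rewrite lee_fin exprn_even_ge0.
rewrite !nE//= ?negbK//.
suff [c Hc] : exists c, integral_pow_g k = c%:E.
  by exists c => //; rewrite even_rec// Hc.
have [n {ek0}->] : exists n, k = n.*2.
  by exists k./2; rewrite -{1}(odd_double_half k) (negbTE ek0).
elim: n => [|n [c IH]].
  exists 1; rewrite /integral_pow_g -(@integral_normal_pdf R 0 1).
  by apply: eq_integral => x _; rewrite expr0 mul1r.
exists (n.*2.+1%:R * c); rewrite doubleS even_rec ?odd_double// IH//.
Qed.

Lemma normal_moments : [/\ (\int[N01]_x (x ^+ 2)%:E)%E = 1%E,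
  (\int[N01]_x (x ^+ 4)%:E)%E = 3%:E & (\int[N01]_x (x ^+ 6)%:E)%E = 15%:E].
Proof.
have [c c0 c2] := @normal_moment_even 0 isT.
have [c' c2' c4] := @normal_moment_even 2 isT.
have [c'' c4' c6] := @normal_moment_even 4 isT.
have {c0} c1 : c = 1.
  apply: EFin_inj; rewrite -c0; under eq_integral do rewrite expr0.
  by rewrite integral_cst// mul1e; exact: probability_setT.
move: c2' c4'; rewrite c2 c4 c1 => -[ec'] [ec'']; rewrite c6 -ec'' -ec'.
by split; congr EFin; lra.
Qed.

Let integrable_even k : ~~ odd k -> N01.-integrable setT (fun x => (x ^+ k)%:E).
Proof.
move=> ek; apply/integrableP; split.
  by apply/measurable_EFinP; exact: measurable_funX.
have [c Hc _] := normal_moment_even ek.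
rewrite (_ : (\int[_]_x _)%E = c%:E) ?ltry// -Hc.
by apply: eq_integral => x _; rewrite gee0_abs// lee_fin exprn_even_ge0.
Qed.

(** An odd power is dominated by [1 + x^(k+1)], where [k+1] is even. *)
Lemma integrable_normal_pow k : N01.-integrable setT (fun x => (x ^+ k)%:E).
Proof.
have [ok|] := boolP (odd k); last exact: integrable_even.
apply: (@le_integrable _ _ _ N01 _ _ _ (fun x => (1 + x ^+ k.+1)%:E)) => //.
- by apply/measurable_EFinP; exact: measurable_funX.
- move=> x _; rewrite lee_fin normrX.
  have e0 : 0 <= x ^+ k.+1 by rewrite exprn_even_ge0//= ok.
  rewrite (ger0_norm (addr_ge0 ler01 e0)) -(ger0_norm e0) normrX.
  have [h|h] := leP `|x| 1.
    by rewrite (le_trans (exprn_ile1 k (normr_ge0 x) h))// lerDl exprn_ge0.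
  rewrite (le_trans (_ : _ <= `|x| ^+ k.+1)) ?lerDr//.
  by rewrite exprS ler_peMl ?exprn_ge0// ltW.
- under eq_fun do rewrite EFinD.
  apply: integrableD => //; last by apply: integrable_even; rewrite /= ok.
  by have := @integrable_even 0 isT; under eq_fun do rewrite expr0.
Qed.

Let integral_opp (h : R -> R) : continuous h -> (forall x, 0 <= h x) ->
  (\int[mu]_x (h x)%:E = \int[mu]_x (h (- x))%:E)%E.
Proof.
have halves (f : R -> R) : continuous f -> (forall x, 0 <= f x) ->
    (\int[mu]_x (f x)%:E = \int[mu]_(x in `[0%R, +oo[) (f (- x))%:E +
      \int[mu]_(x in `[0%R, +oo[) (f x)%:E)%E.
  move=> cf f0; have mf := continuous_measurable_fun cf.
  rewrite -(setUv `[0, +oo[%classic) ge0_integral_setU//= ; last 4 first.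
    exact: measurableC.
    by apply/measurable_EFinP; rewrite setUv.
    by move=> x _; rewrite lee_fin.
    exact/disj_setPCl.
  rewrite addeC; congr (_ + _)%E.
  rewrite setCitvr integral_itv_bndo_bndc; last exact/measurable_EFinP/measurable_funTS.
  rewrite -{1}oppr0 ge0_integration_by_substitutionNy//.
  exact: continuous_subspaceT.
move=> ch h0; rewrite (halves h)// (halves (h \o -%R))//; last first.
  by move=> x; rewrite /=.
  by move=> x; apply: continuous_comp; [exact: oppr_continuous|exact: ch].
by rewrite addeC; congr (_ + _)%E; apply: eq_integral => x _; rewrite /= opprK.
Qed.

(** Reflection exchanges the positive and negative parts, whose integrals are finite and therefore
    cancel. *)
Lemma normal_moment_odd k : odd k -> (\int[N01]_x (x ^+ k)%:E)%E = 0%E.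
Proof.
move=> ok; have ik := integrable_normal_pow k.
rewrite integralE; set A := (X in (X - _)%E); set B := (X in (_ - X)%E).
suff AB : A = B.
  rewrite AB subee// /B; apply: integrable_fin_num => //.
  exact: integrable_funeneg.
have mk : measurable_fun setT (fun x : R => (x ^+ k)%:E).
  by apply/measurable_EFinP; exact: measurable_funX.
rewrite /A /B !normal_prob_ge0_integral//; last 2 first.
- exact: measurable_funeneg.
- exact: measurable_funepos.
transitivity (\int[mu]_x (Num.max (x ^+ k) 0 * g x)%:E)%E.
  by apply: eq_integral => x _; rewrite funeposE -EFin_max -EFinM.
rewrite integral_opp.
- apply: eq_integral => x _; rewrite g_even exprNn -signr_odd ok expr1 mulN1r.
  by rewrite funenegE -EFin_max -EFinM.
- move=> x; apply: cvgM; last exact: g_cont.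
  apply: (@continuous_max _ _ (fun x : R => x ^+ k) (cst 0)); first exact: pow_cont.
  exact: cst_continuous.
- by move=> x; rewrite mulr_ge0// le_max lexx orbT.
Qed.

End gaussian_moments.

(** * Conditioning on the past *)

Section independence.
Context {R : realType} {d d1 d2} {T : measurableType d}
  {S1 : measurableType d1} {S2 : measurableType d2} (P : probability T R).
Variables (X : T -> S1) (Y : T -> S2).
Hypothesis (mX : measurable_fun setT X) (mY : measurable_fun setT Y).
Hypothesis XY : forall A B, measurable A -> measurable B ->
  P (X @^-1` A `&` Y @^-1` B) = (P (X @^-1` A) * P (Y @^-1` B))%E.

Let X' : {mfun T >-> S1} := mfun_Sub (mem_set mX).
Let Y' : {mfun T >-> S2} := mfun_Sub (mem_set mY).

Let mXY : measurable_fun setT (fun w => (X w, Y w)).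
Proof. exact: measurable_fun_pair. Qed.

Let XY' : {mfun T >-> (S1 * S2)%type} := mfun_Sub (mem_set mXY).

Let jointE (A : set (S1 * S2)) : measurable A ->
  distribution P XY' A = (distribution P X' \x distribution P Y')%E A.
Proof.
by move=> mA; exact/esym/product_measure_unique.
Qed.

(** The joint law is the product of the marginals, so Tonelli freezes [X w] and averages over an
    independent copy [Y v]. This nested integral plays the role of a conditional expectation. *)
Lemma indep_integral (F : S1 * S2 -> \bar R) : measurable_fun setT F ->
  (forall z, 0 <= F z)%E ->
  (\int[P]_w F (X w, Y w) = \int[P]_w \int[P]_v F (X w, Y v))%E.
Proof.
move=> mF F0.
transitivity (\int[distribution P XY']_z F z)%E.
  by rewrite ge0_integral_distribution.
rewrite (eq_measure_integral (distribution P X' \x distribution P Y')%E); last first.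
  by move=> A mA _; exact: jointE.
rewrite fubini_tonelli1// ge0_integral_distribution//; last 2 first.
- exact: measurable_fun_fubini_tonelli_F.
- by move=> x; exact: integral_ge0.
apply: eq_integral => w _; rewrite /fubini_F/= ge0_integral_distribution//.
by apply: measurableT_comp => //; exact: measurable_pair1.
Qed.

(** Signed integrands need Fubini: integrability comes first, from the nonnegative case applied to
    the absolute value. *)
Lemma indep_mul (f : S1 -> R) (g : S2 -> R) :
  measurable_fun setT f -> measurable_fun setT g ->
  P.-integrable setT (fun w => (f (X w))%:E) ->
  P.-integrable setT (fun w => (g (Y w))%:E) ->
  P.-integrable setT (fun w => (f (X w) * g (Y w))%:E) /\
  (\int[P]_w (f (X w) * g (Y w))%:E =
   \int[P]_w (f (X w))%:E * \int[P]_w (g (Y w))%:E)%E.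
Proof.
move=> mf mg If Ig.
pose F (z : S1 * S2) := (f z.1 * g z.2)%:E.
have mF : measurable_fun setT F.
  by apply/measurable_EFinP; apply: measurable_funM; exact: measurableT_comp.
have IF : P.-integrable setT (fun w => F (X w, Y w)).
  apply/integrableP; split; first exact: measurableT_comp.
  rewrite (indep_integral (F := fun z => `|F z|%E))//; last exact: measurableT_comp.
  under eq_integral => w _.
    under eq_integral => v _ do rewrite /F /= normrM EFinM.
    rewrite ge0_integralZl//; last first.
      apply/measurable_EFinP; apply: measurableT_comp => //.
      exact: measurableT_comp.
    over.
  have /integrableP[mgY gY] := Ig; have /integrableP[mfX fX] := If.
  rewrite ge0_integralZr//.
  - apply: lte_mul_pinfty => //; first exact: integral_ge0.
    by rewrite ge0_fin_numE//; exact: integral_ge0.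
  - by apply/measurable_EFinP; apply: measurableT_comp => //; exact: measurableT_comp.
  - exact: integral_ge0.
split => //.
have IF2 : (distribution P X' \x distribution P Y')%E.-integrable setT F.
  apply/integrableP; split => //.
  rewrite -(eq_measure_integral _ (m1 := distribution P XY')); last first.
    by move=> A mA _; exact: jointE.
  rewrite ge0_integral_distribution//; last exact: measurableT_comp.
  by case/integrableP : IF.
transitivity (\int[distribution P XY']_z F z)%E.
  by rewrite integral_distribution.
rewrite (eq_measure_integral (distribution P X' \x distribution P Y')%E); last first.
  by move=> A mA _; exact: jointE.
rewrite -integral12_prod_meas1//= /fubini_F.
have e x : (\int[distribution P Y']_y F (x, y) =
    (f x)%:E * \int[P]_w (g (Y w))%:E)%E.
  rewrite -integralZl// integral_distribution//.
  - exact: measurableT_comp mF (measurable_pair1 _).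
  - have := integrableZl measurableT (f x) Ig.
    by apply: eq_integrable => // w _; rewrite /F /= EFinM.
under eq_integral do rewrite e.
have fg : (\int[P]_w (g (Y w))%:E)%E \is a fin_num by exact: integrable_fin_num.
rewrite integral_distribution//=.
- by rewrite -(fineK fg) integralZr.
- by apply: emeasurable_funM => //; exact/measurable_EFinP.
- by rewrite -(fineK fg); exact: integrableZr.
Qed.

End independence.

Lemma bigcap_seq_cons {T : Type} {I : eqType} (F : I -> set T) k s :
  \bigcap_(j in [set` k :: s]) F j = F k `&` \bigcap_(j in [set` s]) F j.
Proof.
apply/seteqP; split=> w.
  move=> h; split; first by apply: h; rewrite /= mem_head.
  by move=> j /= js; apply: h; rewrite /= in_cons js orbT.
by move=> [h1 h2] j /=; rewrite in_cons => /orP[/eqP ->|/h2].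
Qed.

Lemma bigcap_seq_nil {T : Type} {I : eqType} (F : I -> set T) :
  \bigcap_(j in [set` [::]]) F j = setT.
Proof. by apply/seteqP; split=> // w _ j; rewrite /= in_nil. Qed.

Section past.
Context {R : realType} {d d'} {T : measurableType d} {S : measurableType d'}
  {I : choiceType} (P : probability T R) (X : I -> T -> S) (J : set I).

(* The pi-system of finite-dimensional cylinders on the coordinates in [J]. *)
Definition past_system : set (set T) :=
  [set A | exists s : seq I, exists V : I -> set S,
    [/\ uniq s, {in s, forall k, J k}, forall k, measurable (V k) &
        A = \bigcap_(k in [set` s]) (X k @^-1` V k)]].

Lemma past_systemI : setI_closed past_system.
Proof.
move=> _ _ [s [V [us sJ mV ->]]] [t [W [ut tJ mW ->]]].
pose U k := (if k \in s then V k else setT) `&` (if k \in t then W k else setT).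
exists (undup (s ++ t)), U; split.
- exact: undup_uniq.
- by move=> k; rewrite mem_undup mem_cat => /orP[/sJ|/tJ].
- by move=> k; apply: measurableI; case: ifP.
- apply/seteqP; split=> w.
    move=> [h1 h2] k /=; rewrite mem_undup mem_cat => _; rewrite /U; split.
      by case: ifPn => // ks; exact: h1.
    by case: ifPn => // ks; exact: h2.
  move=> h; split=> k /= ks.
    have := h k; rewrite /= mem_undup mem_cat ks => /(_ isT); rewrite /U /= ks.
    by case.
  have := h k; rewrite /= mem_undup mem_cat ks orbT => /(_ isT); rewrite /U /= ks.
  by case.
Qed.

Hypothesis mX : forall k, measurable_fun setT (X k).

Lemma past_system_measurable : past_system `<=` measurable.
Proof.
move=> _ [s [V [us sJ mV ->]]]; elim: s us sJ => [|k s IH].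
  by move=> _ _; rewrite bigcap_seq_nil.
rewrite cons_uniq => /andP[_ us] sJ; rewrite bigcap_seq_cons.
apply: measurableI; last by apply: IH => // j js; apply: sJ; rewrite inE js orbT.
by rewrite -[X in measurable X]setTI; exact: mX.
Qed.

Local Notation past := (g_sigma_algebraType past_system).

Lemma measurable_past_id : measurable_fun setT (id : T -> past).
Proof.
move=> _ A mA; rewrite setTI; apply: mA; split => //; last first.
  exact: past_system_measurable.
split; first exact: measurable0.
  by move=> B mB; rewrite setTD; exact: measurableC.
by move=> F mF; exact: bigcup_measurable.
Qed.

Lemma measurable_past k : J k -> measurable_fun setT (X k : past -> S).
Proof.
move=> Jk _ A mA; rewrite setTI; apply: sub_sigma_algebra.
exists [:: k], (fun _ => A); split => //.
  by move=> j; rewrite inE => /eqP ->.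
by rewrite bigcap_seq_cons bigcap_seq_nil setIT.
Qed.

Hypothesis indX : mutually_independent P X.

(** With [C] the preimage of [B], the finite measures [A |-> P (A & C)] and [A |-> P A * P C] agree
    on the cylinders by mutual independence, hence on the generated sigma-algebra. *)
Lemma past_indep k (A : set past) (B : set S) : ~ J k ->
  measurable A -> measurable B ->
  P (A `&` X k @^-1` B) = (P A * P (X k @^-1` B))%E.
Proof.
move=> nJk mA mB; have mC : measurable (X k @^-1` B).
  by rewrite -[X in measurable X]setTI; exact: mX.
set C := X k @^-1` B in mC *.
have PC : P C \is a fin_num by exact: fin_num_measure.
have c0 : 0 <= fine (P C) by rewrite fine_ge0.
have := @g_sigma_algebra_measure_unique _ R T past_system past_system_measurable
  (fun=> setT) _ _ (mrestr P mC) (mscale (NngNum c0) P) past_systemI.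
have m2E (B' : set T) : mscale (NngNum c0) P B' = (P B' * P C)%E.
  by rewrite /mscale /= fineK// muleC.
rewrite -m2E => H; apply: H mA => //.
- by move=> _; exists [::], (fun=> setT); split => //; rewrite bigcap_seq_nil.
- by apply/seteqP; split=> // w _; exists 0%N.
- move=> _ [s [V [us sJ mV ->]]]; apply: etrans (esym (m2E _)).
  rewrite /mrestr.
  have ks : k \notin s by apply/negP => /sJ.
  (* Mutual independence is used for the family [k :: s], with [B] at index [k]; since [k] is not in
     [s] the other sets are unchanged. *)
  pose W j := if j == k then B else V j.
  have mW j : measurable (W j) by rewrite /W; case: ifP.
  have WV : \bigcap_(j in [set` s]) (X j @^-1` W j) =
            \bigcap_(j in [set` s]) (X j @^-1` V j).
    apply: eq_bigcapr => j /= js; rewrite /W; case: eqP => // jk.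
    by rewrite jk (negbTE ks) in js.
  have := indX (s := k :: s) (V := W).
  rewrite cons_uniq ks us => /(_ isT mW); rewrite bigcap_seq_cons big_cons.
  rewrite WV -(indX us mW) WV {1 2}/W eqxx.
  by rewrite setIC muleC.
- by move=> _; change (P (setT `&` C) < +oo)%E; rewrite setTI ltey_eq PC.
Qed.

Lemma past_integral k (F : past * S -> \bar R) : ~ J k ->
  measurable_fun setT F -> (forall z, 0 <= F z)%E ->
  (\int[P]_w F (w, X k w) = \int[P]_w \int[P]_v F (w, X k v))%E.
Proof.
move=> nJk mF F0.
apply: (indep_integral (X := id : T -> past) (Y := X k)) => //.
- exact: measurable_past_id.
- by move=> A B mA mB; exact: past_indep.
Qed.

End past.

(** * Moments of a standard Gaussian vector *)

Section has_expectation.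
Context {R : realType} {d} {T : measurableType d} (P : probability T R).

(** Integrability travels with the value, so the mean of a polynomial in the noise is assembled term
    by term without side conditions. *)
Definition hasE (X : T -> R) (c : R) : Prop :=
  P.-integrable setT (fun w => (X w)%:E) /\ (\int[P]_w (X w)%:E = c%:E)%E.

Lemma hasE_ext X Y c : X =1 Y -> hasE X c -> hasE Y c.
Proof. by move=> /funext ->. Qed.

Lemma hasE_eq X a b : a = b -> hasE X a -> hasE X b.
Proof. by move=> ->. Qed.

Lemma hasE_cst c : hasE (fun=> c) c.
Proof.
split; first by apply: finite_measure_integrable_cst.
by rewrite integral_cst//= probability_setT mule1.
Qed.

Lemma hasED X Y a b : hasE X a -> hasE Y b -> hasE (fun w => X w + Y w) (a + b).
Proof.
move=> [iX eX] [iY eY]; split.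
  by under eq_fun do rewrite EFinD; exact: integrableD.
by under eq_integral do rewrite EFinD; rewrite integralD// eX eY.
Qed.

Lemma hasEZ X a c : hasE X a -> hasE (fun w => c * X w) (c * a).
Proof.
move=> [iX eX]; split.
  by under eq_fun do rewrite EFinM; exact: integrableZl.
by under eq_integral do rewrite EFinM; rewrite integralZl// eX.
Qed.

Lemma hasE_sum (I : Type) (s : seq I) (X : I -> T -> R) (a : I -> R) :
  (forall i, hasE (X i) (a i)) ->
  hasE (fun w => \sum_(i <- s) X i w) (\sum_(i <- s) a i).
Proof.
move=> h; elim: s => [|i s IH].
  rewrite big_nil; apply: hasE_ext (hasE_cst 0) => w.
  by rewrite big_nil.
rewrite big_cons; apply: hasE_ext (hasED (h i) IH) => w.
by rewrite big_cons.
Qed.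

Lemma hasE_le X Y a b : (forall w, X w <= Y w) -> hasE X a -> hasE Y b -> a <= b.
Proof.
move=> XY [iX eX] [iY eY]; rewrite -lee_fin -eX -eY.
by apply: le_integral => // w _; rewrite lee_fin.
Qed.

End has_expectation.

Section gaussian_vector.
Context {R : realType} {d} {T : measurableType d} (P : probability T R)
  {m : nat} (e : 'I_m -> T -> R).
Hypothesis me : forall j, measurable_fun setT (e j).
Hypothesis lawe : forall V : 'I_m -> set R, (forall j, measurable (V j)) ->
  P [set w | forall j, V j (e j w)] = (\prod_(j < m) normal_prob 0 1 (V j))%E.

(** Taking the full line for the other coordinates leaves factors 1 in the product law. *)
Lemma gvec_law j (V : set R) : measurable V ->
  P (e j @^-1` V) = normal_prob 0 1 V.
Proof.
move=> mV; pose W i := if i == j then V else setT.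
have := lawe (V := W); rewrite (bigD1 j)//= big1 ?mule1; last first.
  by move=> i /negbTE ij; rewrite /W ij probability_setT.
rewrite [in X in _ -> X](_ : V = W j); last by rewrite /W eqxx.
move=> <-; last by move=> i; rewrite /W; case: ifP.
have -> : W j = V by rewrite /W eqxx.
congr (P _); apply/seteqP; split=> w /=.
  by move=> Vw i; rewrite /W; case: eqP => // ->.
by move=> /(_ j); rewrite /W eqxx.
Qed.

Lemma gvec_indep : mutually_independent P e.
Proof.
move=> s V us mV; pose W i := if i \in s then V i else setT.
have := lawe (V := W).
rewrite (bigID (mem s))/= [X in (_ * X)%E]big1 ?mule1; last first.
  by move=> i /negbTE ij; rewrite /W ij probability_setT.
move=> h; transitivity (P [set w | forall j, W j (e j w)]).
  congr (P _); apply/seteqP; split=> w /=.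
    by move=> h1 i; rewrite /W; case: ifPn => // si; exact: h1.
  by move=> h1 i /= si; have := h1 i; rewrite /W si.
rewrite h; last by move=> i; rewrite /W; case: ifP.
rewrite big_uniq//=; apply: eq_bigr => i si.
by rewrite gvec_law// /W si.
Qed.

Lemma hasE_gvec_pow j k c :
  (\int[@normal_prob R 0 1]_x (x ^+ k)%:E)%E = c%:E ->
  hasE P (fun w => e j w ^+ k) c.
Proof.
have mj : @measurable_fun _ _ T (measurableTypeR R) setT (e j) by exact: me.
pose X := @mfun_Sub _ _ T (measurableTypeR R) (e j) (mem_set mj).
have mk : measurable_fun setT (fun x : R => (x ^+ k)%:E).
  by apply/measurable_EFinP; exact: measurable_funX.
have dE A : measurable A -> distribution P X A = normal_prob 0 1 A.
  by move=> mA; exact: gvec_law.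
move=> Hc; have i1 : P.-integrable setT (fun w => (e j w ^+ k)%:E).
  apply/integrableP; split.
    by apply/measurable_EFinP; exact: measurable_funX.
  have /integrableP[_] := integrable_normal_pow (R := R) k.
  rewrite (eq_measure_integral (distribution P X)); last by move=> A mA _; exact/esym/dE.
  by rewrite ge0_integral_distribution//; exact: measurableT_comp.
split=> //; rewrite -Hc -(eq_measure_integral _ (m1 := distribution P X)); last first.
  by move=> A mA _; exact: dE.
by rewrite integral_distribution.
Qed.

Lemma hasE_indep_mul (J : set 'I_m) k (F : T -> R) q a b : ~ J k ->
  measurable_fun setT (F : g_sigma_algebraType (past_system e J) -> R) ->
  hasE P F a -> hasE P (fun w => e k w ^+ q) b ->
  hasE P (fun w => F w * e k w ^+ q) (a * b).
Proof.
move=> nJk mF [iF eF] [iq eq].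
have [] := @indep_mul R _ _ _ T (g_sigma_algebraType (past_system e J))
  _ P id (e k) (measurable_past_id (J := J) me) (me k) _
  F (fun y => y ^+ q) mF (@exprn_measurable R setT q) iF iq.
  by move=> A B mA mB; exact: past_indep me gvec_indep _ _ _ nJk mA mB.
by move=> i1 e1; split => //; rewrite e1 eF eq EFinM.
Qed.

Lemma hasE_gvec1 j : hasE P (e j) 0.
Proof.
have := hasE_gvec_pow j (normal_moment_odd (R := R) (isT : odd 1)).
by apply: hasE_ext => w; rewrite expr1.
Qed.

Let mom2 j : hasE P (fun w => e j w ^+ 2) 1.
Proof. by have [h _ _] := @normal_moments R; exact: hasE_gvec_pow. Qed.

Let mom3 j : hasE P (fun w => e j w ^+ 3) 0.
Proof. exact: hasE_gvec_pow (normal_moment_odd (R := R) (isT : odd 3)). Qed.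

Lemma hasE_gvec2 i j : hasE P (fun w => e i w * e j w) (i == j)%:R.
Proof.
have [<-|ij] := eqVneq i j; first exact: mom2.
have nJ : ~ [set i] j by move=> /= ji; rewrite ji eqxx in ij.
have := hasE_indep_mul (q := 1) nJ (measurable_past (erefl : [set i] i)) (hasE_gvec1 i).
move=> /(_ 0) h; apply: hasE_ext (hasE_eq _ (h _)).
- by move=> w; rewrite expr1.
- by rewrite mulr0.
- by apply: hasE_ext (hasE_gvec1 j) => w; rewrite expr1.
Qed.

(** If some index differs from the two others, its factor is independent of the rest and has mean 0;
    otherwise the product is an odd power. The case analysis moves an isolated index to the last
    place. *)
Lemma hasE_gvec3 i j k : hasE P (fun w => e i w * e j w * e k w) 0.
Proof.
have last_diff a b c : c != a -> c != b -> hasE P (fun w => e a w * e b w * e c w) 0.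
  move=> ca cb; pose J : set 'I_m := [set x | x != c].
  have nJ : ~ J c by rewrite /J/= eqxx.
  have mF : measurable_fun setT
      (fun w : g_sigma_algebraType (past_system e J) => e a w * e b w).
    by apply: measurable_funM; apply: measurable_past; rewrite /J/= eq_sym.
  have := hasE_indep_mul (q := 1) nJ mF (hasE_gvec2 a b).
  move=> /(_ 0) h; apply: hasE_ext (hasE_eq _ (h _)).
  - by move=> w; rewrite expr1.
  - by rewrite mulr0.
  - by apply: hasE_ext (hasE_gvec1 c) => w; rewrite expr1.
have [ki|ki] := eqVneq k i; last first.
  have [kj|kj] := eqVneq k j; last exact: last_diff.
  by apply: hasE_ext (last_diff j k i _ _) => [w| |]; rewrite ?kj 1?mulrC ?mulrA// eq_sym -?kj.
have [kj|kj] := eqVneq k j; last first.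
  by apply: hasE_ext (last_diff i k j _ _) => [w| |]; rewrite -?ki 1?mulrAC// eq_sym.
by subst i j; apply: hasE_ext (mom3 k) => w; rewrite !exprS expr0 mulr1 mulrA.
Qed.

(** The chi-square moments, which are the dimension factors of [xi3]. The induction adds one
    coordinate to the partial sum [Sk k], independent of it, and expands the binomial. *)
Lemma hasE_gvec_norm : let S w := \sum_j e j w ^+ 2 in
  [/\ hasE P S m%:R, hasE P (fun w => S w ^+ 2) (m%:R * (m%:R + 2)) &
      hasE P (fun w => S w ^+ 3) (m%:R * (m%:R + 2) * (m%:R + 4))].
Proof.
move=> S; pose Sk k w := \sum_(j < m | (j < k)%N) e j w ^+ 2.
have Sm : Sk m = S.
  by apply/funext => w; rewrite /Sk /S; apply: eq_bigl => j; rewrite ltn_ord.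
suff main k : (k <= m)%N -> [/\ hasE P (Sk k) k%:R,
    hasE P (fun w => Sk k w ^+ 2) (k%:R * (k%:R + 2)) &
    hasE P (fun w => Sk k w ^+ 3) (k%:R * (k%:R + 2) * (k%:R + 4))].
  by rewrite -Sm; exact: main.
elim: k => [_|k IH km].
  have S0 w : Sk 0 w = 0 by rewrite /Sk big_pred0.
  split; apply: hasE_ext (hasE_eq _ (hasE_cst P 0)) => [w|]; rewrite ?S0 ?expr0n ?mul0r//.
have {IH}[E1 E2 E3] := IH (ltnW km).
pose o : 'I_m := Ordinal km; pose J : set 'I_m := [set j : 'I_m | (j < k)%N].
have nJ : ~ J o by rewrite /J/= ltnn.
have SS w : Sk k.+1 w = Sk k w + e o w ^+ 2.
  rewrite /Sk (bigD1 o)//= addrC; congr (_ + _); apply: eq_bigl => j.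
  by rewrite ltnS (ltn_neqAle j) andbC.
have mS p : measurable_fun setT
    (fun w : g_sigma_algebraType (past_system e J) => Sk k w ^+ p).
  apply: measurable_funX; rewrite /Sk.
  under eq_fun do rewrite big_mkcond /=.
  apply: measurable_sum => j; case: (ltnP j k) => // jk.
  by apply: measurable_funX; exact: measurable_past.
have [m2 m4 m6] := @normal_moments R.
have pr p q a b : hasE P (fun w => Sk k w ^+ p) a ->
    (\int[@normal_prob R 0 1]_x (x ^+ q)%:E)%E = b%:E ->
    hasE P (fun w => Sk k w ^+ p * e o w ^+ q) (a * b).
  by move=> h1 h2; apply: hasE_indep_mul nJ (mS p) h1 (hasE_gvec_pow o h2).
have F1 : hasE P (fun w => Sk k w ^+ 1) k%:R by apply: hasE_ext E1.
have g2 := hasE_gvec_pow o m2; have g4 := hasE_gvec_pow o m4.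
have g6 := hasE_gvec_pow o m6.
split.
- apply: hasE_ext (hasE_eq _ (hasED E1 g2)) => [w|]; first by rewrite SS.
  by rewrite -natr1.
- apply: hasE_ext (hasE_eq _ (hasED E2 (hasED (hasEZ 2 (pr _ _ _ _ F1 m2)) g4))).
    by move=> w; rewrite SS; ring.
  by rewrite -natr1; ring.
- apply: hasE_ext (hasE_eq _ (hasED E3 (hasED (hasEZ 3 (pr _ _ _ _ E2 m2))
    (hasED (hasEZ 3 (pr _ _ _ _ F1 m4)) g6)))).
    by move=> w; rewrite SS; ring.
  by rewrite -natr1; ring.
Qed.

End gaussian_vector.

(** * Random matrices *)

Section matrix_measurability.
Context {R : realType} {d} {U : measurableType d}.

(* Matrices carry no sigma-algebra: a random matrix is measurable entrywise. *)
Definition mxmeas k l (F : U -> 'M[R]_(k, l)) : Prop :=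
  forall i j, measurable_fun setT (fun u => F u i j).

(** The inverse is written with a real power of [f^2], whose measurability is available. At 0 both
    sides vanish. *)
Lemma measurable_fun_invr (f : U -> R) : measurable_fun setT f ->
  measurable_fun setT (fun u => (f u)^-1).
Proof.
move=> mf; rewrite (_ : (fun _ => _) = fun u => f u * ((f u ^+ 2) `^ (-1))).
  apply: measurable_funM => //; apply: measurableT_comp (measurable_powR _) _.
  exact: measurable_funX.
apply/funext => u; have [->|fu] := eqVneq (f u) 0; first by rewrite invr0 mul0r.
by rewrite powR_inv1 ?sqr_ge0//; field.
Qed.

Lemma measurable_fun_maxr (f g : U -> R) : measurable_fun setT f ->
  measurable_fun setT g -> measurable_fun setT (fun u => Num.max (f u) (g u)).
Proof. by move=> mf mg; exact: measurable_maxr. Qed.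

Lemma mxmeas_cst k l (X : 'M[R]_(k, l)) : mxmeas (fun=> X).
Proof. by move=> i j; exact: measurable_cst. Qed.

Lemma mxmeasD k l (F G : U -> 'M[R]_(k, l)) : mxmeas F -> mxmeas G ->
  mxmeas (fun u => F u + G u).
Proof.
move=> mF mG i j; under eq_fun do rewrite mxE.
exact: measurable_funD.
Qed.

Lemma mxmeasN k l (F : U -> 'M[R]_(k, l)) : mxmeas F -> mxmeas (fun u => - F u).
Proof.
move=> mF i j; under eq_fun do rewrite mxE.
exact: measurableT_comp.
Qed.

Lemma mxmeasB k l (F G : U -> 'M[R]_(k, l)) : mxmeas F -> mxmeas G ->
  mxmeas (fun u => F u - G u).
Proof. by move=> mF mG; apply: mxmeasD => //; exact: mxmeasN. Qed.

Lemma mxmeasM k l p (F : U -> 'M[R]_(k, l)) (G : U -> 'M[R]_(l, p)) :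
  mxmeas F -> mxmeas G -> mxmeas (fun u => F u *m G u).
Proof.
move=> mF mG i j; under eq_fun do rewrite mxE.
by apply: measurable_sum => h; exact: measurable_funM.
Qed.

Lemma mxmeas_tr k l (F : U -> 'M[R]_(k, l)) : mxmeas F -> mxmeas (fun u => (F u)^T).
Proof. by move=> mF i j; under eq_fun do rewrite mxE; exact: mF. Qed.

Lemma mxmeasZ k l (a : U -> R) (F : U -> 'M[R]_(k, l)) :
  measurable_fun setT a -> mxmeas F -> mxmeas (fun u => a u *: F u).
Proof.
move=> ma mF i j; under eq_fun do rewrite mxE.
exact: measurable_funM.
Qed.

Lemma measurable_mxtrace k (F : U -> 'M[R]_k) : mxmeas F ->
  measurable_fun setT (fun u => \tr (F u)).
Proof. by move=> mF; apply: measurable_sum => i; exact: mF. Qed.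

Lemma measurable_quadform k (F : U -> 'M[R]_k) (x : U -> 'cV[R]_k) :
  mxmeas F -> mxmeas x -> measurable_fun setT (fun u => quadform (F u) (x u)).
Proof.
move=> mF mx; suff : mxmeas (fun u => (x u)^T *m F u *m x u) by apply.
by apply: mxmeasM => //; apply: mxmeasM => //; exact: mxmeas_tr.
Qed.

Lemma measurable_fdot k l (F G : U -> 'M[R]_(k, l)) :
  mxmeas F -> mxmeas G -> measurable_fun setT (fun u => fdot (F u) (G u)).
Proof.
by move=> mF mG; apply: measurable_mxtrace; apply: mxmeasM => //; exact: mxmeas_tr.
Qed.

Lemma measurable_det k (F : U -> 'M[R]_k) : mxmeas F ->
  measurable_fun setT (fun u => \det (F u)).
Proof.
move=> mF; apply: measurable_sum => s; apply: measurable_funM => //.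
by apply: measurable_prod => i _; exact: mF.
Qed.

Lemma mxmeas_if k l (b : U -> bool) (F G : U -> 'M[R]_(k, l)) :
  measurable_fun setT b -> mxmeas F -> mxmeas G ->
  mxmeas (fun u => if b u then F u else G u).
Proof.
move=> mb mF mG i j.
rewrite (_ : (fun _ => _) = fun u => if b u then F u i j else G u i j).
  exact: measurable_fun_ifT.
by apply/funext => u; case: ifP.
Qed.

(** No invertibility is assumed: [invmx] is the cofactor formula where the determinant is nonzero
    and the identity map elsewhere, and both pieces are measurable. *)
Lemma mxmeas_inv k (F : U -> 'M[R]_k) : mxmeas F -> mxmeas (fun u => invmx (F u)).
Proof.
move=> mF; apply: mxmeas_if => //.
  rewrite (_ : (fun _ => _) = fun u => ~~ (\det (F u) == 0)).
    apply: measurableT_comp => //.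
    by apply: measurable_fun_eqr => //; exact: measurable_det.
  by apply/funext => u; rewrite unitmxE unitfE.
apply: mxmeasZ; first exact/measurable_fun_invr/measurable_det.
move=> i j; under eq_fun do rewrite mxE.
apply: measurable_funM => //; apply: measurable_det => a b.
by under eq_fun do rewrite !mxE; exact: mF.
Qed.

Lemma mxmeas_colvec k (x : U -> k.-tuple R) : measurable_fun setT x ->
  mxmeas (fun u => colvec (x u)).
Proof.
move=> mx i j; under eq_fun do rewrite mxE.
exact: measurableT_comp (measurable_tnth i) mx.
Qed.

(** True for negative [x] as well, as [nat_ceil] truncates at 0. All facts about rounded parameters
    go through this equivalence. *)
Lemma lt_nat_ceil (i : nat) (x : R) : (i < nat_ceil x)%N = (i%:R < x).
Proof.
rewrite /nat_ceil -ltz_nat gez0_abs; last first.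
  by rewrite ceil_ge0 (@lt_le_trans _ _ 0) ?ltrN10// le_max lexx.
rewrite ceil_gt_int lt_max; case: (ltP (i%:R : R) x) => //=; rewrite ?orbT// orbF.
by rewrite ltNge ler0n.
Qed.

Lemma measurable_nat_ceil_eq (f : U -> R) k : measurable_fun setT f ->
  measurable [set u | nat_ceil (f u) = k].
Proof.
move=> mf; have mb i : measurable [set u | (i < nat_ceil (f u))%N].
  under eq_set do rewrite lt_nat_ceil.
  rewrite -[X in measurable X]setTI.
  exact: (measurable_fun_ltr (measurable_cst _) mf measurableT (Y := [set true])).
case: k => [|k].
  rewrite (_ : [set u | _] = ~` [set u | (0 < nat_ceil (f u))%N]).
    exact: measurableC.
  by apply/seteqP; split=> u /=; [move=> ->|move/negP; rewrite lt0n negbK => /eqP].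
rewrite (_ : [set u | _] = [set u | (k < nat_ceil (f u))%N] `\`
    [set u | (k.+1 < nat_ceil (f u))%N]); first exact: measurableD.
apply/seteqP; split=> u /=; first by move=> ->; rewrite ltnn.
by move=> [h1 /negP]; rewrite -leqNgt => h2; apply/eqP; rewrite eqn_leq h1 h2.
Qed.

(** Needed because the number of iterations of a stage is random: split over its countably many
    values. *)
Lemma mxmeas_nat k l (F : nat -> U -> 'M[R]_(k, l)) (N : U -> nat) :
  (forall t, mxmeas (F t)) -> (forall t, measurable [set u | N u = t]) ->
  mxmeas (fun u => F (N u) u).
Proof.
move=> mF mN i j _ Y mY; rewrite setTI.
rewrite (_ : _ @^-1` Y = \bigcup_t ([set u | N u = t] `&` (fun u => F t u i j) @^-1` Y)).
  apply: bigcupT_measurable => t; apply: measurableI => //.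
  by rewrite -[X in measurable X]setTI; exact: mF.
apply/seteqP; split=> u /=; first by move=> h; exists (N u).
by move=> [t _ /= [-> ]].
Qed.

End matrix_measurability.

(** * Cost of a linear policy *)

Section lqr_algebra.
Context {R : realType} {n m : nat} (pb : lqr R n m).
Hypotheses (n_gt0 : (0 < n)%N) (m_gt0 : (0 < m)%N).

Local Notation A := (sysA pb).
Local Notation B := (sysB pb).
Local Notation Q := (costQ pb).
Local Notation Rc := (costR pb).

Hypotheses (pQ : posdef Q) (pR : posdef Rc).

Let trB k l (X Y : 'M[R]_(k, l)) : (X - Y)^T = X^T - Y^T.
Proof. by apply/matrixP => i j; rewrite !mxE. Qed.

Let trD k l (X Y : 'M[R]_(k, l)) : (X + Y)^T = X^T + Y^T.
Proof. by apply/matrixP => i j; rewrite !mxE. Qed.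

Let trN k l (X : 'M[R]_(k, l)) : (- X)^T = - X^T.
Proof. by apply/matrixP => i j; rewrite !mxE. Qed.

Let conj_sym k l (X : 'M[R]_k) (Y : 'M[R]_(k, l)) : X^T = X ->
  (Y^T *m X *m Y)^T = Y^T *m X *m Y.
Proof. by move=> sX; rewrite !trmx_mul trmxK sX mulmxA. Qed.

(** Half the Hessian of the one-step cost in the control. *)
Definition hess (P : 'M[R]_n) : 'M[R]_m := Rc + B^T *m P *m B.

Lemma hess_sym P : P^T = P -> (hess P)^T = hess P.
Proof.
by move=> sP; rewrite /hess linearD /= (proj1 pR) !trmx_mul trmxK sP mulmxA.
Qed.

Lemma hess_ge P z : possemidef P -> lambda_min Rc * fdot z z <= quadform (hess P) z.
Proof.
move=> pP; rewrite quadformD quadform_conj.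
apply: le_trans (lambda_min_le z m_gt0 (proj1 pR)) _.
by rewrite lerDl; exact: (proj2 pP).
Qed.

Lemma hess_posdef P : possemidef P -> posdef (hess P).
Proof.
move=> pP; apply: (posdef_of_lb (lambda_min_gt0 m_gt0 pR)).
  exact: hess_sym (proj1 pP).
by move=> z; exact: hess_ge.
Qed.

Lemma hess_gain P : possemidef P -> hess P *m gain pb P = B^T *m P *m A.
Proof.
move=> /hess_posdef/posdef_unit uG.
by rewrite /gain -/(hess P) -!mulmxA mulKVmx// !mulmxA.
Qed.

Lemma hess_le P c z : 0 <= c -> (forall z, quadform P z <= c * fdot z z) ->
  quadform (hess P) z <= (specnorm Rc + c * specnorm B ^+ 2) * fdot z z.
Proof.
move=> c0 Hc; rewrite quadformD quadform_conj mulrDl.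
apply: lerD; first exact: quadform_le_specnorm.
apply: le_trans (Hc _) _; rewrite -mulrA ler_wpM2l//.
exact: specnorm_ub2.
Qed.

Lemma policy_cost_sym P K : P^T = P -> (policy_cost pb P K)^T = policy_cost pb P K.
Proof.
move=> sP; rewrite /policy_cost (trD _ Q) (trD _ (_ *m K)) (proj1 pQ).
by rewrite (conj_sym _ sP) (conj_sym _ (proj1 pR)).
Qed.

Lemma quadform_policy_cost P K x : quadform (policy_cost pb P K) x =
  quadform P ((A - B *m K) *m x) + quadform Rc (K *m x) + quadform Q x.
Proof. by rewrite /policy_cost !quadformD !quadform_conj. Qed.

(** Completion of the square: the normal equation [hess P *m gain P = B^T P A] cancels the terms
    linear in [K - gain P]. *)
Lemma policy_cost_square P K : possemidef P ->
  policy_cost pb P K = policy_cost pb P (gain pb P) +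
    (K - gain pb P)^T *m hess P *m (K - gain pb P).
Proof.
move=> pP; have sP := proj1 pP; have sG := hess_sym sP.
set Kg := gain pb P.
have e1 : hess P *m Kg = B^T *m P *m A := hess_gain pP.
have e2 : Kg^T *m hess P = A^T *m P *m B.
  by rewrite -[in LHS]sG -trmx_mul e1 !trmx_mul trmxK sP mulmxA.
have expand X : policy_cost pb P X = A^T *m P *m A + Q
    + X^T *m hess P *m X - X^T *m (hess P *m Kg) - (Kg^T *m hess P) *m X.
  rewrite e1 e2 /policy_cost /hess trB trmx_mul.
  rewrite !(mulmxBl, mulmxBr, mulmxDl, mulmxDr, mulNmx, mulmxN) !mulmxA.
  set a := _ *m A; set b := _ *m _ *m A; set c := A^T *m _ *m _ *m _.
  set e := X^T *m B^T *m _ *m _ *m _; set f := X^T *m Rc *m X.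
  move: a b c e f => a b c e f.
  by apply/matrixP => i j; rewrite !mxE; ring.
rewrite !expand trB.
rewrite !(mulmxBl, mulmxBr) !mulmxA -/Kg.
move: (hess P) => H; move: (K^T *m H *m K) (K^T *m H *m Kg) (Kg^T *m H *m K)
  (Kg^T *m H *m Kg) (A^T *m P *m A) => a b c e f.
by apply/matrixP => i j; rewrite !mxE; ring.
Qed.

Lemma policy_cost_psd P K : possemidef P -> possemidef (policy_cost pb P K).
Proof.
move=> pP; split; first exact: policy_cost_sym (proj1 pP).
move=> x; rewrite quadform_policy_cost !addr_ge0 ?(proj2 pP)//.
  exact: (proj2 (posdef_psd pR)).
exact: (proj2 (posdef_psd pQ)).
Qed.

Lemma policy_cost_min P K x : possemidef P ->
  quadform (policy_cost pb P (gain pb P)) x <= quadform (policy_cost pb P K) x.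
Proof.
move=> pP; rewrite [in leRHS]policy_cost_square// quadformD quadform_conj lerDl.
exact: (proj2 (posdef_psd (hess_posdef pP))).
Qed.

(** The completed square at [K = 0], where the policy cost is [A^T P A + Q], is the Riccati
    equation. *)
Lemma dareE P : possemidef P -> dare pb P -> P = policy_cost pb P (gain pb P).
Proof.
move=> pP dP; have sP := proj1 pP; have sG := hess_sym sP.
have uG := posdef_unit (hess_posdef pP).
have e1 := hess_gain pP.
have := policy_cost_square 0 pP; rewrite sub0r trN !mulNmx mulmxN opprK.
rewrite {1}/policy_cost mulmx0 subr0 trmx0 !mul0mx addr0 => h.
move/(canLR (addrK _)): h => <-.
rewrite [LHS]dP -addrA (addrC _ Q) addrA; congr (_ - _).
rewrite -[RHS]mulmxA e1.
have -> : (gain pb P)^T = A^T *m P *m B *m invmx (hess P).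
  by rewrite /gain -/(hess P) !trmx_mul trmxK trmx_inv sG sP !mulmxA.
by rewrite !mulmxA.
Qed.

(* One trajectory cost as a quadratic polynomial in the exploration noise. *)
Lemma cost_to_go_noise P K x eta s : possemidef P ->
  cost_to_go pb P x (- (K *m x) + s *: eta) =
  quadform (policy_cost pb P K) x
  - 2 * s * fdot (hess P *m (K - gain pb P) *m x) eta
  + s ^+ 2 * quadform (hess P) eta.
Proof.
move=> pP; have sP := proj1 pP; rewrite /cost_to_go quadform_policy_cost.
set u := - (K *m x) + s *: eta.
have -> : A *m x + B *m u = (A - B *m K) *m x + s *: (B *m eta).
  by rewrite /u mulmxDr mulmxN -scalemxAr mulmxBl mulmxA addrA.
rewrite /u !quadform_vecD// ?(proj1 pR)//.
have -> : quadform Rc (- (K *m x)) = quadform Rc (K *m x).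
  by rewrite -scaleN1r quadform_vecZ sqrrN expr1n mul1r.
rewrite !quadform_vecZ mulmxBr hess_gain// {2}/hess quadformD quadform_conj.
rewrite /hess !(mulmxBl, mulmxDl, fdotBr, fdotDl, fdotNl, fdotZr, mulmxN).
by rewrite fdot_adj !mulmxBr !(fdotDl, fdotNl) !mulmxA; ring.
Qed.

End lqr_algebra.

(** * One stochastic gradient step *)

Section second_moments.
Context {R : realType} {d1} {S : measurableType d1} (D : probability S R) {n : nat}.
Variables (x : S -> 'cV[R]_n) (S0 : 'M[R]_n).
Hypothesis Exx : forall i j, hasE D (fun s => x s i 0 * x s j 0) (S0 i j).

Lemma hasE_quadform (X : 'M[R]_n) :
  hasE D (fun s => quadform X (x s)) (\tr (X *m S0)).
Proof.
have -> : \tr (X *m S0) = \sum_i \sum_j X i j * S0 j i.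
  by apply: eq_bigr => i _; rewrite mxE.
have h := hasE_sum (index_enum _) (fun i =>
  hasE_sum (index_enum _) (fun j => hasEZ (X i j) (Exx j i))).
apply: hasE_ext h => s; rewrite quadformE fdotE; apply: eq_bigr => i _.
rewrite big_ord1 mxE mulr_sumr; apply: eq_bigr => j _; ring.
Qed.

(** The trace against [S0] is the mean of the quadratic form, so a pointwise order passes to traces
    without a square root of [S0]. *)
Lemma trace_le (X Y : 'M[R]_n) : (forall z, quadform X z <= quadform Y z) ->
  \tr (X *m S0) <= \tr (Y *m S0).
Proof. by move=> XY; apply: hasE_le (hasE_quadform X) (hasE_quadform Y). Qed.

Lemma trace_ge0 (X : 'M[R]_n) : (forall z, 0 <= quadform X z) -> 0 <= \tr (X *m S0).
Proof.
move=> X0; have := @trace_le 0 X; rewrite mul0mx mxtrace0; apply => z.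
by rewrite quadformE mul0mx fdot0r.
Qed.

(** By cyclicity the trace is the sum of the values of the form [S0] on the rows of [K]. *)
Lemma trace_gram_ge c k (K : 'M[R]_(k, n)) : (forall z, c * fdot z z <= quadform S0 z) ->
  c * fdot K K <= \tr (K^T *m K *m S0).
Proof.
move=> Hc; rewrite -mulmxA mxtrace_mulC.
have -> : fdot K K = \sum_i fdot (row i K)^T (row i K)^T.
  rewrite fdotE; apply: eq_bigr => i _; rewrite fdotE; apply: eq_bigr => j _.
  by rewrite big_ord1 !mxE.
rewrite mulr_sumr; apply: ler_sum => i _.
apply: le_trans (Hc _) _; rewrite /quadform trmxK -!row_mul mxE.
by rewrite !mxE le_eqVlt; apply/orP; left; apply/eqP/eq_bigr => j _; rewrite !mxE.
Qed.

End second_moments.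

Section one_step.
Context {R : realType} {n m : nat} (pb : lqr R n m).
Hypotheses (n_gt0 : (0 < n)%N) (m_gt0 : (0 < m)%N) (Hpb : lqr_setting pb).

Local Notation A := (sysA pb).
Local Notation B := (sysB pb).
Local Notation Q := (costQ pb).
Local Notation Rc := (costR pb).
Local Notation S0 := (Sigma0 pb).
Local Notation sigma := (explore pb).

Lemma setting_posQ : posdef Q. Proof. by case: Hpb => _ [? ?]. Qed.
Lemma setting_posR : posdef Rc. Proof. by case: Hpb => _ [? ?]. Qed.
Lemma setting_posS : posdef S0. Proof. by case: Hpb => _ _ [? ? ? ? ?]. Qed.
Lemma setting_posP : posdef (Pstar pb). Proof. by case: Hpb => _ _ _ [? ?]. Qed.
Lemma setting_sigma : 0 < sigma. Proof. by case: Hpb => _ _ _ _ [? ?]. Qed.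
Lemma setting_Cm : 0 < Cm pb. Proof. by case: Hpb => _ _ []. Qed.

(** The setting gives the values of the second moments; integrability has to be recovered. Squares
    are nonnegative with finite integral, and they dominate the mixed products. *)
Lemma init_moments i j :
  hasE (initD pb) (fun x => colvec x i 0 * colvec x j 0) (S0 i j).
Proof.
have Eij a b : (\int[initD pb]_x (tnth x a * tnth x b)%:E = (S0 a b)%:E)%E.
  by have [_ _ [_ H _ _ _] _ _] := Hpb; have := H a b; rewrite unlock.
have mt a : measurable_fun setT (fun x : n.-tuple R => tnth x a).
  exact: measurable_tnth.
have m2 a b : measurable_fun setT (fun x : n.-tuple R => (tnth x a * tnth x b)%:E).
  by apply/measurable_EFinP; exact: measurable_funM.
have isq a : (initD pb).-integrable setT (fun x => (tnth x a * tnth x a)%:E).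
  apply/integrableP; split => //.
  rewrite (_ : (\int[_]_x _)%E = (S0 a a)%:E) ?ltry// -Eij.
  by apply: eq_integral => x _; rewrite gee0_abs// lee_fin -expr2 sqr_ge0.
have mxE2 : (fun x : n.-tuple R => colvec x i 0 * colvec x j 0) =
    fun x => tnth x i * tnth x j by apply/funext => x; rewrite !mxE.
rewrite mxE2; split; last exact: Eij.
apply: (@le_integrable _ _ _ (initD pb) _ _ _
  (fun x => (tnth x i * tnth x i + tnth x j * tnth x j)%:E)) => //.
- move=> x _; rewrite !abse_EFin lee_fin.
  set a := tnth x i; set b := tnth x j.
  have h1 : 0 <= (a - b) ^+ 2 by exact: sqr_ge0.
  have h2 : 0 <= (a + b) ^+ 2 by exact: sqr_ge0.
  rewrite (@ger0_norm _ (a * a + b * b)); last by rewrite -!expr2 addr_ge0 ?sqr_ge0.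
  by rewrite ler_norml; apply/andP; split; nra.
- by under eq_fun do rewrite EFinD; exact: integrableD.
Qed.

Lemma hasE_law d (T : measurableType d) (P : probability T R) d' (S : measurableType d')
    (D : probability S R) (X : T -> S) (f : S -> R) c :
  measurable_fun setT X -> (forall V, measurable V -> P (X @^-1` V) = D V) ->
  measurable_fun setT f -> hasE D f c -> hasE P (f \o X) c.
Proof.
move=> mX PX mf [If Ef]; pose X' : {mfun T >-> S} := mfun_Sub (mem_set mX).
have dE V : measurable V -> D V = distribution P X' V by move=> mV; rewrite -PX.
have mEf : measurable_fun setT (EFin \o f) by exact/measurable_EFinP.
have I1 : P.-integrable setT (EFin \o (f \o X)).
  apply/integrableP; split; first exact: measurableT_comp mEf mX.
  have /integrableP[_] := If.
  rewrite (eq_measure_integral (distribution P X')); last by move=> V mV _; exact: dE.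
  by rewrite ge0_integral_distribution//; exact: measurableT_comp.
split => //; rewrite -Ef (eq_measure_integral (distribution P X')); last first.
  by move=> V mV _; exact: dE.
by rewrite integral_distribution.
Qed.

Definition gap (P : 'M[R]_n) (K : 'M[R]_(m, n)) : R :=
  \tr ((K - gain pb P)^T *m hess pb P *m (K - gain pb P) *m S0).

Definition ccst : R := lambda_min S0 * lambda_min Rc.

Lemma ccst_gt0 : 0 < ccst.
Proof. by rewrite mulr_gt0 ?lambda_min_gt0//; [exact: setting_posS|exact: setting_posR]. Qed.

Lemma muE : mu pb = 4 * ccst.
Proof.
by rewrite /mu !sigma_min_posdef// ?mulrA//; [exact: setting_posR|exact: setting_posS].
Qed.

Lemma JtilE P K : Jtil pb P K = \tr (policy_cost pb P K *m S0).
Proof.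
rewrite /Jtil unlock.
have [_ ->] := hasE_quadform init_moments (Q + K^T *m Rc *m K + (A - B *m K)^T *m P *m (A - B *m K)).
rewrite /=; congr (\tr (_ *m _)); rewrite /policy_cost [RHS]addrC [Q + _ + _]addrAC.
by rewrite addrA.
Qed.

Lemma trace_sq_ge k (K : 'M[R]_(k, n)) : lambda_min S0 * fdot K K <= \tr (K^T *m K *m S0).
Proof.
apply: trace_gram_ge => z; apply: lambda_min_le => //.
exact: (proj1 setting_posS).
Qed.

Lemma trace_hess_ge (G : 'M[R]_m) (E : 'M[R]_(m, n)) :
  (forall z, lambda_min Rc * fdot z z <= quadform G z) ->
  ccst * fdot E E <= \tr (E^T *m G *m E *m S0).
Proof.
move=> HG; have lR := lambda_min_gt0 m_gt0 setting_posR.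
apply: (@le_trans _ _ (\tr (lambda_min Rc *: (E^T *m E) *m S0))).
  rewrite -scalemxAl linearZ /= /ccst mulrAC mulrC ler_wpM2l ?(ltW lR)//.
  exact: trace_sq_ge.
apply: (trace_le init_moments) => z; rewrite quadformZ quadform_conj.
by rewrite -[E^T]mulmx1 quadform_conj quadform_scal mul1r HG.
Qed.

Lemma gap_ge P K : possemidef P ->
  ccst * fdot (K - gain pb P) (K - gain pb P) <= gap P K.
Proof. by move=> pP; apply: trace_hess_ge => z; apply: hess_ge => //; exact: setting_posR. Qed.

Lemma gap_ge0 P K : possemidef P -> 0 <= gap P K.
Proof.
by move=> pP; apply: le_trans (gap_ge K pP); rewrite mulr_ge0 ?fdot_ge0// ltW// ccst_gt0.
Qed.

Lemma Jtil_gap P K : possemidef P -> Jtil pb P K = Jtil pb P (gain pb P) + gap P K.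
Proof.
move=> pP; rewrite !JtilE (policy_cost_square m_gt0 setting_posR K pP).
by rewrite mulmxDl mxtraceD.
Qed.

Lemma Jtil_ge P K : possemidef P -> ccst * fdot K K <= Jtil pb P K.
Proof.
move=> pP; rewrite JtilE.
apply: le_trans (trace_hess_ge K (fun z => lambda_min_le z m_gt0 (proj1 setting_posR))) _.
apply: (trace_le init_moments) => z; rewrite quadform_policy_cost quadform_conj.
rewrite addrAC lerDr addr_ge0 ?(proj2 pP)//.
exact: (proj2 (posdef_psd setting_posQ)).
Qed.

Lemma Jtil_gt0 P K : possemidef P -> 0 < Jtil pb P K.
Proof.
move=> pP; rewrite JtilE; have lQ := lambda_min_gt0 n_gt0 setting_posQ.
have lS := lambda_min_gt0 n_gt0 setting_posS.
apply: (@lt_le_trans _ _ (\tr (lambda_min Q *: ((1%:M : 'M[R]_n)^T *m 1%:M) *m S0))).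
  rewrite -scalemxAl linearZ /= mulr_gt0//.
  apply: lt_le_trans (trace_sq_ge _); rewrite mulr_gt0// fdot_gt0.
  apply/eqP => /matrixP/(_ (Ordinal n_gt0) (Ordinal n_gt0)).
  by rewrite !mxE eqxx => /eqP; rewrite oner_eq0.
apply: (trace_le init_moments) => z.
rewrite quadformZ -[_^T]mulmx1 quadform_conj mul1mx quadform_scal mul1r.
rewrite quadform_policy_cost.
apply: le_trans (lambda_min_le z n_gt0 (proj1 setting_posQ)) _.
rewrite lerDr addr_ge0 ?(proj2 pP)//.
exact: (proj2 (posdef_psd setting_posR)).
Qed.

(** Half the gradient of [Jtil] in the gain. *)
Definition gradmx P K : 'M[R]_(m, n) := hess pb P *m (K - gain pb P) *m S0.

(** With [E = K - gain P] and [Y] the half gradient, [gap = <E, Y>]. From [ccst |E|^2 <= <E, Y>] and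
    [<E, Y>^2 <= |E|^2 |Y|^2], divide by [<E, Y>]. *)
Lemma gap_PL P K : possemidef P ->
  ccst * gap P K <= fdot (gradmx P K) (gradmx P K).
Proof.
move=> pP; set E := K - gain pb P; set Y := gradmx P K.
have fE : gap P K = fdot E Y by rewrite /gap /fdot /Y /gradmx -/E !mulmxA.
have h1 := gap_ge K pP; rewrite -/E fE in h1.
have h2 := fdot_CS E Y; have c0 := ccst_gt0; rewrite fE.
have y0 := fdot_ge0 Y; have e0 := fdot_ge0 E.
have [->|f0] := eqVneq (fdot E Y) 0; first by rewrite mulr0.
have fp : 0 < fdot E Y by rewrite lt_neqAle eq_sym f0 -fE gap_ge0.
rewrite -(ler_pM2l fp) mulrCA -expr2.
apply: le_trans (_ : ccst * (fdot E E * fdot Y Y) <= _).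
  by rewrite ler_wpM2l// ltW.
by rewrite mulrA ler_wpM2r.
Qed.

Let trace_quad_shift (E F : 'M[R]_(m, n)) (H : 'M[R]_m) (S : 'M[R]_n) c :
  H^T = H -> S^T = S ->
  \tr ((E + c *: F)^T *m H *m (E + c *: F) *m S) = \tr (E^T *m H *m E *m S) +
    2 * c * \tr (F^T *m H *m E *m S) + c ^+ 2 * \tr (F^T *m H *m F *m S).
Proof.
move=> sH sS.
have -> : (E + c *: F)^T = E^T + c *: F^T by apply/matrixP => i j; rewrite !mxE.
rewrite !(mulmxDl, mulmxDr) -!scalemxAr -!scalemxAl !mxtraceD !mxtraceZ.
have t1 : \tr (E^T *m H *m F *m S) = \tr (F^T *m H *m E *m S).
  by rewrite -mxtrace_tr !trmx_mul trmxK sH sS mxtrace_mulC !mulmxA.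
rewrite t1; ring.
Qed.

(** An exact expansion, since the gap is quadratic; the rank-one direction factors the second-order
    term into a form in [eta] and a form in [x]. *)
Lemma gap_shift P K c eta (x : 'cV[R]_n) : possemidef P ->
  gap P (K + c *: (eta *m x^T)) = gap P K +
    2 * c * fdot eta (gradmx P K *m x) +
    c ^+ 2 * (quadform (hess pb P) eta * quadform S0 x).
Proof.
move=> pP; rewrite /gap addrAC; set E := K - gain pb P; set H := hess pb P.
have sH : H^T = H by apply: hess_sym => //; [exact: setting_posR|exact: (proj1 pP)].
have sS := proj1 setting_posS.
set F := eta *m x^T.
have t2 : \tr (F^T *m H *m E *m S0) = fdot eta (gradmx P K *m x).
  rewrite /F trmx_mul trmxK /fdot /gradmx -/E -/H -!mulmxA mxtrace_mulC !mulmxA.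
  by [].
have t3 : \tr (F^T *m H *m F *m S0) = quadform H eta * quadform S0 x.
  rewrite /F trmx_mul trmxK; have -> : x *m eta^T *m H *m (eta *m x^T) *m S0 =
     x *m (eta^T *m H *m eta) *m (x^T *m S0) by rewrite !mulmxA.
  rewrite [eta^T *m H *m eta]mx11_scalar mul_mx_scalar -scalemxAl mxtraceZ.
  by rewrite mxtrace_mulC /mxtrace big_ord1.
by rewrite trace_quad_shift// t2 t3.
Qed.

End one_step.

Ltac nonneg := repeat (first [ assumption | exact: specnorm_ge0 |
  exact: fdot_ge0 | exact: sqr_ge0 | exact: powR_ge0 | exact: ler0n |
  exact: ler01 | apply: exprn_ge0 | apply: mulr_ge0 | apply: addr_ge0 ]).

Section one_step_noise.
Context {R : realType} {n m : nat} (pb : lqr R n m).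
Hypotheses (n_gt0 : (0 < n)%N) (m_gt0 : (0 < m)%N) (Hpb : lqr_setting pb).

Local Notation A := (sysA pb).
Local Notation B := (sysB pb).
Local Notation Q := (costQ pb).
Local Notation Rc := (costR pb).
Local Notation S0 := (Sigma0 pb).
Local Notation sigma := (explore pb).

Definition pbnd : R := Pmax pb + acst pb.

Lemma Pmax_ge0 : 0 <= Pmax pb.
Proof. by rewrite !(addr_ge0, mulr_ge0) ?specnorm_ge0 ?sqrtr_ge0. Qed.

Lemma acst_gt0 : 0 < acst pb.
Proof.
have pQ := setting_posQ Hpb.
by rewrite /acst sigma_min_posdef// divr_gt0// lambda_min_gt0.
Qed.

Lemma pbnd_ge0 : 0 <= pbnd.
Proof. by rewrite addr_ge0 ?Pmax_ge0// ltW ?acst_gt0. Qed.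

(* The value matrices for which the constants of the algorithm are valid. *)
Definition okP (P : 'M[R]_n) : Prop :=
  possemidef P /\ forall z, quadform P z <= pbnd * fdot z z.

Definition sgd_step (P : 'M[R]_n) (K : 'M[R]_(m, n)) al
    (z : n.-tuple R * m.-tuple R) : 'M[R]_(m, n) :=
  let x := colvec z.1 in let eta := colvec z.2 in
  K + (al / sigma * cost_to_go pb P x (- (K *m x) + sigma *: eta)) *: (eta *m x^T).

Lemma mxmeas_gain {d'} {U : measurableType d'} (FP : U -> 'M[R]_n) : mxmeas FP ->
  mxmeas (fun u => gain pb (FP u)).
Proof.
move=> mP; apply: mxmeasM; last exact: mxmeas_cst.
apply: mxmeasM => //; apply: mxmeasM; last exact: mxmeas_cst.
apply: mxmeas_inv; apply: mxmeasD; first exact: mxmeas_cst.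
by apply: mxmeasM; [apply: mxmeasM => //|]; exact: mxmeas_cst.
Qed.

Lemma measurable_gap {d'} {U : measurableType d'} (FP : U -> 'M[R]_n)
    (FK : U -> 'M[R]_(m, n)) : mxmeas FP -> mxmeas FK ->
  measurable_fun setT (fun u => gap pb (FP u) (FK u)).
Proof.
move=> mP mK; have mh : mxmeas (fun u => hess pb (FP u)).
  apply: mxmeasD; first exact: mxmeas_cst.
  by apply: mxmeasM; [apply: mxmeasM => //|]; exact: mxmeas_cst.
have mE : mxmeas (fun u => FK u - gain pb (FP u)).
  by apply: mxmeasB => //; exact: mxmeas_gain.
apply: measurable_mxtrace; apply: mxmeasM; last exact: mxmeas_cst.
by apply: mxmeasM => //; apply: mxmeasM => //; exact: mxmeas_tr.
Qed.

Lemma mxmeas_sgd_step {d'} {U : measurableType d'} (FP : U -> 'M[R]_n)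
    (FK : U -> 'M[R]_(m, n)) (fa : U -> R) (FZ : U -> n.-tuple R * m.-tuple R) :
  mxmeas FP -> mxmeas FK -> measurable_fun setT fa -> measurable_fun setT FZ ->
  mxmeas (fun u => sgd_step (FP u) (FK u) (fa u) (FZ u)).
Proof.
move=> mP mK ma mZ.
have mx : mxmeas (fun u => colvec (FZ u).1).
  by apply: mxmeas_colvec; exact: measurableT_comp measurable_fst mZ.
have meta : mxmeas (fun u => colvec (FZ u).2).
  by apply: mxmeas_colvec; exact: measurableT_comp measurable_snd mZ.
have mu : mxmeas (fun u => - (FK u *m colvec (FZ u).1) + sigma *: colvec (FZ u).2).
  by apply: mxmeasD; [apply: mxmeasN; exact: mxmeasM|exact: mxmeasZ].
apply: mxmeasD => //; apply: mxmeasZ; last by apply: mxmeasM => //; exact: mxmeas_tr.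
apply: measurable_funM; first exact: measurable_funM.
apply: measurable_funD; last first.
  apply: measurable_quadform => //.
  by apply: mxmeasD; apply: mxmeasM => //; exact: mxmeas_cst.
by apply: measurable_funD; apply: measurable_quadform => //; exact: mxmeas_cst.
Qed.

Section fixed_stage.
Variables (zeta : R) (P : 'M[R]_n) (K0 K : 'M[R]_(m, n)).
Hypotheses (zeta_gt0 : 0 < zeta) (HP : okP P).
Hypothesis HK : gap pb P K <= 10 * zeta^-1 * Jtil pb P K0.

Local Notation Ct := (Ctil pb zeta P K0).
Local Notation x1 := (xi1 pb zeta P K0).
Local Notation x2 := (xi2 pb).
Local Notation x3 := (xi3 pb zeta P K0).

(** Coercivity of the cost: [ccst |K|^2 <= Jtil K = Jtil (gain P) + gap K]. With [HK] the right-hand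
    side is the numerator of [Ctil], which explains that constant. *)
Lemma fdotK_le : fdot K K <= Ct.
Proof.
have pR := setting_posR Hpb; have pS := setting_posS Hpb.
rewrite /Ctil !sigma_min_posdef// -/(ccst pb) ler_pdivlMr ?ccst_gt0// mulrC.
apply: le_trans (Jtil_ge n_gt0 m_gt0 Hpb K (proj1 HP)) _.
rewrite (Jtil_gap m_gt0 Hpb K (proj1 HP)) addrC lerD2r.
exact: HK.
Qed.

Lemma Ctil_ge0 : 0 <= Ct.
Proof. exact: le_trans (fdot_ge0 _) fdotK_le. Qed.

Lemma xi1_ge0 : 0 <= x1.
Proof.
have b0 := pbnd_ge0; have c0 := Ctil_ge0.
by rewrite /xi1 -/pbnd; nonneg.
Qed.

Lemma xi2_ge0 : 0 <= x2.
Proof.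
have b0 := pbnd_ge0; rewrite /xi2 -/pbnd.
by nonneg.
Qed.

(** The cost is bounded together with the factor [|x|] that it carries in the update direction. The
    part quadratic in [x] then yields [Cm^(3/2)] in [xi1] and the noise part [Cm^(1/2)] in [xi2]. *)
Lemma cost_to_go_bound (x : 'cV[R]_n) (eta : 'cV[R]_m) : fdot x x <= Cm pb ->
  let u := - (K *m x) + sigma *: eta in
  0 <= cost_to_go pb P x u /\
  cost_to_go pb P x u * vnorm x <= x1 + sigma ^+ 2 * x2 * fdot eta eta.
Proof.
move=> xC u; have pR := setting_posR Hpb; have pQ := setting_posQ Hpb.
have [[sP pP] uP] := HP; have s0 := setting_sigma Hpb.
split.
  rewrite /cost_to_go !addr_ge0 ?pP//.
    exact: (proj2 (posdef_psd pQ)).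
  exact: (proj2 (posdef_psd pR)).
have b0 := pbnd_ge0; have C0 := setting_Cm Hpb.
set X := fdot x x; set S := fdot eta eta.
have X0 : 0 <= X := fdot_ge0 x; have S0' : 0 <= S := fdot_ge0 eta.
have uu : fdot u u <= 2 * Ct * X + 2 * sigma ^+ 2 * S.
  apply: le_trans (fdotD_le _ _) _.
  rewrite fdotNl fdotNr opprK fdotZl fdotZr -/S.
  have h : fdot (K *m x) (K *m x) <= Ct * X.
    by apply: le_trans (fdot_mul _ _) _; rewrite ler_wpM2r ?fdotK_le.
  have -> : 2 * Ct * X + 2 * sigma ^+ 2 * S = 2 * (Ct * X) + 2 * (sigma * (sigma * S)).
    by ring.
  by rewrite lerD2r ler_wpM2l.
have U0 : 0 <= fdot u u := fdot_ge0 u.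
set v := A *m x + B *m u.
have vv : fdot v v <= 2 * specnorm A ^+ 2 * X + 2 * specnorm B ^+ 2 * fdot u u.
  apply: le_trans (fdotD_le _ _) _; rewrite -(mulrA 2) -(mulrA 2).
  by apply: lerD; rewrite ler_wpM2l ?specnorm_ub2.
have q1 := quadform_le_specnorm Q x; rewrite -/X in q1.
have q2 := quadform_le_specnorm Rc u; have q3 := uP v.
set nA := specnorm A ^+ 2 in vv *; set nB := specnorm B ^+ 2 in vv *.
have nA0 : 0 <= nA := sqr_ge0 _; have nB0 : 0 <= nB := sqr_ge0 _.
set c1 := specnorm Q + 2 * specnorm Rc * Ct + 2 * pbnd * (nA + 2 * nB * Ct).
set c2 := 2 * (specnorm Rc + 2 * pbnd * nB).
have ct0 := Ctil_ge0; have rc0 := specnorm_ge0 Rc; have q0 := specnorm_ge0 Q.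
have key : cost_to_go pb P x u <= c1 * X + sigma ^+ 2 * c2 * S.
  rewrite /cost_to_go -/v.
  have q2' : quadform Rc u <= specnorm Rc * (2 * Ct * X + 2 * sigma ^+ 2 * S).
    by apply: le_trans q2 _; rewrite ler_wpM2l.
  have q3' : quadform P v <= pbnd * (2 * nA * X + 2 * nB * (2 * Ct * X + 2 * sigma ^+ 2 * S)).
    apply: le_trans q3 _; rewrite ler_wpM2l//; apply: le_trans vv _.
    by rewrite lerD2l ler_wpM2l// mulr_ge0.
  apply: le_trans (lerD (lerD q1 q2') q3') _.
  by rewrite le_eqVlt; apply/orP; left; apply/eqP; rewrite /c1 /c2; ring.
have vx0 := vnorm_ge0 x.
have vxC : vnorm x <= Cm pb `^ (1 / 2).
  rewrite div1r powR12_sqrt ?(ltW C0)// vnormE ler_wsqrtr//.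
have c10 : 0 <= c1 by rewrite /c1; nonneg.
have c20 : 0 <= c2 by rewrite /c2; nonneg.
apply: le_trans (ler_wpM2r vx0 key) _; rewrite mulrDl; apply: lerD.
  rewrite /xi1 -/pbnd -/nA -/nB -/c1 -mulrA ler_wpM2l//.
  have -> : (3 / 2 : R) = 1 + 1 / 2 by field.
  rewrite powRD; last by rewrite (gt_eqF C0) implybT.
  by rewrite powRr1 ?(ltW C0)// ler_pM.
rewrite /xi2 -/pbnd -/nB -/c2 mulrAC ler_wpM2r// -mulrA.
by rewrite ler_wpM2l ?sqr_ge0// ler_wpM2l.
Qed.

Lemma hess_LE z : quadform (hess pb P) z <= C3 pb / 2 * fdot z z.
Proof.
apply: le_trans (@hess_le _ _ _ pb P _ z pbnd_ge0 (proj2 HP)) _.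
by rewrite (_ : C3 pb / 2 = specnorm Rc + pbnd * specnorm B ^+ 2)// /C3 -/pbnd; field.
Qed.

Lemma C3_gt0 : 0 < C3 pb.
Proof.
have pR := setting_posR Hpb.
rewrite /C3 -/pbnd mulr_gt0//; apply: ltr_pwDl; last first.
  by rewrite mulr_ge0 ?pbnd_ge0 ?sqr_ge0.
have [z z0] := cV_neq0 (R := R) m_gt0.
have zp : 0 < fdot z z by rewrite fdot_gt0.
rewrite -(pmulr_lgt0 _ zp).
by apply: lt_le_trans (quadform_le_specnorm _ _); exact: (proj2 pR).
Qed.

(* The right-hand side is a polynomial in the noise whose expectation is known. *)
Lemma gap_noise_bound al (x : 'cV[R]_n) (eta : 'cV[R]_m) u S :
  fdot x x <= Cm pb -> u = - (K *m x) + sigma *: eta -> S = fdot eta eta ->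
  gap pb P (K + (al / sigma * cost_to_go pb P x u) *: (eta *m x^T)) <=
    gap pb P K + 2 * (al / sigma) *
      (cost_to_go pb P x u * fdot eta (gradmx pb P K *m x)) +
    al ^+ 2 * (Lcst pb / 2) * (x1 ^+ 2 / sigma ^+ 2 * S + 2 * x1 * x2 * S ^+ 2
      + sigma ^+ 2 * x2 ^+ 2 * S ^+ 3).
Proof.
move=> xC uE SE; rewrite gap_shift//; last exact: (proj1 HP).
have [q0 qb] := cost_to_go_bound eta xC; rewrite -uE -SE in q0 qb.
set q := cost_to_go pb P x u in q0 qb *; have s0 := setting_sigma Hpb.
rewrite -!addrA lerD2l; apply: lerD; first by rewrite le_eqVlt; apply/orP; left; apply/eqP; ring.
have SS0 : 0 <= S by rewrite SE fdot_ge0.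
have h1 : quadform (hess pb P) eta * quadform S0 x <=
    Lcst pb / 2 * (S * vnorm x ^+ 2).
  have -> : Lcst pb / 2 * (S * vnorm x ^+ 2) =
    (C3 pb / 2 * S) * (specnorm S0 * fdot x x).
    by rewrite sqr_vnorm /Lcst; ring.
  rewrite SE; apply: ler_pM.
  - exact: (proj2 (posdef_psd (hess_posdef m_gt0 (setting_posR Hpb) (proj1 HP)))).
  - exact: (proj2 (posdef_psd (setting_posS Hpb))).
  - exact: hess_LE.
  - exact: quadform_le_specnorm.
have L0 : 0 <= Lcst pb / 2.
  by rewrite divr_ge0// /Lcst mulr_ge0 ?specnorm_ge0// ltW// C3_gt0.
apply: le_trans (ler_wpM2l (sqr_ge0 _) h1) _.
have -> : (al / sigma * q) ^+ 2 * (Lcst pb / 2 * (S * vnorm x ^+ 2)) =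
   al ^+ 2 * (Lcst pb / 2) * ((q * vnorm x) ^+ 2 * S / sigma ^+ 2).
  by field; rewrite gt_eqF.
(* The three terms whose means add up to [xi3] are the expansion of this square, times
   [S / sigma^2]. *)
have -> : x1 ^+ 2 / sigma ^+ 2 * S + (2 * x1 * x2 * S ^+ 2 + sigma ^+ 2 * x2 ^+ 2 * S ^+ 3)
  = (x1 + sigma ^+ 2 * x2 * S) ^+ 2 * S / sigma ^+ 2 by field; rewrite gt_eqF.
apply: ler_wpM2l; first by nonneg.
apply: ler_wpM2r; first by rewrite invr_ge0 sqr_ge0.
apply: ler_wpM2r => //.
rewrite ler_pXn2r// ?nnegrE ?mulr_ge0 ?vnorm_ge0//.
by have h2 := xi1_ge0; have h3 := xi2_ge0; nonneg.
Qed.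

Section noise.
Context {d} {T : measurableType d} (Pr : probability T R)
  (Z : T -> n.-tuple R * m.-tuple R).
Hypothesis mZ : measurable_fun setT Z.
Hypothesis lawx : forall V, measurable V -> Pr [set w | V (Z w).1] = initD pb V.
Hypothesis lawe : forall V : 'I_m -> set R, (forall j, measurable (V j)) ->
  Pr [set w | forall j, V j (tnth (Z w).2 j)] = (\prod_(j < m) normal_prob 0 1 (V j))%E.
Hypothesis indZ : forall V W, measurable V -> measurable W ->
  Pr [set w | V (Z w).1 /\ W (Z w).2] =
  (Pr [set w | V (Z w).1%R] * Pr [set w | W (Z w).2%R])%E.

Let e (j : 'I_m) w := tnth (Z w).2 j.
Let eta w : 'cV[R]_m := colvec (Z w).2.
Let x w : 'cV[R]_n := colvec (Z w).1.

Let mZ1 : measurable_fun setT (fun w => (Z w).1).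
Proof. exact: measurableT_comp measurable_fst mZ. Qed.

Let mZ2 : measurable_fun setT (fun w => (Z w).2).
Proof. exact: measurableT_comp measurable_snd mZ. Qed.

Let me j : measurable_fun setT (e j).
Proof. exact: measurableT_comp (measurable_tnth j) mZ2. Qed.

Let etaE w j : eta w j 0 = e j w. Proof. by rewrite mxE. Qed.

Let hasE_lin y : hasE Pr (fun w => fdot (eta w) y) 0.
Proof.
have h := hasE_sum (index_enum _) (fun j => hasEZ (y j 0) (hasE_gvec1 me lawe j)).
apply: hasE_ext (hasE_eq _ h) => [w|]; last by rewrite big1// => j _; rewrite mulr0.
by rewrite fdotE; apply: eq_bigr => j _; rewrite big_ord1 etaE mulrC.
Qed.

Let hasE_quad g y : hasE Pr (fun w => fdot g (eta w) * fdot (eta w) y) (fdot g y).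
Proof.
have h := hasE_sum (index_enum _) (fun i => hasE_sum (index_enum _)
  (fun j => hasEZ (g i 0 * y j 0) (hasE_gvec2 me lawe i j))).
apply: hasE_ext (hasE_eq _ h) => [w|].
  rewrite !fdotE mulr_suml; apply: eq_bigr => i _; rewrite big_ord1 mulr_sumr.
  by apply: eq_bigr => j _; rewrite big_ord1 !etaE; ring.
rewrite fdotE; apply: eq_bigr => i _; rewrite big_ord1 (bigD1 i)//= eqxx mulr1.
by rewrite big1 ?addr0// => j /negbTE ji; rewrite eq_sym ji mulr0.
Qed.

Let hasE_cub (H : 'M[R]_m) y : hasE Pr (fun w => quadform H (eta w) * fdot (eta w) y) 0.
Proof.
have h := hasE_sum (index_enum _) (fun i => hasE_sum (index_enum _)
  (fun j => hasE_sum (index_enum _) (fun k =>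
   hasEZ (H i j * y k 0) (hasE_gvec3 me lawe i j k)))).
apply: hasE_ext (hasE_eq _ h) => [w|]; last first.
  by rewrite !big1// => i _; rewrite big1// => j _; rewrite big1// => k _; rewrite mulr0.
have -> : fdot (eta w) y = \sum_k e k w * y k 0.
  by rewrite fdotE; apply: eq_bigr => k _; rewrite big_ord1 etaE.
have -> : quadform H (eta w) = \sum_i \sum_j e i w * (H i j * e j w).
  rewrite quadformE fdotE; apply: eq_bigr => i _; rewrite big_ord1 [(H *m _) _ _]mxE mulr_sumr.
  by apply: eq_bigr => j _; rewrite !etaE.
rewrite mulr_suml; apply: eq_bigr => i _.
rewrite mulr_suml; apply: eq_bigr => j _; rewrite mulr_sumr.
by apply: eq_bigr => k _; ring.
Qed.

Let hasE_norm : [/\ hasE Pr (fun w => fdot (eta w) (eta w)) m%:R,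
  hasE Pr (fun w => fdot (eta w) (eta w) ^+ 2) (m%:R * (m%:R + 2)) &
  hasE Pr (fun w => fdot (eta w) (eta w) ^+ 3) (m%:R * (m%:R + 2) * (m%:R + 4))].
Proof.
have SE w : \sum_j e j w ^+ 2 = fdot (eta w) (eta w).
  by rewrite fdotE; apply: eq_bigr => j _; rewrite big_ord1 etaE expr2.
have [h1 h2 h3] := hasE_gvec_norm me lawe.
by split; [apply: hasE_ext h1|apply: hasE_ext h2|apply: hasE_ext h3] => w; rewrite SE.
Qed.

(** The mean over the noise with the state frozen at [y]. In the cost, the terms of degree 0 and 2
    in the noise give odd moments against [eta] and vanish; the linear one contributes [- 2 sigma],
    hence the factor [- 4 al]. *)
Let b al y : R := gap pb P K + al ^+ 2 * (Lcst pb / 2) * x3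
  - 4 * al * quadform ((hess pb P *m (K - gain pb P))^T *m gradmx pb P K) y.

Let inner al y : fdot y y <= Cm pb ->
  hasE Pr (fun v => gap pb P K + 2 * (al / sigma) *
      (cost_to_go pb P y (- (K *m y) + sigma *: eta v) *
       fdot (eta v) (gradmx pb P K *m y)) +
    al ^+ 2 * (Lcst pb / 2) * (x1 ^+ 2 / sigma ^+ 2 * fdot (eta v) (eta v)
      + 2 * x1 * x2 * fdot (eta v) (eta v) ^+ 2
      + sigma ^+ 2 * x2 ^+ 2 * fdot (eta v) (eta v) ^+ 3)) (b al y).
Proof.
move=> yC; have [h1 h2 h3] := hasE_norm; have s0 := setting_sigma Hpb.
set Y := gradmx pb P K *m y; set g := hess pb P *m (K - gain pb P) *m y.
have hc := hasED (hasED (hasEZ (quadform (policy_cost pb P K) y) (hasE_lin Y))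
  (hasEZ (- (2 * sigma)) (hasE_quad g Y)))
  (hasEZ (sigma ^+ 2) (hasE_cub (hess pb P) Y)).
have hn := hasED (hasED (hasEZ (x1 ^+ 2 / sigma ^+ 2) h1) (hasEZ (2 * x1 * x2) h2))
  (hasEZ (sigma ^+ 2 * x2 ^+ 2) h3).
have h := hasED (hasED (hasE_cst Pr (gap pb P K)) (hasEZ (2 * (al / sigma)) hc))
  (hasEZ (al ^+ 2 * (Lcst pb / 2)) hn).
apply: hasE_ext (hasE_eq _ h) => [v|].
  rewrite cost_to_go_noise//; [|exact: setting_posR|exact: (proj1 HP)].
  by rewrite -/g; ring.
have eb : quadform ((hess pb P *m (K - gain pb P))^T *m gradmx pb P K) y = fdot g Y.
  by rewrite quadformE -mulmxA fdot_adj trmxK.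
rewrite /b eb /xi3; field.
by rewrite gt_eqF.
Qed.

(** Off the null set [h] may be negative, so its positive part is used for the comparison of
    nonnegative integrals. *)
Lemma ge0_ae_le_hasE (f : T -> \bar R) h c : measurable_fun setT f ->
  (forall w, 0 <= f w)%E -> hasE Pr h c -> {ae Pr, forall w, (f w <= (h w)%:E)%E} ->
  (\int[Pr]_w f w <= c%:E)%E.
Proof.
move=> mf f0 [Ih <-] fh; have mh : measurable_fun setT h.
  by apply/measurable_EFinP; exact: measurable_int Ih.
have -> : (\int[Pr]_w (h w)%:E = \int[Pr]_w (Num.max (h w) 0)%:E)%E.
  apply: ae_eq_integral => //.
  - exact: measurable_int Ih.
  - by apply/measurable_EFinP; exact: measurable_fun_maxr.
  - apply: filterS fh => w fw _; congr EFin; apply/esym/max_idPl.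
    by rewrite -lee_fin; exact: le_trans (f0 w) fw.
apply: ae_ge0_le_integral => //.
- by move=> w _; rewrite lee_fin le_max lexx orbT.
- by apply/measurable_EFinP; exact: measurable_fun_maxr.
- by apply: filterS fh => w fw _; apply: le_trans fw _; rewrite lee_fin le_max lexx.
Qed.

(** The noise is integrated first, at states with [|x|^2 <= Cm], hence almost surely; averaging [b]
    over the state leaves [- 4 al |gradmx|^2]. Gradient domination and [mu = 4 ccst] give the
    contraction. *)
Lemma one_step al : 0 <= al ->
  (\int[Pr]_w (gap pb P (sgd_step P K al (Z w)))%:E <=
   ((1 - mu pb * al) * gap pb P K + al ^+ 2 * (Lcst pb / 2) * x3)%:E)%E.
Proof.
move=> al0; pose Phi z := (gap pb P (sgd_step P K al z))%:E.
have mPhi : measurable_fun setT Phi.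
  apply/measurable_EFinP; apply: measurable_gap; first exact: mxmeas_cst.
  exact: mxmeas_sgd_step.
have Phi0 z : (0 <= Phi z)%E by rewrite lee_fin gap_ge0//; exact: (proj1 HP).
have -> : (\int[Pr]_w (gap pb P (sgd_step P K al (Z w)))%:E =
    \int[Pr]_w \int[Pr]_v Phi ((Z w).1, (Z v).2))%E.
  rewrite -(indep_integral mZ1 mZ2 _ mPhi Phi0).
    by apply: eq_integral => w _; rewrite -surjective_pairing.
  by move=> V W mV mW; exact: indZ.
have s0 := setting_sigma Hpb.
have mF : measurable_fun setT (fun w => \int[Pr]_v Phi ((Z w).1, (Z v).2))%E.
  have mG : measurable_fun setT (fun sv : n.-tuple R * T => Phi (sv.1, (Z sv.2).2)).
    apply: measurableT_comp => //; apply: measurable_fun_pair => //.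
    exact: measurableT_comp mZ2 measurable_snd.
  have := @measurable_fun_fubini_tonelli_F _ _ _ _ _ Pr _ mG.
  by move=> /(_ (fun _ => Phi0 _)) h; exact: measurableT_comp h mZ1.
have hb : hasE Pr (b al \o x)
    (gap pb P K + al ^+ 2 * (Lcst pb / 2) * x3
      - 4 * al * fdot (gradmx pb P K) (gradmx pb P K)).
  have hq := hasE_quadform (init_moments Hpb)
    ((hess pb P *m (K - gain pb P))^T *m gradmx pb P K).
  have := hasE_law mZ1 lawx _ hq; set c := \tr _ => hq2.
  have cE : c = fdot (gradmx pb P K) (gradmx pb P K).
    rewrite [in RHS]/fdot [X in _ = \tr (X^T *m _)]/gradmx (trmx_mul _ S0).
    by rewrite (proj1 (setting_posS Hpb)) -mulmxA mxtrace_mulC.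
  have {}hq2 : hasE Pr (fun w => quadform
      ((hess pb P *m (K - gain pb P))^T *m gradmx pb P K) (x w)) c.
    apply: hq2; apply: measurable_quadform; first exact: mxmeas_cst.
    exact: mxmeas_colvec.
  have := hasED (hasE_cst Pr (gap pb P K + al ^+ 2 * (Lcst pb / 2) * x3))
    (hasEZ (- (4 * al)) hq2).
  by rewrite -cE mulNr; apply: hasE_ext => w; rewrite mulNr.
have aeC : {ae Pr, forall w, fdot (x w) (x w) <= Cm pb}.
  have [_ _ [_ _ _ _ [N [mN N0 Nsub]]] _ _] := Hpb.
  exists ((fun w => (Z w).1) @^-1` N); split.
  - by rewrite -[X in measurable X]setTI; exact: mZ1.
  - by have := lawx mN => /= ->.
  - by move=> w /= h; apply: Nsub => /=; rewrite sqr_vnorm.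
apply: le_trans (ge0_ae_le_hasE mF _ hb _) _.
- by move=> w; exact: integral_ge0.
- apply: filterS aeC => w xC.
  have [Ii Ei] := inner al xC; rewrite /= -Ei.
  apply: ge0_le_integral => //.
  + by apply: measurableT_comp => //; apply: measurable_fun_pair.
  + exact: measurable_int Ii.
  + by move=> v _; rewrite lee_fin; exact: gap_noise_bound.
rewrite lee_fin muE//.
have := gap_PL n_gt0 m_gt0 Hpb K (proj1 HP) => PL.
have h := ler_wpM2l (mulr_ge0 (ler0n R 4) al0) PL.
by move: h; lra.
Qed.

End noise.
End fixed_stage.

End one_step_noise.

(** * One stage of the algorithm *)

Section past_monotone.
Context {R : realType} {d d'} {T : measurableType d} {S : measurableType d'}
  {I : choiceType} (X : I -> T -> S).

Lemma measurable_past_sub {d2} {U : measurableType d2} (J J' : set I) (F : T -> U) :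
  J `<=` J' ->
  measurable_fun setT (F : g_sigma_algebraType (past_system X J) -> U) ->
  measurable_fun setT (F : g_sigma_algebraType (past_system X J') -> U).
Proof.
move=> JJ mF _ Y mY; have := mF measurableT Y mY; rewrite !setTI.
move=> h; have sub : past_system X J `<=`
    (measurable : set (set (g_sigma_algebraType (past_system X J')))).
  move=> _ [s [V [us sJ mV ->]]]; apply: sub_sigma_algebra.
  by exists s, V; split => // k /sJ; exact: JJ.
apply: h; split => //; split; first exact: measurable0.
  by move=> B mB; rewrite setTD; exact: measurableC.
by move=> G mG; exact: bigcup_measurable.
Qed.

Lemma mxmeas_past_sub (J J' : set I) k l (F : T -> 'M[R]_(k, l)) : J `<=` J' ->
  mxmeas (F : g_sigma_algebraType (past_system X J) -> 'M[R]_(k, l)) ->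
  mxmeas (F : g_sigma_algebraType (past_system X J') -> 'M[R]_(k, l)).
Proof.
move=> JJ mF i j.
exact: (measurable_past_sub (F := fun w => F w i j) JJ (mF i j)).
Qed.

Lemma measurable_past_real (J : set I) {d2} {U : measurableType d2} (F : T -> U) :
  (forall k, measurable_fun setT (X k)) ->
  measurable_fun setT (F : g_sigma_algebraType (past_system X J) -> U) ->
  measurable_fun setT F.
Proof.
by move=> mX mF; exact: measurableT_comp mF (measurable_past_id (J := J) mX).
Qed.

End past_monotone.

Section stage_inequalities.
Context {R : realFieldType}.

(** [D / t] is a supersolution of the recursion [r |-> (1 - 2/t) r + D/t^2], with slack
    [D / (t^2 (t + 1))]. *)
Lemma rate_step (D t : R) : 0 <= D -> 2 <= t ->
  (1 - 2 / t) * (D / t) + D / t ^+ 2 <= D / (t + 1).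
Proof.
move=> D0 t2; have t0 : 0 < t by lra.
rewrite -subr_ge0.
have -> : D / (t + 1) - ((1 - 2 / t) * (D / t) + D / t ^+ 2) = D / (t ^+ 2 * (t + 1)).
  by field; rewrite !gt_eqF//; lra.
by rewrite divr_ge0// mulr_ge0 ?sqr_ge0//; lra.
Qed.

(** Since [1/t^2 <= 1/(t-1) - 1/t], the quantity [D / (t - 1)] dominates the whole remaining sum of
    the noise terms. *)
Lemma telescope_step (D t : R) : 0 <= D -> 1 < t ->
  D / t ^+ 2 + D / t <= D / (t - 1).
Proof.
move=> D0 t1; have t0 : 0 < t by lra.
rewrite -subr_ge0.
have -> : D / (t - 1) - (D / t ^+ 2 + D / t) = D / (t ^+ 2 * (t - 1)).
  by field; rewrite !gt_eqF//; lra.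
by rewrite divr_ge0// mulr_ge0 ?sqr_ge0//; lra.
Qed.

End stage_inequalities.

Lemma mxmeas_comp {R : realType} {d1 d2} {U1 : measurableType d1}
    {U2 : measurableType d2} k l (F : U2 -> 'M[R]_(k, l)) (g : U1 -> U2) :
  mxmeas F -> measurable_fun setT g -> mxmeas (fun w => F (g w)).
Proof.
by move=> mF mg i j; exact: (measurableT_comp (f := fun w => F w i j) (mF i j) mg).
Qed.

(** * Measurability of the random parameters of a stage *)

Section stage_measurability.
Context {R : realType} {n m : nat} (pb : lqr R n m).
Hypotheses (n_gt0 : (0 < n)%N) (m_gt0 : (0 < m)%N) (Hpb : lqr_setting pb).
Variables (zeta vs : R) (K0 : 'M[R]_(m, n)).
Context {d'} {U : measurableType d'}.
Implicit Types (FP : U -> 'M[R]_n) (FK : U -> 'M[R]_(m, n)).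

Lemma measurable_Jtil FP FK : mxmeas FP -> mxmeas FK ->
  measurable_fun setT (fun u => Jtil pb (FP u) (FK u)).
Proof.
move=> mFP mFK; under eq_fun do rewrite JtilE//.
have c1 k l (C : 'M[R]_(k, l)) : mxmeas (fun _ : U => C) := mxmeas_cst C.
have mBK : mxmeas (fun u => sysA pb - sysB pb *m FK u).
  by apply: mxmeasB => //; exact: mxmeasM.
apply: measurable_mxtrace; apply: mxmeasM => //; apply: mxmeasD => //.
apply: mxmeasD; apply: mxmeasM => //; apply: mxmeasM => //; exact: mxmeas_tr.
Qed.

Lemma measurable_theta FP : mxmeas FP ->
  measurable_fun setT (fun u => theta pb zeta (FP u) K0).
Proof.
move=> mFP; have mJ : measurable_fun setT (fun u => Jtil pb (FP u) K0).
  by apply: measurable_Jtil => //; exact: mxmeas_cst.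
have mC : measurable_fun setT (fun u => Ctil pb zeta (FP u) K0).
  apply: measurable_funM => //; apply: measurable_funD; first exact: measurable_funM.
  by apply: measurable_Jtil => //; exact: mxmeas_gain.
have m1 : measurable_fun setT (fun u => xi1 pb zeta (FP u) K0).
  apply: measurable_funM => //; apply: measurable_funD.
    by apply: measurable_funD => //; exact: measurable_funM.
  apply: measurable_funM => //; apply: measurable_funD => //.
  exact: measurable_funM.
have m3 : measurable_fun setT (fun u => xi3 pb zeta (FP u) K0).
  apply: measurable_funD => //; apply: measurable_funD.
    by apply: measurable_funM => //; apply: measurable_funM => //; exact: measurable_funX.
  by do 4![apply: measurable_funM => //].
apply: measurable_fun_maxr => //; apply: measurable_funM; first exact: measurable_funM.
by apply: measurable_fun_invr; exact: measurable_funM.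
Qed.

Lemma mxmeas_sgd FP (FZ : nat -> U -> n.-tuple R * m.-tuple R) i : mxmeas FP ->
  (forall j, measurable_fun setT (FZ j)) ->
  mxmeas (fun u => sgd pb zeta (FP u) K0 (FZ^~ u) i).
Proof.
move=> mFP mFZ; elim: i => [|i IH]; first exact: mxmeas_cst.
have mt := measurable_theta mFP.
apply: (mxmeas_sgd_step pb mFP IH _ (mFZ i)); apply: measurable_funM => //.
by apply: measurable_funM => //; apply: measurable_fun_invr; exact: measurable_funD.
Qed.

Lemma mxmeas_sgd_iterations FP (FZ : nat -> U -> n.-tuple R * m.-tuple R) : mxmeas FP ->
  (forall j, measurable_fun setT (FZ j)) ->
  mxmeas (fun u => sgd pb zeta (FP u) K0 (FZ^~ u) (iterations pb zeta (FP u) K0 vs)).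
Proof.
move=> mFP mFZ.
apply: (mxmeas_nat (F := fun i u => sgd pb zeta (FP u) K0 (FZ^~ u) i)) => [i|i].
  exact: mxmeas_sgd.
apply: measurable_nat_ceil_eq; apply: measurable_funM.
  by apply: measurable_funM => //; exact: measurable_theta.
by apply: measurable_Jtil => //; exact: mxmeas_cst.
Qed.

Variables (FP : U -> 'M[R]_n) (FK : U -> 'M[R]_(m, n)) (FZ : U -> n.-tuple R * m.-tuple R).
Hypotheses (mFP : mxmeas FP) (mFK : mxmeas FK) (mFZ : measurable_fun setT FZ).

Lemma measurable_next i : mxmeas (fun u =>
  if (i < iterations pb zeta (FP u) K0 vs)%N &&
     (gap pb (FP u) (FK u) <= 10 * zeta^-1 * Jtil pb (FP u) K0)
  then sgd_step pb (FP u) (FK u) (stepsize pb zeta (FP u) K0 i) (FZ u) else FK u).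
Proof.
have mt := measurable_theta mFP.
have mJ : measurable_fun setT (fun u => Jtil pb (FP u) K0).
  by apply: measurable_Jtil => //; exact: mxmeas_cst.
apply: mxmeas_if => //; last first.
  apply: mxmeas_sgd_step => //; apply: measurable_funM => //.
  by apply: measurable_funM => //; apply: measurable_fun_invr; exact: measurable_funD.
apply: measurable_and.
  under eq_fun do rewrite lt_nat_ceil.
  apply: measurable_fun_ltr => //; apply: measurable_funM => //.
  exact: measurable_funM.
apply: measurable_fun_ler; first exact: measurable_gap.
exact: measurable_funM.
Qed.

End stage_measurability.

Section stage.
Context {R : realType} {n m : nat} (pb : lqr R n m).
Hypotheses (n_gt0 : (0 < n)%N) (m_gt0 : (0 < m)%N) (Hpb : lqr_setting pb).
Context {d} {T : measurableType d} (Pr : probability T R).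
Variable Z : nat -> nat -> {mfun T >-> (n.-tuple R * m.-tuple R)%type}.
Hypothesis HZ : fresh_samples Pr (initD pb) Z.
Variables (zeta vs : R) (h : nat) (K0 : 'M[R]_(m, n)).
Hypotheses (zeta_gt0 : 0 < zeta) (zeta_lt1 : zeta < 1) (vs_gt0 : 0 < vs).

Let X (k : nat * nat) : T -> n.-tuple R * m.-tuple R := Z k.1 k.2.
(** Stages are executed by decreasing index: before iteration [i] of stage [h], the draws of the
    stages above [h] and the first [i] draws of stage [h] are known. *)
Let J i : set (nat * nat) := [set k | (h < k.1)%N \/ k.1 = h /\ (k.2 < i)%N].
Local Notation past i := (g_sigma_algebraType (past_system X (J i))).

Let mX k : measurable_fun setT (X k).
Proof. exact: measurable_funPT. Qed.

Let J_mono i j : (i <= j)%N -> J i `<=` J j.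
Proof. by move=> ij k [|[kh ki]]; [left|right; split=> //; exact: leq_trans ki ij]. Qed.

(** [P] is the random value matrix received by the stage, [Gd] the event that the stages already
    executed succeeded, and [Tm] a deterministic bound for the random number of iterations, so that
    the recursion can be run for a fixed time. *)
Variables (P : T -> 'M[R]_n) (Gd : set T) (Tm : nat).
Hypothesis mP : mxmeas (P : past 0 -> 'M[R]_n).
Hypothesis mGd : measurable (Gd : set (past 0)).
Hypothesis Gd_ok : forall w, Gd w -> okP pb (P w).

Let J0 w := Jtil pb (P w) K0.
Let th w := theta pb zeta (P w) K0.
Let lam w := 10 * zeta^-1 * J0 w.
Let al i w := stepsize pb zeta (P w) K0 i.
Let N w := iterations pb zeta (P w) K0 vs.
Let V (w : T) K := gap pb (P w) K.

Hypothesis Gd_N : forall w, Gd w -> (N w <= Tm)%N.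

Let active i w K := (i < N w)%N && (V w K <= lam w).
Let next i w K z := if active i w K then sgd_step pb (P w) K (al i w) z else K.
(* The recursion frozen at its first exit from [gap <= lam], where the constants
   of the algorithm are valid, and after the prescribed number of steps. *)
Fixpoint xs i w := if i is j.+1 then next j w (xs j w) (Z h j w) else K0.

Let th_ge2 w : 2 <= th w. Proof. by rewrite /th /theta le_max lexx. Qed.

Let mPi i : mxmeas (P : past i -> 'M[R]_n).
Proof. exact: (mxmeas_past_sub (J_mono (leq0n i)) mP). Qed.

Let mZi i : measurable_fun setT (Z h i : past i.+1 -> _).
Proof.
have Jk : J i.+1 (h, i) by right; split => /=.
exact: (measurable_past (X := X) Jk).
Qed.

Let mxs i : mxmeas (xs i : past i -> 'M[R]_(m, n)).
Proof.
elim: i => [|i IH]; first exact: mxmeas_cst.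
have IHi : mxmeas (xs i : past i.+1 -> 'M[R]_(m, n)).
  exact: (mxmeas_past_sub (J_mono (leqnSn i)) IH).
exact: (measurable_next Hpb zeta vs K0 (@mPi i.+1) IHi (@mZi i) i).
Qed.

Let D w := th w * J0 w.

(** The step size makes [mu al = 2 / (i + theta)]. The second entry of the maximum defining [theta]
    is what bounds the noise term [al^2 (L/2) xi3] by [theta J0 / (i + theta)^2]. *)
Let step_bound i w : Gd w -> active i w (xs i w) ->
  (\int[Pr]_v (V w (sgd_step pb (P w) (xs i w) (al i w) (Z h i v)))%:E <=
   ((1 - 2 / (i%:R + th w)) * V w (xs i w) + D w / (i%:R + th w) ^+ 2)%:E)%E.
Proof.
move=> Gw /andP[_ Vl]; have ok := Gd_ok Gw; have [lx le li _] := HZ.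
have c0 := ccst_gt0 n_gt0 m_gt0 Hpb.
have mu0 : 0 < mu pb by rewrite muE// mulr_gt0.
have t0 : 0 < i%:R + th w by rewrite ltr_wpDl// (lt_le_trans _ (th_ge2 w)).
have al0 : 0 <= al i w by rewrite /al /stepsize -/(th w) mulr_ge0// divr_ge0// ltW.
have := one_step n_gt0 m_gt0 Hpb ok Vl (mX (h, i)) (lx h i) (le h i) (li h i) al0.
move/le_trans; apply.
have Jp : 0 < J0 w by apply: Jtil_gt0 => //; exact: (proj1 ok).
rewrite lee_fin; apply: lerD.
  by rewrite /al /stepsize -/(th w) le_eqVlt; apply/orP; left; apply/eqP; field;
    rewrite !gt_eqF.
rewrite ler_pdivlMr ?exprn_gt0//.
have -> : al i w ^+ 2 * (Lcst pb / 2) * xi3 pb zeta (P w) K0 * (i%:R + th w) ^+ 2 =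
   2 * Lcst pb * xi3 pb zeta (P w) K0 / (mu pb ^+ 2 * J0 w) * J0 w.
  by rewrite /al /stepsize -/(th w); field; rewrite !gt_eqF.
by rewrite ler_wpM2r ?(ltW Jp)// /th /theta le_max lexx orbT.
Qed.

(* Conditioning on the past turns the one-step estimate into an inequality
   between expectations, for every nonnegative weight known before stage [h]. *)
Let expect_next i (c : T -> R) (g : T -> R -> R) (b : T -> R) :
  measurable_fun setT (c : past 0 -> R) -> (forall w, 0 <= c w) ->
  measurable_fun setT (fun w => c w * b w) ->
  measurable_fun setT (fun p : past i * R => g p.1 p.2) ->
  (forall w r, Gd w -> 0 <= r -> 0 <= g w r) ->
  (forall w, Gd w -> (\int[Pr]_v (g w (V w (next i w (xs i w) (Z h i v))))%:E <= (b w)%:E)%E) ->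
  (forall w, ~ Gd w -> c w = 0) ->
  (forall w, 0 <= c w * b w) ->
  (\int[Pr]_w (c w * g w (V w (xs i.+1 w)))%:E <= \int[Pr]_w (c w * b w)%:E)%E.
Proof.
move=> mc c0 mcb mg g0 gb cGd cb0.
have V0 w K : Gd w -> 0 <= V w K.
  by move=> Gw; apply: gap_ge0 => //; exact: (proj1 (Gd_ok Gw)).
have mPf : mxmeas (fun p : past i * (n.-tuple R * m.-tuple R) => P p.1).
  exact: (mxmeas_comp (@mPi i) measurable_fst).
have mxf : mxmeas (fun p : past i * (n.-tuple R * m.-tuple R) => xs i p.1).
  exact: (mxmeas_comp (@mxs i) measurable_fst).
have mV : measurable_fun setT (fun p : past i * (n.-tuple R * m.-tuple R) =>
    V p.1 (next i p.1 (xs i p.1) p.2)).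
  apply: (measurable_gap pb mPf).
  exact: (measurable_next Hpb zeta vs K0 mPf mxf measurable_snd i).
have mci : measurable_fun setT (c : past i -> R).
  exact: (measurable_past_sub (J_mono (leq0n i)) mc).
pose F (p : past i * (n.-tuple R * m.-tuple R)) :=
  (c p.1 * g p.1 (V p.1 (next i p.1 (xs i p.1) p.2)))%:E.
have mF : measurable_fun setT F.
  apply/measurable_EFinP; apply: measurable_funM.
    exact: measurableT_comp mci measurable_fst.
  have mpair : measurable_fun setT (fun p : past i * (n.-tuple R * m.-tuple R) =>
      (p.1, V p.1 (next i p.1 (xs i p.1) p.2)) : past i * R).
    by apply: measurable_fun_pair.
  exact: measurableT_comp mg mpair.
have F0 p : (0 <= F p)%E.
  rewrite lee_fin; have [Gw|nG] := pselect (Gd p.1); last by rewrite cGd// mul0r.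
  by rewrite mulr_ge0// g0// V0.
have nJ : ~ J i (h, i) by move=> [|[_]] /=; rewrite ltnn.
have [_ _ _ ind] := HZ.
have -> : (\int[Pr]_w (c w * g w (V w (xs i.+1 w)))%:E =
  \int[Pr]_w \int[Pr]_v F (w, X (h, i) v))%E.
  by rewrite -(past_integral mX ind nJ mF F0).
apply: ge0_le_integral => //.
- by move=> w _; exact: integral_ge0.
- have mG : measurable_fun setT (fun p : past i * T => F (p.1, X (h, i) p.2)).
    apply: measurableT_comp => //; apply: measurable_fun_pair => //.
    exact: measurableT_comp (mX (h, i)) measurable_snd.
  have := @measurable_fun_fubini_tonelli_F _ _ _ _ _ Pr _ mG.
  move=> /(_ (fun _ => F0 _)) mFF.
  exact: (measurable_past_real mX mFF).
- by apply/measurable_EFinP.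
- move=> w _; have [Gw|nG] := pselect (Gd w); last first.
    rewrite [leRHS](_ : _ = 0%E); last by rewrite cGd// mul0r.
    rewrite (_ : (\int[_]_v _)%E = 0%E)//.
    by apply: integral0_eq => v _; rewrite /F /= cGd// mul0r.
  rewrite /F /= EFinM; under eq_integral do rewrite EFinM.
  rewrite ge0_integralZl//.
  + by apply: lee_wpmul2l; [rewrite lee_fin|exact: gb].
  + apply/measurable_EFinP.
    have mpw : measurable_fun setT (fun v : T =>
      (w, V w (next i w (xs i w) (Z h i v))) : past i * R).
      apply: measurable_fun_pair => //.
      have := measurableT_comp mV (measurable_pair1 (w : past i)).
      by move=> mVw; exact: measurableT_comp mVw (mX (h, i)).
    exact: measurableT_comp mg mpw.
  + by move=> v _; rewrite lee_fin g0// V0.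
  + by rewrite lee_fin.
Qed.

Let Vxs_ge0 i w : Gd w -> 0 <= V w (xs i w).
Proof. by move=> Gw; apply: gap_ge0 => //; exact: (proj1 (Gd_ok Gw)). Qed.

Let D_ge0 w : Gd w -> 0 <= D w.
Proof.
move=> Gw; rewrite mulr_ge0// ?(le_trans _ (th_ge2 w))//.
by apply/ltW/Jtil_gt0 => //; exact: (proj1 (Gd_ok Gw)).
Qed.

Let u i w := if V w (xs i w) <= lam w then V w (xs i w) else 0.

Let mR i (f : T -> R) : measurable_fun setT (f : past i -> R) -> measurable_fun setT f.
Proof. exact: measurable_past_real. Qed.

Let mth i : measurable_fun setT (th : past i -> R).
Proof. exact: (measurable_theta Hpb zeta K0 (@mPi i)). Qed.

Let mJ0 i : measurable_fun setT (J0 : past i -> R).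
Proof. exact: (measurable_Jtil Hpb (@mPi i) (mxmeas_cst K0)). Qed.

Let mD i : measurable_fun setT (D : past i -> R).
Proof. exact: measurable_funM. Qed.

Let mV i : measurable_fun setT (fun w : past i => V w (xs i w)).
Proof. exact: (measurable_gap pb (@mPi i) (@mxs i)). Qed.

Let mlam i : measurable_fun setT (lam : past i -> R).
Proof. exact: measurable_funM. Qed.

(** Inequalities between these integrals for every weight known before the stage stand for
    inequalities between conditional expectations. *)
Let wint (c f : T -> R) := (\int[Pr]_w (c w * f w)%:E)%E.

Section weights.
Variable c : T -> R.
Hypothesis mc : measurable_fun setT (c : past 0 -> R).
Hypothesis c0 : forall w, 0 <= c w.
Hypothesis cGd : forall w, ~ Gd w -> c w = 0.

Let mcT : measurable_fun setT c. Proof. exact: mR mc. Qed.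

Lemma wint_ge0_cond f w : (Gd w -> 0 <= f w) -> 0 <= c w * f w.
Proof.
move=> f0; have [Gw|nG] := pselect (Gd w); last by rewrite cGd// mul0r.
by rewrite mulr_ge0// f0.
Qed.

Lemma wintD (f g : T -> R) : measurable_fun setT f -> measurable_fun setT g ->
  (forall w, Gd w -> 0 <= f w) -> (forall w, Gd w -> 0 <= g w) ->
  wint c (fun w => f w + g w) = (wint c f + wint c g)%E.
Proof.
move=> mf mg f0 g0; rewrite /wint; under eq_integral do rewrite mulrDr EFinD.
rewrite ge0_integralD//.
- by move=> w _; rewrite lee_fin; apply: wint_ge0_cond => /f0.
- by apply/measurable_EFinP; exact: measurable_funM.
- by move=> w _; rewrite lee_fin; apply: wint_ge0_cond => /g0.
- by apply/measurable_EFinP; exact: measurable_funM.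
Qed.

Lemma wint_le (f g : T -> R) : measurable_fun setT f -> measurable_fun setT g ->
  (forall w, Gd w -> 0 <= f w) -> (forall w, Gd w -> f w <= g w) ->
  (wint c f <= wint c g)%E.
Proof.
move=> mf mg f0 fg; apply: ge0_le_integral => //.
- by move=> w _; rewrite lee_fin; apply: wint_ge0_cond => /f0.
- by apply/measurable_EFinP; exact: measurable_funM.
- by apply/measurable_EFinP; exact: measurable_funM.
- move=> w _; rewrite lee_fin; have [Gw|nG] := pselect (Gd w); last by rewrite cGd// !mul0r.
  by rewrite ler_wpM2l// fg.
Qed.

Lemma expect_next_wint i (g : T -> R -> R) (b : T -> R) :
  measurable_fun setT b ->
  measurable_fun setT (fun p : past i * R => g p.1 p.2) ->
  (forall w r, Gd w -> 0 <= r -> 0 <= g w r) ->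
  (forall w, Gd w -> (\int[Pr]_v (g w (V w (next i w (xs i w) (Z h i v))))%:E <= (b w)%:E)%E) ->
  (forall w, Gd w -> 0 <= b w) ->
  (wint c (fun w => g w (V w (xs i.+1 w))) <= wint c b)%E.
Proof.
move=> mb mg g0 gb b0; apply: expect_next => //; first exact: measurable_funM.
by move=> w; apply: wint_ge0_cond => /b0.
Qed.

(** The budget for all noise still to come, by [telescope_step]. *)
Let tl i w := D w / (i%:R + th w - 1).

Let th1 i w : 1 < i%:R + th w.
Proof. by rewrite ltr_wpDl// (lt_le_trans _ (th_ge2 w))// ltr1n. Qed.

Let tl_ge0 i w : Gd w -> 0 <= tl i w.
Proof. by move=> Gw; rewrite divr_ge0 ?D_ge0// subr_ge0 ltW. Qed.

Let mtl i : measurable_fun setT (tl i : past 0 -> R).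
Proof.
apply: measurable_funM; first exact: mD.
apply: measurable_fun_invr; apply: measurable_funB => //.
by apply: measurable_funD => //; exact: mth.
Qed.

Let tlE i w : tl i.+1 w = D w / (i%:R + th w).
Proof. by rewrite /tl -natr1; congr (_ / _); ring. Qed.

Let tl_step i w : Gd w -> D w / (i%:R + th w) ^+ 2 + tl i.+1 w <= tl i w.
Proof. by move=> Gw; rewrite tlE; apply: telescope_step => //; exact: D_ge0. Qed.

Let tl_mono i w : Gd w -> tl i.+1 w <= tl i w.
Proof.
move=> Gw; apply: le_trans (tl_step i Gw); rewrite lerDr divr_ge0 ?D_ge0//.
exact: sqr_ge0.
Qed.

Let gap_sum i : (wint c (fun w => V w (xs i w)) + wint c (tl i) <=
  wint c (fun w => V w K0) + wint c (tl 0))%E.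
Proof.
elim: i => [|i IH] //; apply: le_trans IH.
have mVi := mR (@mV i); have mdi := mR (@mtl i); have mdi1 := mR (@mtl i.+1).
have me : measurable_fun setT (fun w => tl i w - tl i.+1 w) by exact: measurable_funB.
have e0 w : Gd w -> 0 <= tl i w - tl i.+1 w by move=> Gw; rewrite subr_ge0 tl_mono.
have V0 w : Gd w -> 0 <= V w (xs i w) by exact: Vxs_ge0.
apply: le_trans (leeD2r _ (expect_next_wint (i := i) (g := fun _ r => r)
  (b := fun w => V w (xs i w) + (tl i w - tl i.+1 w)) _ _ _ _ _)) _.
- exact: measurable_funD.
- exact: measurable_snd.
- by [].
- move=> w Gw; rewrite /next; case: (boolP (active i w (xs i w))) => act; last first.
    by rewrite integral_cst//= probability_setT mule1 lee_fin lerDl e0.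
  apply: le_trans (step_bound Gw act) _; rewrite lee_fin.
  rewrite mulrBl mul1r -addrA lerD2l; have := tl_step i Gw.
  have : 0 <= 2 / (i%:R + th w) * V w (xs i w).
    by rewrite mulr_ge0 ?V0// divr_ge0// ltW// (lt_trans _ (th1 i w)).
  set x := _ * V _ _; set y := D w / _; lra.
- by move=> w Gw; rewrite addr_ge0 ?V0 ?e0.
- rewrite (wintD mVi me V0 e0) -addeA; apply: leeD2l.
  rewrite -(wintD me mdi1 e0 (@tl_ge0 _)).
  by apply: wint_le => // [|w Gw|w Gw];
    [exact: measurable_funD|rewrite subrK tl_ge0|rewrite subrK].
Qed.

Lemma gap_K0 w : Gd w -> V w K0 <= J0 w.
Proof.
move=> Gw; have okw := proj1 (Gd_ok Gw).
by rewrite /J0 Jtil_gap// lerDr ltW// Jtil_gt0.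
Qed.

(** The 3 is 1 + 2: the initial gap is at most [J0], and [tl 0 = J0 theta / (theta - 1) <= 2 J0]
    because [theta >= 2]. *)
Lemma gap_growth i : (wint c (fun w => V w (xs i w)) <= wint c (fun w => (3 * J0 w)%R))%E.
Proof.
apply: (@le_trans _ _ (wint c (fun w => V w (xs i w)) + wint c (tl i))%E).
  rewrite leeDl// integral_ge0// => w _; rewrite lee_fin.
  by apply: wint_ge0_cond => Gw; exact: tl_ge0.
apply: le_trans (gap_sum i) _.
have V00 w : Gd w -> 0 <= V w K0 by move=> Gw; exact: (@Vxs_ge0 0).
rewrite -wintD//; [|exact: mR (@mV 0)|exact: mR (@mtl 0)|by move=> w; exact: tl_ge0].
apply: wint_le.
- by apply: measurable_funD; [exact: mR (@mV 0)|exact: mR (@mtl 0)].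
- by apply: measurable_funM => //; exact: mR (@mJ0 0).
- by move=> w Gw; rewrite addr_ge0 ?V00 ?tl_ge0.
move=> w Gw; have := gap_K0 Gw; suff : tl 0 w <= 2 * J0 w by lra.
rewrite /tl add0r ler_pdivrMr; last by rewrite subr_gt0 (lt_le_trans _ (th_ge2 w)) ?ltr1n.
have J0w : 0 < J0 w by apply: Jtil_gt0 => //; exact: (proj1 (Gd_ok Gw)).
by have := th_ge2 w; rewrite /D; nra.
Qed.

End weights.

Let mlt i : measurable_fun setT (fun w : past 0 => (i < N w)%N).
Proof.
rewrite /N /iterations; under eq_fun do rewrite lt_nat_ceil.
apply: measurable_fun_ltr => //; apply: measurable_funM; last exact: mJ0.
by apply: measurable_funM => //; exact: mth.
Qed.

(** The rate stops improving with the recursion, at the random time [N w]. *)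
Let rt i w : R := D w / ((minn i (N w))%:R + th w).

Let mmin i : measurable_fun setT (fun w : past 0 => (minn i (N w))%:R : R).
Proof.
elim: i => [|i IH]; first by under eq_fun do rewrite min0n; exact: measurable_cst.
rewrite (_ : (fun _ => _) = fun w => (minn i (N w))%:R + (if (i < N w)%N then 1 else 0)).
  by apply: measurable_funD => //; exact: measurable_fun_ifT.
apply/funext => w; rewrite /minn; case: (ltnP i (N w)) => iN.
  case: ltnP => iN2; first by rewrite -natr1.
  by rewrite natr1; congr (_ %:R); apply/eqP; rewrite eqn_leq iN2.
by rewrite addr0 ltnNge (leqW iN).
Qed.

Let mrt i : measurable_fun setT (rt i : past 0 -> R).
Proof.
apply: measurable_funM; first exact: mD.
by apply: measurable_fun_invr; apply: measurable_funD; [exact: mmin|exact: mth].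
Qed.

Let mu_ i : measurable_fun setT (u i : past i -> R).
Proof.
apply: measurable_fun_ifT => //; by apply: measurable_fun_ler; [exact: mV|exact: mlam].
Qed.

Let u_ge0 i w : Gd w -> 0 <= u i w.
Proof. by move=> Gw; rewrite /u; case: ifP => // _; exact: Vxs_ge0. Qed.

(** The weight is quantified inside the induction: the factor [ph] of one step is random but known
    before the stage, and nonnegative because [theta >= 2], so [c * ph] is again an admissible
    weight for the induction hypothesis. *)
Lemma gap_rate i (c : T -> R) :
  measurable_fun setT (c : past 0 -> R) -> (forall w, 0 <= c w) ->
  (forall w, ~ Gd w -> c w = 0) -> (wint c (u i) <= wint c (rt i))%E.
Proof.
have tp j w : 0 < j%:R + th w by rewrite ltr_wpDl// (lt_le_trans _ (th_ge2 w)).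
have t2 j w : 2 <= j%:R + th w by rewrite ler_wpDl.
have rt0 j w : Gd w -> 0 <= rt j w by move=> Gw; rewrite divr_ge0 ?D_ge0// ltW.
elim: i c => [|i IH] c mc c0 cGd.
  apply: wint_le => //; [exact: mR (@mu_ 0)|exact: mR (@mrt 0)|exact: u_ge0|].
  move=> w Gw; rewrite /rt min0n add0r /D mulrC mulKf ?gt_eqF//; last first.
    by rewrite (lt_le_trans _ (th_ge2 w)).
  rewrite /u; case: ifP => _; first exact: gap_K0.
  by apply/ltW/Jtil_gt0 => //; exact: (proj1 (Gd_ok Gw)).
pose ph w : R := if (i < N w)%N then 1 - 2 / (i%:R + th w) else 1.
pose ps w : R := if (i < N w)%N then D w / (i%:R + th w) ^+ 2 else 0.
have mti : measurable_fun setT (fun w : past 0 => (i%:R + th w)^-1).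
  by apply: measurable_fun_invr; apply: measurable_funD => //; exact: mth.
have mph : measurable_fun setT (ph : past 0 -> R).
  by apply: measurable_fun_ifT => //; apply: measurable_funB => //; exact: measurable_funM.
have mps : measurable_fun setT (ps : past 0 -> R).
  apply: measurable_fun_ifT => //; apply: measurable_funM; first exact: mD.
  by under eq_fun do rewrite -exprVn; exact: measurable_funX.
have ph0 w : 0 <= ph w.
  by rewrite /ph; case: ifP => // _; rewrite subr_ge0 ler_pdivrMr// mul1r.
have ps0 w : Gd w -> 0 <= ps w.
  by move=> Gw; rewrite /ps; case: ifP => // _; rewrite divr_ge0 ?D_ge0// sqr_ge0.
have wmul f : wint c (fun w => ph w * f w) = wint (fun w => c w * ph w) f.
  by rewrite /wint; under eq_integral do rewrite mulrA.
apply: le_trans (expect_next_wint mc c0 cGd (i := i)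
  (g := fun w r => if r <= lam w then r else 0)
  (b := fun w => ph w * u i w + ps w) _ _ _ _ _) _.
- apply: measurable_funD; last exact: mR mps.
  by apply: measurable_funM; [exact: mR mph|exact: mR (@mu_ i)].
- apply: measurable_fun_ifT => //; apply: measurable_fun_ler => //.
  exact: (measurableT_comp (@mlam i) measurable_fst).
- by move=> w r _ r0; case: ifP.
- move=> w Gw; rewrite /ph /ps; case: (boolP (i < N w)%N) => iN; last first.
    rewrite /next /active (negbTE iN) /= integral_cst//= probability_setT mule1.
    by rewrite mul1r addr0.
  rewrite /next /active iN /=; case: (boolP (V w (xs i w) <= lam w)) => Vl; last first.
    rewrite (negbTE Vl) integral_cst//= probability_setT mule1 lee_fin.
    by rewrite /u (negbTE Vl) mulr0 add0r divr_ge0 ?D_ge0// sqr_ge0.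
  have act : active i w (xs i w) by rewrite /active iN.
  rewrite {1}/u Vl; apply: le_trans (step_bound Gw act).
  have mstep : measurable_fun setT (fun v =>
      V w (sgd_step pb (P w) (xs i w) (al i w) (Z h i v))).
    apply: measurable_gap; first exact: mxmeas_cst.
    by apply: mxmeas_sgd_step => //; exact: mxmeas_cst.
  have Vs v : 0 <= V w (sgd_step pb (P w) (xs i w) (al i w) (Z h i v)).
    by apply: gap_ge0 => //; exact: (proj1 (Gd_ok Gw)).
  apply: ge0_le_integral => //.
  + by move=> v _; rewrite lee_fin; case: ifP.
  + apply/measurable_EFinP; apply: measurable_fun_ifT => //.
    exact: measurable_fun_ler.
  + by apply/measurable_EFinP.
  + by move=> v _; rewrite lee_fin; case: ifP.
- by move=> w Gw; rewrite addr_ge0 ?ps0// mulr_ge0// u_ge0.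
have mphu : measurable_fun setT (fun w => ph w * u i w).
  by apply: measurable_funM; [exact: mR mph|exact: mR (@mu_ i)].
have mphr : measurable_fun setT (fun w => ph w * rt i w).
  by apply: measurable_funM; [exact: mR mph|exact: mR (@mrt i)].
rewrite (wintD mc c0 cGd mphu (mR mps)) => [|w Gw|//]; last by rewrite mulr_ge0// u_ge0.
apply: (@le_trans _ _ (wint c (fun w => (ph w * rt i w)%R) + wint c ps)%E).
  apply: leeD2r; rewrite !wmul; apply: IH => [|w|w nG]; first exact: measurable_funM.
    exact: mulr_ge0.
  by rewrite cGd// mul0r.
rewrite -(wintD mc c0 cGd mphr (mR mps)) => [|w Gw|//]; last by rewrite mulr_ge0// rt0.
apply: wint_le => //.
- by apply: measurable_funD; [exact: mphr|exact: mR mps].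
- exact: mR (@mrt i.+1).
- by move=> w Gw; rewrite addr_ge0 ?ps0// mulr_ge0// rt0.
move=> w Gw; rewrite /ph /ps /rt; case: ltnP => iN.
  rewrite (minn_idPl iN) -[i.+1%:R]natr1 addrAC.
  by apply: rate_step => //; exact: D_ge0.
by rewrite mul1r addr0 (minn_idPr (leqW iN)).
Qed.

Let xs_sgd i w : V w (xs i w) <= lam w ->
  xs i w = sgd pb zeta (P w) K0 (fun j => Z h j w) (minn i (N w)).
Proof.
elim: i => [|i IH]; first by rewrite min0n.
rewrite /= /next; case: (boolP (active i w (xs i w))) => act Vl.
  have /andP[iN Vi] := act.
  have -> : minn i.+1 (N w) = i.+1 by apply/minn_idPl.
  rewrite (IH Vi) (minn_idPl (ltnW iN)); reflexivity.
move: act; rewrite /active Vl andbT -leqNgt => Ni.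
by rewrite IH// (minn_idPr Ni) (minn_idPr (leqW Ni)).
Qed.

Let mGdT : measurable Gd.
Proof.
rewrite -[X in measurable X]setTI.
exact: (measurable_past_id (J := J 0) mX measurableT mGd).
Qed.

Let markov (A : set T) (f : T -> R) : measurable A -> measurable_fun setT f ->
  (forall w, 0 <= f w) -> (forall w, A w -> 1 <= f w) ->
  (Pr A <= \int[Pr]_w (f w)%:E)%E.
Proof.
move=> mA mf f0 Af; rewrite -[leLHS]mul1e -(integral_cst _ mA).
apply: (@le_trans _ _ (\int[Pr]_(w in A) (f w)%:E)%E).
  apply: ge0_le_integral => //.
  by apply/measurable_EFinP; exact: measurable_funTS.
by apply: ge0_subset_integral => //; [exact/measurable_EFinP|move=> w _; rewrite lee_fin].
Qed.

Let ccst_vs : 0 < ccst pb * vs ^+ 2.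
Proof. by rewrite mulr_gt0 ?exprn_gt0// ccst_gt0. Qed.

Let mGd1 : measurable_fun setT (\1_Gd : past 0 -> R).
Proof. exact: measurable_indic. Qed.

Let Gd1 w : Gd w -> \1_Gd w = 1 :> R.
Proof. by move=> Gw; rewrite indicE mem_set. Qed.

Let nGd1 w : ~ Gd w -> \1_Gd w = 0 :> R.
Proof. by move=> Gw; rewrite indicE memNset. Qed.

Let J0_gt0 w : Gd w -> 0 < J0 w.
Proof. by move=> Gw; apply: Jtil_gt0 => //; exact: (proj1 (Gd_ok Gw)). Qed.

Let lam_gt0 w : Gd w -> 0 < lam w.
Proof. by move=> Gw; rewrite mulr_gt0 ?J0_gt0// mulr_gt0// invr_gt0. Qed.

(** Markov with the random threshold [lam] moved into the weight: [3 J0 / lam = 3 zeta / 10]. *)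
Let escape : (Pr (Gd `&` [set w | (lam w < V w (xs Tm w))%R]) <= (3 / 10 * zeta)%:E)%E.
Proof.
pose c w : R := \1_Gd w * (lam w)^-1.
have mc : measurable_fun setT (c : past 0 -> R).
  by apply: measurable_funM => //; apply: measurable_fun_invr; exact: mlam.
have c0 w : 0 <= c w.
  have [Gw|nG] := pselect (Gd w); last by rewrite /c nGd1// mul0r.
  by rewrite /c Gd1// mul1r invr_ge0 ltW// lam_gt0.
have cGd w : ~ Gd w -> c w = 0 by move=> nG; rewrite /c nGd1// mul0r.
apply: (@le_trans _ _ (wint c (fun w => V w (xs Tm w)))).
  apply: markov.
  - apply: measurableI => //; rewrite -[X in measurable X]setTI.
    exact: (measurable_fun_ltr (mR (@mlam Tm)) (mR (@mV Tm)) measurableT (Y := [set true])).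
  - by apply: measurable_funM; [exact: mR mc|exact: mR (@mV Tm)].
  - move=> w; apply: (wint_ge0_cond c0 cGd (f := fun w => V w (xs Tm w))) => Gw.
    exact: Vxs_ge0.
  - move=> w [Gw /ltW]; rewrite /c Gd1// mul1r mulrC.
    by rewrite ler_pdivlMr ?lam_gt0// mul1r.
apply: le_trans (gap_growth mc c0 cGd Tm) _.
apply: (@le_trans _ _ (\int[Pr]_w (3 / 10 * zeta)%:E)%E); last first.
  by rewrite integral_cst//= probability_setT mule1.
apply: ge0_le_integral => //.
- move=> w _; rewrite lee_fin; apply: (wint_ge0_cond c0 cGd (f := fun w => 3 * J0 w)) => Gw.
  by rewrite mulr_ge0// ltW// J0_gt0.
- apply/measurable_EFinP; apply: measurable_funM; first exact: mR mc.
  by apply: measurable_funM => //; exact: mR (@mJ0 0).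
- move=> w _; rewrite lee_fin; have [Gw|nG] := pselect (Gd w); last first.
    by rewrite cGd// mul0r mulr_ge0 ?divr_ge0// ltW.
  have Jp := J0_gt0 Gw.
  rewrite /c Gd1// mul1r /lam le_eqVlt; apply/orP; left; apply/eqP; field.
  by rewrite !gt_eqF.
Qed.

(** At time [Tm >= N] the rate is [theta J0 / (N + theta)]. Since
    [N >= 40 theta J0 / (7 mu vs^2 zeta)] and [mu = 4 ccst], it is at most
    [(7/10) zeta ccst vs^2]. *)
Let inaccurate : (Pr (Gd `&` [set w | (ccst pb * vs ^+ 2 < u Tm w)%R]) <= (7 / 10 * zeta)%:E)%E.
Proof.
pose c w : R := \1_Gd w * (ccst pb * vs ^+ 2)^-1.
have mc : measurable_fun setT (c : past 0 -> R) by exact: measurable_funM.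
have c0 w : 0 <= c w by rewrite /c mulr_ge0 ?invr_ge0 ?(ltW ccst_vs)// indicE.
have cGd w : ~ Gd w -> c w = 0 by move=> nG; rewrite /c nGd1// mul0r.
apply: (@le_trans _ _ (wint c (u Tm))).
  apply: markov.
  - apply: measurableI => //; rewrite -[X in measurable X]setTI.
    exact: (measurable_fun_ltr (measurable_cst _) (mR (@mu_ Tm)) measurableT (Y := [set true])).
  - by apply: measurable_funM; [exact: mR mc|exact: mR (@mu_ Tm)].
  - by move=> w; apply: (wint_ge0_cond c0 cGd) => Gw; exact: u_ge0.
  - move=> w [Gw] /= /ltW ul; rewrite /c Gd1// mul1r [_^-1 * _]mulrC.
    by rewrite ler_pdivlMr// mul1r.
apply: le_trans (gap_rate Tm mc c0 cGd) _.
apply: (@le_trans _ _ (\int[Pr]_w (7 / 10 * zeta)%:E)%E); last first.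
  by rewrite integral_cst//= probability_setT mule1.
have tp w : 0 < th w by rewrite (lt_le_trans _ (th_ge2 w)).
have rt0 w : Gd w -> 0 <= rt Tm w.
  by move=> Gw; rewrite divr_ge0 ?D_ge0// addr_ge0// ltW.
apply: ge0_le_integral => //.
- by move=> w _; rewrite lee_fin; apply: (wint_ge0_cond c0 cGd); exact: rt0.
- apply/measurable_EFinP; apply: measurable_funM; first exact: mR mc.
  exact: mR (@mrt Tm).
- move=> w _; rewrite lee_fin; have [Gw|nG] := pselect (Gd w); last first.
    by rewrite cGd// mul0r mulr_ge0 ?divr_ge0// ltW.
  rewrite /c Gd1// mul1r mulrC ler_pdivrMr// /rt (minn_idPr (Gd_N Gw)).
  have c1 := ccst_gt0 n_gt0 m_gt0 Hpb; have Jp := J0_gt0 Gw.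
  have z0 : 0 <= 7 / 10 * zeta * (ccst pb * vs ^+ 2).
    by rewrite mulr_ge0 ?(ltW ccst_vs)// mulr_ge0 ?(ltW zeta_gt0)// divr_ge0.
  rewrite ler_pdivrMr ?ltr_wpDl//.
  have NT : 40 / (7 * mu pb * vs ^+ 2 * zeta) * th w * J0 w <= (N w)%:R.
    by rewrite leNgt -lt_nat_ceil ltnn.
  apply: (@le_trans _ _ (7 / 10 * zeta * (ccst pb * vs ^+ 2) * (N w)%:R)); last first.
    apply: ler_wpM2l; last by rewrite lerDl ltW.
    exact: z0.
  apply: le_trans (ler_wpM2l _ NT).
    rewrite /D muE// le_eqVlt; apply/orP; left; apply/eqP; field.
    by rewrite !gt_eqF.
  exact: z0.
Qed.

Lemma stage_bad : (Pr (Gd `&` [set w | (vs ^+ 2 <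
    fdot (sgd pb zeta (P w) K0 (fun j => Z h j w) (N w) - gain pb (P w))
         (sgd pb zeta (P w) K0 (fun j => Z h j w) (N w) - gain pb (P w)))%R])
  <= zeta%:E)%E.
Proof.
set A := Gd `&` [set w | (lam w < V w (xs Tm w))%R].
set B := Gd `&` [set w | (ccst pb * vs ^+ 2 < u Tm w)%R].
have mA : measurable A.
  apply: measurableI => //; rewrite -[X in measurable X]setTI.
  exact: (measurable_fun_ltr (mR (@mlam Tm)) (mR (@mV Tm)) measurableT (Y := [set true])).
have mB : measurable B.
  apply: measurableI => //; rewrite -[X in measurable X]setTI.
  exact: (measurable_fun_ltr (measurable_cst _) (mR (@mu_ Tm)) measurableT (Y := [set true])).
apply: (@le_trans _ _ (Pr (A `|` B))).
  have mPT : mxmeas P by move=> i j; exact: (mR (@mPi 0 i j)).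
  have mS := mxmeas_sgd_iterations Hpb zeta vs K0 (FZ := Z h) mPT (fun j => mX (h, j)).
  have mE := mxmeasB mS (mxmeas_gain pb mPT).
  apply: le_measure; rewrite ?inE.
  - apply: measurableI => //; rewrite -[X in measurable X]setTI.
    exact: (measurable_fun_ltr (measurable_cst _) (measurable_fdot mE mE)
      measurableT (Y := [set true])).
  - exact: measurableU.
  move=> w [Gw /= bad]; case: (ltP (lam w) (V w (xs Tm w))) => Vl; [by left|right].
  split => //=; rewrite /u Vl.
  apply: lt_le_trans (gap_ge n_gt0 m_gt0 Hpb _ (proj1 (Gd_ok Gw))).
  rewrite ltr_pM2l ?(ccst_gt0 n_gt0 m_gt0 Hpb)//.
  by rewrite xs_sgd// (minn_idPr (Gd_N Gw)).
apply: le_trans (measureU2 _ mA mB) _.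
apply: le_trans (leeD escape inaccurate) _.
by rewrite -EFinD lee_fin; lra.
Qed.

End stage.

(** * The Riccati recursion *)

Section riccati.
Context {R : realType} {n m : nat} (pb : lqr R n m).
Hypotheses (n_gt0 : (0 < n)%N) (m_gt0 : (0 < m)%N) (Hpb : lqr_setting pb).
Hypothesis HQN : possemidef (termQ pb - Pstar pb).

Local Notation A := (sysA pb).
Local Notation B := (sysB pb).
Local Notation Q := (costQ pb).
Local Notation Rc := (costR pb).
Local Notation Ps := (Pstar pb).
Local Notation QN := (termQ pb).
Local Notation a := (acst pb).

Let pR := setting_posR Hpb.
Let pQ := setting_posQ Hpb.
Let pPs := setting_posP Hpb.
Let psPs := posdef_psd pPs.

(** The shift [X + c I] lies between 0 and [2 c I]; [psd_le_sqr] applied to it simplifies to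
    [|X z|^2 <= c^2 |z|^2]. *)
Lemma sym_specnorm_le k (X : 'M[R]_k) c : 0 <= c -> X^T = X ->
  (forall z, `|quadform X z| <= c * fdot z z) -> specnorm X <= c.
Proof.
move=> c0 sX H; apply: specnorm_le2 => // z.
have Hz y : - (c * fdot y y) <= quadform X y <= c * fdot y y by rewrite -ler_norml.
have pY : possemidef (X + c%:M).
  split; first by rewrite linearD /= sX tr_scalar_mx.
  move=> y; rewrite quadformD quadform_scal.
  by have /andP[h _] := Hz y; rewrite -subr_ge0 in h; lra.
have uY y : quadform (X + c%:M) y <= (2 * c) * fdot y y.
  rewrite quadformD quadform_scal; have /andP[_ h] := Hz y; lra.
have := psd_le_sqr z pY uY.
rewrite quadformD quadform_scal mulmxDl mul_scalar_mx !(fdotDl, fdotDr, fdotZl, fdotZr).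
rewrite (fdotC (X *m z)) -quadformE; lra.
Qed.

Lemma costQ_ge z : 2 * a * fdot z z <= quadform Q z.
Proof.
rewrite /acst mulrC (mulrC 2) divfK ?pnatr_eq0// mulrC sigma_min_posdef//.
exact: lambda_min_le (proj1 pQ).
Qed.

Lemma policy_cost_geQ P K z : possemidef P -> quadform Q z <= quadform (policy_cost pb P K) z.
Proof.
move=> pP; rewrite quadform_policy_cost lerDr addr_ge0 ?(proj2 pP)//.
exact: (proj2 (posdef_psd pR)).
Qed.

Lemma policy_cost_mono P P' K z : (forall y, quadform P y <= quadform P' y) ->
  quadform (policy_cost pb P K) z <= quadform (policy_cost pb P' K) z.
Proof. by move=> PP; rewrite !quadform_policy_cost !lerD2r. Qed.

Let F P := policy_cost pb P (gain pb P).

(** The gain optimal for [P'] is a competitor for [P]. *)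
Lemma riccati_mono P P' z : possemidef P -> (forall y, quadform P y <= quadform P' y) ->
  quadform (F P) z <= quadform (F P') z.
Proof.
move=> pP PP; apply: le_trans (policy_cost_min m_gt0 pR (gain pb P') z pP) _.
exact: policy_cost_mono.
Qed.

Lemma riccati_Pstar : F Ps = Ps.
Proof.
by have [_ _ _ [_ dPs] _] := Hpb; exact/esym/(dareE m_gt0 pR psPs dPs).
Qed.

Lemma Pstar_ge z : 2 * a * fdot z z <= quadform Ps z.
Proof.
rewrite -riccati_Pstar; apply: le_trans (costQ_ge z) _; exact: policy_cost_geQ.
Qed.

Let Pk k := iter k F QN.

Lemma iter_ric_psd k : possemidef (Pk k).
Proof.
elim: k => [|k IH]; last exact: (policy_cost_psd pQ pR).
split => [|x] /=; first by case: Hpb => _ _ _ _ [].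
by rewrite -[QN](subrK Ps) quadformD addr_ge0 ?(proj2 psPs) ?(proj2 HQN).
Qed.

(** The order [Q_N >= Pstar] is propagated by monotonicity; with [Pstar_ge] it bounds all iterates
    below by [2 a]. *)
Lemma Pstar_le_ric k z : quadform Ps z <= quadform (Pk k) z.
Proof.
elim: k z => [|k IH] z; first by rewrite -subr_ge0 -quadformB; exact: (proj2 HQN).
by rewrite -{1}riccati_Pstar; exact: riccati_mono.
Qed.

Lemma ric_ge k z : 2 * a * fdot z z <= quadform (Pk k) z.
Proof. exact: le_trans (Pstar_ge z) (Pstar_le_ric k z). Qed.

Let s := starnorm Ps (AKstar pb).
Let ds := starnorm Ps (QN - Ps).

Lemma specnorm_Pstar_gt0 : 0 < specnorm Ps.
Proof.
have [z z0] := cV_neq0 (R := R) n_gt0; have zp : 0 < fdot z z by rewrite fdot_gt0.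
rewrite -(pmulr_lgt0 _ zp); apply: lt_le_trans (quadform_le_specnorm _ _).
exact: (proj2 pPs).
Qed.

Lemma Pmax_gt0 : 0 < Pmax pb.
Proof.
apply: ltr_pwDl; first exact: specnorm_Pstar_gt0.
by rewrite mulr_ge0 ?starnorm_ge0// mulr_ge0 ?specnorm_ge0.
Qed.

(** Lyapunov argument: [AKstar^T Pstar AKstar = Pstar - Kstar^T R Kstar - Q <= (1 - 2 a / |Pstar|)
    Pstar], using [Q >= 2 a I]. *)
Lemma AKstar_contract : s < 1.
Proof.
have a0 := acst_gt0 n_gt0 Hpb; have P0 := specnorm_Pstar_gt0.
have Ez z : quadform Ps (AKstar pb *m z) <= quadform Ps z - 2 * a * fdot z z.
  rewrite -[X in _ <= quadform X z - _]riccati_Pstar quadform_policy_cost -addrA -addrA.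
  rewrite lerDl addrA subr_ge0; apply: le_trans (costQ_ge z) _.
  by rewrite lerDr; exact: (proj2 (posdef_psd pR)).
have P2 : 2 * a <= specnorm Ps.
  have [z z0] := cV_neq0 (R := R) n_gt0; have zp : 0 < fdot z z by rewrite fdot_gt0.
  rewrite -(ler_pM2r zp); apply: le_trans (Pstar_ge z) _.
  exact: quadform_le_specnorm.
have r0 : 0 <= 1 - 2 * a / specnorm Ps by rewrite subr_ge0 ler_pdivrMr// mul1r.
apply: (@le_lt_trans _ _ (Num.sqrt (1 - 2 * a / specnorm Ps))); last first.
  rewrite -[ltRHS]sqrtr1 ltr_sqrt// gtrBl divr_gt0// mulr_gt0//.
apply: starnorm_le => // z.
rewrite sqr_sqrtr// mulrBl mul1r; apply: le_trans (Ez z) _.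
have a2 : 0 <= 2 * a by rewrite mulr_ge0// ltW.
rewrite lerD2l lerN2 -(mulrA (2 * a)) ler_wpM2l//.
by rewrite mulrC ler_pdivrMr// mulrC quadform_le_specnorm.
Qed.

(** Using the suboptimal gain [Kstar] in each backward step, the difference with the fixed point is
    at most its conjugate by [AKstar], which costs a factor [s^2]. *)
Lemma ric_sub_Pstar_le k z : quadform (Pk k - Ps) z <=
  ds * specnorm (invmx Ps) * s ^+ (2 * k) * quadform Ps z.
Proof.
elim: k z => [|k IH] z.
  rewrite muln0 expr0 mulr1; apply: le_trans (psd_le_starnorm z n_gt0 pPs HQN) _.
  by rewrite -mulrA ler_wpM2l ?starnorm_ge0//; exact: posdef_inv_lb.
have -> : (2 * k.+1 = 2 * k + 2)%N by rewrite mulnS addnC.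
rewrite exprD mulrA -mulrA.
apply: le_trans (_ : quadform (Pk k - Ps) (AKstar pb *m z) <= _); last first.
  apply: le_trans (IH _) _; rewrite ler_wpM2l//; last exact: starnorm_ub.
  by rewrite !mulr_ge0 ?starnorm_ge0 ?specnorm_ge0// exprn_ge0// starnorm_ge0.
rewrite quadformB -{1}riccati_Pstar.
have := policy_cost_min m_gt0 pR (Kstar pb) z (iter_ric_psd k).
rewrite /F !quadform_policy_cost /Pk /= -/(Pk k) quadformB -/(AKstar pb) -/(Kstar pb).
lra.
Qed.

Lemma ric_sub_Pstar k z : quadform (Pk k - Ps) z <=
  cond Ps * ds * s ^+ (2 * k) * fdot z z.
Proof.
apply: le_trans (ric_sub_Pstar_le k z) _.
have -> : cond Ps * ds * s ^+ (2 * k) * fdot z z =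
  ds * specnorm (invmx Ps) * s ^+ (2 * k) * (specnorm Ps * fdot z z).
  by rewrite /cond; ring.
rewrite ler_wpM2l ?quadform_le_specnorm//.
by rewrite !mulr_ge0 ?starnorm_ge0 ?specnorm_ge0// exprn_ge0// starnorm_ge0.
Qed.

Lemma ric_le_Pmax k z : quadform (Pk k) z <= Pmax pb * fdot z z.
Proof.
rewrite -[Pk k](subrK Ps) quadformD addrC /Pmax mulrDl.
apply: lerD; first exact: quadform_le_specnorm.
apply: le_trans (ric_sub_Pstar k z) _; rewrite ler_wpM2r ?fdot_ge0//.
rewrite ler_piMr//; first by rewrite !mulr_ge0 ?starnorm_ge0 ?specnorm_ge0.
by rewrite exprn_ile1 ?starnorm_ge0// ltW// AKstar_contract.
Qed.

(** Subtract the normal equations of the two gains, that of [P'] in the form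
    [R G = B^T P' (A - B G)]. The difference of the gains is thus linear in [P - P'], with the
    closed loop of [P'] only. *)
Lemma gain_sub P P' : possemidef P -> possemidef P' ->
  hess pb P *m (gain pb P - gain pb P') = B^T *m (P - P') *m (A - B *m gain pb P').
Proof.
move=> pP pP'; rewrite mulmxBr hess_gain//.
have e : Rc *m gain pb P' = B^T *m P' *m (A - B *m gain pb P').
  rewrite mulmxBr -hess_gain// /hess mulmxDl; rewrite !mulmxA; exact/esym/addrK.
have -> : hess pb P *m gain pb P' =
    B^T *m P' *m (A - B *m gain pb P') + B^T *m P *m B *m gain pb P'.
  by rewrite {1}/hess mulmxDl e.
have alg (x y z w : 'M[R]_(m, n)) : x - (y - z + w) = x - w - (y - z).
  by apply/matrixP => i j; rewrite !mxE; ring.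
move: (gain pb P') => G; rewrite mulmxBr alg.
by rewrite (mulmxBr _ P P') mulmxBl !mulmxBr !mulmxA.
Qed.

Lemma gain_sub_le P P' : possemidef P -> possemidef P' ->
  specnorm (gain pb P - gain pb P') <=
  specnorm (A - B *m gain pb P') * specnorm B / lambda_min Rc * specnorm (P - P').
Proof.
move=> pP pP'; have uH := posdef_unit (hess_posdef m_gt0 pR pP).
rewrite -[X in specnorm X <= _](mulKmx uH) gain_sub//.
have lR := lambda_min_gt0 m_gt0 pR.
have iH : specnorm (invmx (hess pb P)) <= (lambda_min Rc)^-1.
  apply: specnorm_inv_le => // [|z]; first by apply: hess_sym => //; exact: (proj1 pP).
  exact: hess_ge.
apply: le_trans (specnormM _ _) _.
have -> : specnorm (A - B *m gain pb P') * specnorm B / lambda_min Rc * specnorm (P - P')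
  = (lambda_min Rc)^-1 * (specnorm B * specnorm (P - P') * specnorm (A - B *m gain pb P')).
  by ring.
apply: ler_pM; rewrite ?specnorm_ge0//.
apply: le_trans (specnormM _ _) _; rewrite ler_wpM2r ?specnorm_ge0//.
apply: le_trans (specnormM _ _) _; rewrite ler_wpM2r ?specnorm_ge0//.
exact: specnorm_tr.
Qed.

(** [2 a |y|^2 <= P_k(y) <= P_{k+1}(z) <= Pmax |z|^2] for [y] the closed-loop successor of [z]. The
    bound does not depend on [k], so [phi] is bounded uniformly in the horizon. *)
Lemma ric_closed_loop_le k :
  specnorm (A - B *m gain pb (Pk k)) <= Num.sqrt (Pmax pb / (2 * a)).
Proof.
have a0 := acst_gt0 n_gt0 Hpb.
have a2 : 0 < 2 * a by rewrite mulr_gt0.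
apply: specnorm_le2 => [|z]; first exact: sqrtr_ge0.
rewrite sqr_sqrtr ?divr_ge0 ?(ltW a2) ?(ltW Pmax_gt0)//.
rewrite mulrAC ler_pdivlMr// mulrC.
apply: le_trans (ric_ge k _) _; apply: le_trans (ric_le_Pmax k.+1 z).
rewrite [Pk k.+1]/(F (Pk k)) /F quadform_policy_cost -addrA lerDl addr_ge0//.
  exact: (proj2 (posdef_psd pR)).
exact: (proj2 (posdef_psd pQ)).
Qed.

(* If some closed loop vanishes, [A = B K] forces [R K = 0], hence [A = 0]. *)
Lemma closed_loop0 P : possemidef P -> A - B *m gain pb P = 0 -> A = 0.
Proof.
move=> pP AB; have AE : A = B *m gain pb P by apply/eqP; rewrite -subr_eq0 AB.
suff K0 : gain pb P = 0 by rewrite AE K0 mulmx0.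
have RK : Rc *m gain pb P = 0.
  have := hess_gain m_gt0 pR pP; rewrite [X in _ = _ *m X]AE.
  move: (gain pb P) => G; rewrite /hess mulmxDl mulmxA => /(canRL (addrK _)).
  by rewrite subrr.
by rewrite -[LHS](mulKmx (posdef_unit pR)) RK mulmx0.
Qed.

Definition rel_close (de : R) (X P : 'M[R]_n) :=
  forall z, (1 - de) * quadform P z <= quadform X z <= (1 + de) * quadform P z.

Lemma rel_close_okP de X k : possemidef X -> rel_close de X (Pk k) ->
  0 <= de -> de * Pmax pb <= a -> okP pb X.
Proof.
move=> pX XP de0 deP; split => // z; have /andP[_ h] := XP z.
apply: le_trans h _; rewrite (mulrDl (Pmax pb)) mulrDl mul1r.
apply: lerD; first exact: ric_le_Pmax.
apply: le_trans (ler_wpM2l de0 (ric_le_Pmax k z)) _.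
by rewrite mulrA ler_wpM2r ?fdot_ge0.
Qed.

(* The value error is measured relatively to the Riccati iterates: one exact
   backward step does not increase a relative error. *)
Lemma rel_close_step de X k K v : okP pb X -> 0 <= de <= 1 -> rel_close de X (Pk k) ->
  fdot (K - gain pb X) (K - gain pb X) <= v ->
  rel_close (de + C3 pb * v / (4 * a)) (policy_cost pb X K) (Pk k.+1).
Proof.
move=> okX /andP[de0 de1] XP Kv z; have [pX uX] := okX.
have a0 := acst_gt0 n_gt0 Hpb; have c30 := C3_gt0 n_gt0 m_gt0 Hpb.
have v0 : 0 <= v := le_trans (fdot_ge0 _) Kv.
have pk := iter_ric_psd k; have pk1 := iter_ric_psd k.+1.
have R0 K' := proj2 (posdef_psd pR) (K' *m z).
have Q0 := proj2 (posdef_psd pQ) z.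
set d1 := C3 pb * v / (4 * a).
have d10 : 0 <= d1 by apply: divr_ge0; apply: mulr_ge0 => //; exact: ltW.
have ext : C3 pb / 2 * (v * fdot z z) <= d1 * quadform (Pk k.+1) z.
  have -> : C3 pb / 2 * (v * fdot z z) = d1 * (2 * a * fdot z z).
    by rewrite /d1; field; rewrite gt_eqF.
  by rewrite ler_wpM2l// ric_ge.
have Pk1E K' : quadform (Pk k.+1) z <=
    quadform (Pk k) ((A - B *m K') *m z) + quadform Rc (K' *m z) + quadform Q z.
  by rewrite -quadform_policy_cost [Pk k.+1]/(F (Pk k)); exact: policy_cost_min.
apply/andP; split.
  (* Lower side: [Pk k.+1] is below the cost of every gain under [Pk k], so an inaccurate [K] can
     only help. *)
  have /andP[h _] := XP ((A - B *m K) *m z).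
  have dP : 0 <= d1 * quadform (Pk k.+1) z by rewrite mulr_ge0// (proj2 pk1).
  have := Pk1E K; rewrite quadform_policy_cost.
  have := R0 K; move: h dP Q0.
  set x := quadform _ _; set y := quadform _ _; set w := quadform _ _.
  set q := quadform _ _; set r := quadform _ _; move=> h dP Q0 r0 Pk1.
  have d1' : 0 <= 1 - de by rewrite subr_ge0.
  have := ler_wpM2l d1' Pk1; have := mulr_ge0 de0 r0; have := mulr_ge0 de0 Q0; lra.
(* Upper side: compare the exact gain of [X] with that of [Pk k], then add the square of
   [K - gain X], absorbed through [Pk k.+1 >= 2 a]. *)
rewrite (policy_cost_square m_gt0 pR K pX) quadformD quadform_conj.
rewrite [X in _ <= X](_ : _ = (1 + de) * quadform (Pk k.+1) z + d1 * quadform (Pk k.+1) z);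
  last by ring.
apply: lerD.
  apply: le_trans (policy_cost_min m_gt0 pR (gain pb (Pk k)) z pX) _.
  rewrite [Pk k.+1]/(F (Pk k)) /F !quadform_policy_cost.
  have /andP[_ h] := XP ((A - B *m gain pb (Pk k)) *m z).
  have := mulr_ge0 de0 (R0 (gain pb (Pk k))); have := mulr_ge0 de0 Q0; lra.
apply: le_trans ext; apply: le_trans (hess_LE n_gt0 Hpb okX _) _.
rewrite ler_wpM2l ?divr_ge0 ?(ltW c30)//.
by apply: le_trans (fdot_mul _ _) _; rewrite ler_wpM2r ?fdot_ge0.
Qed.

End riccati.

(** * The horizon *)

Section horizon_choice.
Context {R : realType} {n m : nat} (pb : lqr R n m).
Hypotheses (n_gt0 : (0 < n)%N) (m_gt0 : (0 < m)%N) (Hpb : lqr_setting pb).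
Hypothesis HQN : possemidef (termQ pb - Pstar pb).

Let s := starnorm (Pstar pb) (AKstar pb).

Definition gain_defect : R := 2 * starnorm (Pstar pb) (termQ pb - Pstar pb) *
  cond (Pstar pb) * specnorm (AKstar pb) * specnorm (sysB pb) / lambda_min (costR pb).
Local Notation g0 := gain_defect.

Lemma gain_defect_ge0 : 0 <= g0.
Proof.
have lR := lambda_min_gt0 m_gt0 (setting_posR Hpb).
by rewrite divr_ge0 ?(ltW lR)// !mulr_ge0 ?starnorm_ge0 ?specnorm_ge0.
Qed.

(** Below [1/e], [ln (1 / eps) >= 1] absorbs additive constants; below a nonzero [g0] the logarithm
    in the horizon is nonnegative. If [g0 = 0], that logarithm is 0 by convention. *)
Definition eps_bound : R := Num.min (expR (-1)) (if g0 == 0 then 1 else g0).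

Lemma eps_bound_gt0 : 0 < eps_bound.
Proof.
rewrite lt_min expR_gt0 /=; case: eqVneq => // g1.
by rewrite lt_neqAle eq_sym g1 gain_defect_ge0.
Qed.

Variable eps : R.
Hypothesis Heps : 0 < eps < eps_bound.
Local Notation N := (horizon pb eps).

Lemma eps_gt0 : 0 < eps. Proof. by case/andP: Heps. Qed.

Lemma log_eps_ge1 : 1 <= ln (1 / eps).
Proof.
have e0 := eps_gt0; rewrite div1r lnV ?posrE// -[1]opprK lerN2.
rewrite -[leRHS]expRK; apply/ltW; rewrite ltr_ln ?posrE ?expR_gt0//.
by case/andP: Heps => _; rewrite lt_min => /andP[].
Qed.

Lemma eps_lt1 : eps < 1.
Proof.
case/andP: Heps => _; rewrite lt_min => /andP[h _]; apply: lt_trans h _.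
by rewrite expR_lt1 ltrN10.
Qed.

Lemma defect_eps : g0 != 0 -> 1 <= g0 / eps.
Proof.
move=> g1; rewrite ler_pdivlMr ?eps_gt0// mul1r ltW//.
by case/andP: Heps => _; rewrite lt_min (negbTE g1) => /andP[].
Qed.

Let lns_ge0 : 0 <= ln (1 / s).
Proof.
have [->|s0] := eqVneq s 0; first by rewrite invr0 mulr0 ln0.
have sp : 0 < s by rewrite lt_neqAle eq_sym s0 starnorm_ge0.
by rewrite ln_ge0// ler_pdivlMr// mul1r ltW// AKstar_contract.
Qed.

Let lng_ge0 : 0 <= ln (g0 / eps).
Proof.
have [->|g1] := eqVneq g0 0; first by rewrite mul0r ln0.
by rewrite ln_ge0// defect_eps.
Qed.

Let horizonE : N = nat_ceil (2^-1 * (ln (g0 / eps) / ln (1 / s)) + 1).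
Proof.
rewrite /horizon /g0; congr (nat_ceil (_ * (ln _ / _) + _)).
by rewrite invfM (mulrC eps^-1) mulrA.
Qed.

Lemma horizon_gt0 : (0 < N)%N.
Proof. by rewrite horizonE lt_nat_ceil ltr_wpDl// mulr_ge0 ?divr_ge0. Qed.

Lemma horizon_gt1 : (1 < N)%N -> 0 < g0.
Proof.
rewrite horizonE lt_nat_ceil => h; rewrite lt_neqAle gain_defect_ge0 andbT eq_sym.
by apply: contraTneq h => ->; rewrite mul0r ln0// mul0r mulr0 add0r ltxx.
Qed.

Lemma horizon_decay : g0 * s ^+ (2 * N.-1) <= eps.
Proof.
have e0 := eps_gt0; have [->|g1] := eqVneq g0 0; first by rewrite mul0r ltW.
have gp : 0 < g0 by rewrite lt_neqAle eq_sym g1 gain_defect_ge0.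
(* [s = 0] would force [AKstar = 0], as [Pstar] is coercive, and then [g0 = 0]. Hence [ln (1 / s)]
   is positive below. *)
have [s0|s0] := eqVneq s 0.
  exfalso; move/eqP: g1; apply; suff AK0 : AKstar pb = 0.
    rewrite /g0 (_ : specnorm _ = 0) ?mulr0 ?mul0r//; apply/eqP.
    rewrite eq_le specnorm_ge0 andbT AK0; apply: specnorm_le => // z.
    by rewrite mul0mx vnorm0 mul0r.
  apply: specnorm_eq0; apply/eqP; rewrite eq_le specnorm_ge0 andbT.
  apply: specnorm_le2 => // z; rewrite expr0n mul0r.
  have := starnorm_ub (AKstar pb) z (setting_posP Hpb); rewrite -/s s0 expr0n mul0r => h.
  have := Pstar_ge n_gt0 m_gt0 Hpb (AKstar pb *m z); have := acst_gt0 n_gt0 Hpb.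
  by move=> a0 h2; have := le_trans h2 h; rewrite pmulr_rle0// mulr_gt0.
have sp : 0 < s by rewrite lt_neqAle eq_sym s0 starnorm_ge0.
have ls : 0 < ln (1 / s).
  by rewrite ln_gt0// ltr_pdivlMr// mul1r AKstar_contract.
suff h : g0 / eps <= s^-1 ^+ (2 * N.-1).
  by move: h; rewrite exprVn ler_pdivrMr// mulrC ler_pdivlMr ?exprn_gt0.
have si : 0 < 1 / s by rewrite divr_gt0.
have lnX : ln ((1 / s) ^+ (2 * N.-1)) = (2 * N.-1)%:R * ln (1 / s).
  by rewrite lnXn// mulr_natl.
have -> : s^-1 = 1 / s by rewrite div1r.
suff : ln (g0 / eps) <= ln ((1 / s) ^+ (2 * N.-1)).
  have p1 : g0 / eps \is Num.pos by rewrite posrE divr_gt0.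
  have p2 : (1 / s) ^+ (2 * N.-1) \is Num.pos by rewrite posrE exprn_gt0.
  by rewrite (ler_ln p1 p2).
rewrite lnX natrM -ler_pdivrMr//.
have : 2^-1 * (ln (g0 / eps) / ln (1 / s)) + 1 <= N%:R.
  by rewrite leNgt -lt_nat_ceil -horizonE ltnn.
have -> : N%:R = N.-1%:R + 1 :> R by rewrite natr1 prednK// horizon_gt0.
lra.
Qed.

(** [|ln g0| + 1] accounts for [ln g0 + ln (1 / eps)]; the 2 is the added 1 of the horizon plus the
    rounding. *)
Definition horizon_const : R := 2^-1 * ((`|ln g0| + 1) / ln (1 / s)) + 2.

Lemma horizon_le : N%:R <= horizon_const * ln (1 / eps).
Proof.
have l1 := log_eps_ge1; have e0 := eps_gt0.
have : (N.-1 < N)%N by rewrite prednK// horizon_gt0.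
rewrite {2}horizonE lt_nat_ceil => h.
rewrite -(prednK horizon_gt0) -natr1 /horizon_const mulrDl.
have : ln (g0 / eps) / ln (1 / s) <= (`|ln g0| + 1) / ln (1 / s) * ln (1 / eps).
  rewrite [leRHS]mulrAC ler_wpM2r ?invr_ge0//.
  have [->|g1] := eqVneq g0 0.
    by rewrite mul0r (ln0 (lexx 0)) normr0 add0r mulr_ge0// (le_trans _ l1).
  have gp : 0 < g0 by rewrite lt_neqAle eq_sym g1 gain_defect_ge0.
  have -> : ln (g0 / eps) = ln g0 + ln (1 / eps).
    by rewrite (lnM (x := g0) (y := eps^-1)) ?posrE ?invr_gt0// div1r.
  have := ler_peMr (normr_ge0 (ln g0)) l1; have := ler_norm (ln g0); lra.
move: h; set x := _ / _; set y := _ / _; set l := ln (1 / eps) in l1 *; lra.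
Qed.

End horizon_choice.

(** * Deterministic bounds on a run *)

Section iteration_bound.
Context {R : realType} {n m : nat} (pb : lqr R n m).
Hypotheses (n_gt0 : (0 < n)%N) (m_gt0 : (0 < m)%N) (Hpb : lqr_setting pb).
Variable M : R.

Local Notation A := (sysA pb).
Local Notation B := (sysB pb).
Local Notation Q := (costQ pb).
Local Notation Rc := (costR pb).
Local Notation S0 := (Sigma0 pb).

(** Majorants free of the random value matrix and of the initial gain, valid under [okP] and
    [specnorm K0 <= M], with the powers of zeta factored out. *)
Definition Jmax : R := (pbnd pb * (2 * specnorm A ^+ 2 + 2 * (specnorm B ^+ 2 * M ^+ 2))
  + specnorm Rc * M ^+ 2 + specnorm Q) * \tr S0.
Definition Cmax : R := 11 * Jmax / ccst pb.
Definition xi1max : R :=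
  (specnorm Q + 2 * specnorm Rc * Cmax
   + 2 * pbnd pb * (specnorm A ^+ 2 + 2 * specnorm B ^+ 2 * Cmax))
  * (Cm pb `^ (3 / 2)).
Definition xi3max : R :=
  1 / explore pb ^+ 2 * xi1max ^+ 2 * m%:R
  + 2 * xi1max * xi2 pb * m%:R * (m%:R + 2)
  + explore pb ^+ 2 * xi2 pb ^+ 2 * m%:R * (m%:R + 2) * (m%:R + 4).
Definition iter_const : R :=
  40 / (7 * mu pb) * (2 * Jmax + 2 * Lcst pb * xi3max / mu pb ^+ 2).

Let tr1 : \tr S0 = \tr (1%:M *m S0). Proof. by rewrite mul1mx. Qed.

Let trS0 : 0 <= \tr S0.
Proof.
rewrite tr1; apply: (trace_ge0 (init_moments Hpb)) => z.
by rewrite quadform_scal mul1r fdot_ge0.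
Qed.

Lemma Jmax_ge0 : 0 <= Jmax.
Proof. by have b0 := pbnd_ge0 n_gt0 Hpb; rewrite /Jmax; nonneg. Qed.

Let c0 := ccst_gt0 n_gt0 m_gt0 Hpb.

Lemma Cmax_ge0 : 0 <= Cmax.
Proof. by rewrite /Cmax divr_ge0 ?(ltW c0)// mulr_ge0 ?Jmax_ge0. Qed.

Lemma xi1max_ge0 : 0 <= xi1max.
Proof.
have b0 := pbnd_ge0 n_gt0 Hpb; have h := Cmax_ge0.
by rewrite /xi1max; nonneg.
Qed.

Let Lcst_ge0 : 0 <= Lcst pb.
Proof. by rewrite /Lcst mulr_ge0 ?specnorm_ge0// ltW// C3_gt0. Qed.

Lemma xi3max_ge0 : 0 <= xi3max.
Proof.
have h := xi1max_ge0; have h2 := xi2_ge0 n_gt0 Hpb.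
have s2 : 0 <= 1 / explore pb ^+ 2 by rewrite div1r invr_ge0 sqr_ge0.
by rewrite /xi3max; nonneg.
Qed.

Let mu_gt0 : 0 < mu pb. Proof. by rewrite muE// mulr_gt0. Qed.

Lemma iter_const_ge0 : 0 <= iter_const.
Proof.
apply: mulr_ge0; first by rewrite divr_ge0// mulr_ge0// ltW.
apply: addr_ge0; first exact: mulr_ge0 _ Jmax_ge0.
by rewrite divr_ge0 ?sqr_ge0// mulr_ge0 ?xi3max_ge0// mulr_ge0.
Qed.

Variables (zeta vs : R) (P : 'M[R]_n) (K0 : 'M[R]_(m, n)).
Hypotheses (zeta_gt0 : 0 < zeta) (zeta_lt1 : zeta < 1) (vs_gt0 : 0 < vs).
Hypotheses (okp : okP pb P) (HK0 : specnorm K0 <= M).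

Lemma Jtil_le_Jmax : Jtil pb P K0 <= Jmax.
Proof.
have b0 := pbnd_ge0 n_gt0 Hpb; have k0 := specnorm_ge0 K0.
rewrite JtilE// /Jmax tr1 -mxtraceZ scalemxAl.
apply: (trace_le (init_moments Hpb)) => z.
rewrite quadform_policy_cost quadformZ quadform_scal mul1r.
rewrite 2!(mulrDl _ _ (fdot z z)).
have KM : fdot (K0 *m z) (K0 *m z) <= M ^+ 2 * fdot z z.
  apply: le_trans (specnorm_ub2 _ _) _; rewrite ler_wpM2r ?fdot_ge0//.
  by rewrite ler_sqr// ?nnegrE// (le_trans k0).
apply: lerD; last exact: quadform_le_specnorm.
apply: lerD; last first.
  apply: le_trans (quadform_le_specnorm _ _) _.
  by rewrite -mulrA ler_wpM2l// specnorm_ge0.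
apply: le_trans (proj2 okp _) _; rewrite -mulrA ler_wpM2l//.
rewrite mulmxBl; apply: le_trans (fdotD_le _ _) _.
rewrite fdotNl fdotNr opprK -mulmxA.
have h1 := specnorm_ub2 A z; have h2 := specnorm_ub2 B (K0 *m z).
have := ler_wpM2l (sqr_ge0 (specnorm B)) KM; lra.
Qed.

Let zi : 1 <= zeta^-1. Proof. by rewrite invf_ge1// ltW. Qed.

(** The 11 in [Cmax] is 10 + 1, since the optimal cost is at most that of [K0] and
    [1 <= zeta^-1]. *)
Lemma Ctil_le : Ctil pb zeta P K0 <= Cmax * zeta^-1.
Proof.
have pp := proj1 okp; have J0 : 0 < Jtil pb P K0 by exact: Jtil_gt0.
rewrite /Ctil !sigma_min_posdef//; [|exact: setting_posR|exact: setting_posS].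
rewrite -/(ccst pb) /Cmax [leRHS]mulrAC ler_wpM2r ?invr_ge0 ?(ltW c0)//.
have Jg : Jtil pb P (gain pb P) <= Jtil pb P K0.
  by rewrite [leRHS]Jtil_gap// lerDl gap_ge0.
have JM := Jtil_le_Jmax; have J0' := ltW J0.
have h1 : Jtil pb P (gain pb P) <= zeta^-1 * Jtil pb P K0.
  by apply: le_trans Jg _; rewrite ler_peMl.
have h2 : zeta^-1 * Jtil pb P K0 <= zeta^-1 * Jmax.
  by rewrite ler_wpM2l// (le_trans _ zi).
lra.
Qed.

Let z0 : 0 <= zeta^-1. Proof. exact: le_trans zi. Qed.

Let xi1_le : xi1 pb zeta P K0 <= xi1max * zeta^-1.
Proof.
have b0 := pbnd_ge0 n_gt0 Hpb; have C0 := Cmax_ge0.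
rewrite /xi1 -/(pbnd pb) /xi1max [leRHS]mulrAC ler_wpM2r ?powR_ge0//.
have q0 := specnorm_ge0 Q; have a0 := sqr_ge0 (specnorm A).
have bb0 := sqr_ge0 (specnorm B); have r0 := specnorm_ge0 Rc.
have h1 : specnorm Q <= specnorm Q * zeta^-1 by rewrite ler_peMr.
have h2 : specnorm A ^+ 2 <= specnorm A ^+ 2 * zeta^-1 by rewrite ler_peMr.
have h3 := ler_wpM2l r0 Ctil_le; have h4 := ler_wpM2l bb0 Ctil_le.
have h5 : specnorm A ^+ 2 + 2 * specnorm B ^+ 2 * Ctil pb zeta P K0 <=
  (specnorm A ^+ 2 + 2 * specnorm B ^+ 2 * Cmax) * zeta^-1 by lra.
have := ler_wpM2l (mulr_ge0 (ler0n R 2) b0) h5; lra.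
Qed.

Let HxK : gap pb P K0 <= 10 * zeta^-1 * Jtil pb P K0.
Proof.
have pp := proj1 okp; have J0 : 0 < Jtil pb P K0 by exact: Jtil_gt0.
have Jg : 0 < Jtil pb P (gain pb P) by exact: Jtil_gt0.
apply: (@le_trans _ _ (Jtil pb P K0)); first by rewrite [leRHS]Jtil_gap// lerDr ltW.
by rewrite ler_peMl ?ltW//; have := zi; lra.
Qed.

Let xi3_le : xi3 pb zeta P K0 <= xi3max * zeta ^- 2.
Proof.
have x0 := xi1_ge0 n_gt0 m_gt0 Hpb okp HxK; have x2 := xi2_ge0 n_gt0 Hpb.
have xm := xi1max_ge0; have zz : 1 <= zeta ^- 2 by rewrite -exprVn exprn_ege1.
have zz2 : zeta^-1 <= zeta ^- 2.
  by rewrite -exprVn expr2 ler_peMl.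
have s2 : 0 <= 1 / explore pb ^+ 2 by rewrite div1r invr_ge0 sqr_ge0.
have m0 : 0 <= m%:R :> R by [].
have m2 : 0 <= m%:R + 2 :> R by rewrite addr_ge0.
have m4 : 0 <= m%:R + 4 :> R by rewrite addr_ge0.
rewrite /xi3 /xi3max 2!(mulrDl _ _ (zeta ^- 2)).
apply: lerD; first apply: lerD.
- rewrite [leRHS](_ : _ = 1 / explore pb ^+ 2 * (xi1max * zeta^-1) ^+ 2 * m%:R).
    rewrite ler_wpM2r// ler_wpM2l//; apply: lerXn2r xi1_le; rewrite nnegrE//.
    exact: mulr_ge0.
  by rewrite -(exprVn zeta); ring.
- rewrite [leRHS](_ : _ =
    2 * (xi1max * zeta ^- 2) * xi2 pb * m%:R * (m%:R + 2)); last by ring.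
  do 3![rewrite ler_wpM2r//]; rewrite ler_wpM2l//.
  by apply: le_trans xi1_le _; rewrite ler_wpM2l.
- by rewrite ler_peMr//; nonneg.
Qed.

(** Only the product with [Jtil] is bounded: it cancels the division by [Jtil] in [theta], so no
    lower bound on the cost enters. The sum covers both cases of the maximum. *)
Lemma theta_Jtil_le : theta pb zeta P K0 * Jtil pb P K0 <=
  zeta ^- 2 * (2 * Jmax + 2 * Lcst pb * xi3max / mu pb ^+ 2).
Proof.
have J0 : 0 < Jtil pb P K0 by apply: Jtil_gt0 => //; exact: (proj1 okp).
have zz : 1 <= zeta ^- 2 by rewrite -exprVn exprn_ege1.
have xm := xi3max_ge0; have JM := Jtil_le_Jmax; have Jm0 := Jmax_ge0.
have t0 : 0 <= 2 * Lcst pb * xi3max / mu pb ^+ 2.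
  by rewrite divr_ge0 ?sqr_ge0// mulr_ge0// mulr_ge0.
rewrite mulrDr /theta; case: (lerP 2 _) => _.
  apply: le_trans (_ : zeta ^- 2 * (2 * Lcst pb * xi3max / mu pb ^+ 2) <= _); last first.
    by rewrite lerDr; apply: mulr_ge0; [exact: le_trans zz|exact: mulr_ge0].
  have -> : 2 * Lcst pb * xi3 pb zeta P K0 / (mu pb ^+ 2 * Jtil pb P K0) * Jtil pb P K0
    = xi3 pb zeta P K0 * (2 * Lcst pb / mu pb ^+ 2).
    by field; rewrite !gt_eqF.
  have -> : zeta ^- 2 * (2 * Lcst pb * xi3max / mu pb ^+ 2) =
    xi3max * zeta ^- 2 * (2 * Lcst pb / mu pb ^+ 2) by ring.
  have w0 : 0 <= 2 * Lcst pb / mu pb ^+ 2 by rewrite divr_ge0 ?sqr_ge0// mulr_ge0.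
  exact: (ler_wpM2r w0 xi3_le).
apply: le_trans (_ : zeta ^- 2 * (2 * Jmax) <= _).
  apply: le_trans (_ : 2 * Jmax <= _); first by rewrite ler_wpM2l.
  by rewrite ler_peMl// mulr_ge0.
by rewrite lerDl mulr_ge0// (le_trans _ zz).
Qed.

Lemma iterations_le : (iterations pb zeta P K0 vs)%:R <= iter_const * zeta ^- 3 / vs ^+ 2 + 1.
Proof.
set x := 40 / (7 * mu pb * vs ^+ 2 * zeta) * theta pb zeta P K0 * Jtil pb P K0.
have xle : x <= iter_const * zeta ^- 3 / vs ^+ 2.
  have -> : x = 40 / (7 * mu pb * vs ^+ 2 * zeta) * (theta pb zeta P K0 * Jtil pb P K0).
    by rewrite /x; ring.
  have -> : iter_const * zeta ^- 3 / vs ^+ 2 = 40 / (7 * mu pb * vs ^+ 2 * zeta) *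
    (zeta ^- 2 * (2 * Jmax + 2 * Lcst pb * xi3max / mu pb ^+ 2)).
    by rewrite /iter_const; field; rewrite !gt_eqF.
  apply: ler_wpM2l theta_Jtil_le; apply: divr_ge0 => //; apply/ltW.
  by rewrite pmulr_lgt0// pmulr_lgt0 ?exprn_gt0// mulr_gt0.
rewrite /iterations -/x; case E : (nat_ceil x) => [|k].
  rewrite addr_ge0// divr_ge0 ?sqr_ge0// mulr_ge0 ?iter_const_ge0// invr_ge0 exprn_ge0//.
  exact: ltW.
rewrite -natr1 lerD2r; apply: le_trans xle; apply/ltW.
by rewrite -lt_nat_ceil E.
Qed.

End iteration_bound.

Ltac positivity := repeat (first [ assumption | exact: ltr01 |
  apply: divr_gt0 | apply: mulr_gt0 | by rewrite ltr0n ]).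

(** * Target accuracies and propagation of errors *)

Section algorithm_run.
Context {R : realType} {n m : nat} (pb : lqr R n m).
Hypotheses (n_gt0 : (0 < n)%N) (m_gt0 : (0 < m)%N) (Hpb : lqr_setting pb).
Hypothesis HQN : possemidef (termQ pb - Pstar pb).
Variable eps : R.
Hypothesis Heps : 0 < eps < eps_bound pb.

Local Notation A := (sysA pb).
Local Notation B := (sysB pb).
Local Notation Rc := (costR pb).
Local Notation QN := (termQ pb).
Local Notation a := (acst pb).
Local Notation N := (horizon pb eps).
Local Notation Pk k := (iter k (fun P => policy_cost pb P (gain pb P)) QN).

Let eps0 : 0 < eps := eps_gt0 Heps.
Let a0 : 0 < a := acst_gt0 n_gt0 Hpb.
Let c30 : 0 < C3 pb := C3_gt0 n_gt0 m_gt0 Hpb.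
Let Pm0 : 0 < Pmax pb := Pmax_gt0 n_gt0 Hpb.
Let lR : 0 < lambda_min Rc := lambda_min_gt0 m_gt0 (setting_posR Hpb).
Let e1 : 0 < expR 1 :> R := expR_gt0 1.

(** The added 1 keeps this positive even when [B = 0], as it serves as a denominator. *)
Definition C1max : R := Num.sqrt (Pmax pb / (2 * a)) * specnorm B / lambda_min Rc + 1.

Lemma phi_le k : 0 <= phi pb k <= Num.sqrt (Pmax pb / (2 * a)).
Proof.
apply/andP; split; first exact: bigmax_ge_id.
apply: bigmax_le; first exact: sqrtr_ge0.
by move=> i _; exact: ric_closed_loop_le.
Qed.

Lemma C1_le k : 0 <= C1 pb k <= C1max.
Proof.
have /andP[p0 p1] := phi_le k; have b0 := specnorm_ge0 B.
rewrite /C1 divr_ge0 ?mulr_ge0 ?(ltW lR)//=.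
apply: le_trans (_ : Num.sqrt (Pmax pb / (2 * a)) * specnorm B / lambda_min Rc <= _).
  by rewrite ler_wpM2r ?invr_ge0 ?(ltW lR)// ler_wpM2r.
by rewrite lerDl.
Qed.

Lemma C1max_gt0 : 0 < C1max.
Proof.
rewrite ltr_wpDl//; apply: divr_ge0; last exact: ltW.
by apply: mulr_ge0; [exact: sqrtr_ge0|exact: specnorm_ge0].
Qed.

(* [C1 = 0] would make the target accuracies [0]; it only happens when [A] or
   [B] vanishes, and then the horizon is 1. *)
Lemma C1_gt0 : (1 < N)%N -> 0 < C1 pb N.
Proof.
move=> N1; have g0 := horizon_gt1 m_gt0 Hpb N1.
have B0 : specnorm B != 0.
  by apply: contraTneq g0 => B0; rewrite /gain_defect B0 mulr0 mul0r ltxx.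
have sn0 k l : specnorm (0 : 'M[R]_(k, l)) = 0.
  by apply/eqP; rewrite eq_le specnorm_ge0 andbT; apply: specnorm_le => // z;
    rewrite mul0mx vnorm0 mul0r.
have /andP[p0 _] := phi_le N.
suff ph0 : phi pb N != 0.
  by rewrite divr_gt0// mulr_gt0// lt_neqAle eq_sym ?ph0 ?B0//= specnorm_ge0.
apply: contraTneq g0 => ph0.
have cl : specnorm (A - B *m Kric pb N 0) <= 0.
  rewrite -[X in _ <= X]ph0 /phi.
  exact: (le_bigmax _ (fun t : 'I_N => specnorm (A - B *m Kric pb N t))
    (Ordinal (ltnW N1))).
have AB0 : A - B *m Kric pb N 0 = 0.
  by apply: specnorm_eq0; apply/eqP; rewrite eq_le cl specnorm_ge0.
have A0 := closed_loop0 m_gt0 Hpb (iter_ric_psd Hpb HQN _) AB0.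
have K0 : Kstar pb = 0 by rewrite /Kstar /gain A0 mulmx0.
by rewrite /gain_defect /AKstar A0 K0 mulmx0 subr0 sn0 mulr0 !mul0r ltxx.
Qed.

Lemma min_sqrt_sq (x y : R) : 0 <= x -> 0 <= y ->
  Num.min (Num.sqrt x) (Num.sqrt y) = Num.sqrt (Num.min x y).
Proof.
move=> x0 y0; case: (leP x y) => xy; first by apply/min_idPl; rewrite ler_wsqrtr.
by apply/min_idPr; rewrite ler_wsqrtr// ltW.
Qed.

Section late_stage.
Hypothesis N1 : (1 < N)%N.
Local Notation v := (accuracy pb eps N 1 ^+ 2).

Let NR : 0 < N%:R :> R. Proof. by rewrite ltr0n ltnW. Qed.

Lemma accuracy_sqE : v = Num.min (a / C3 pb * (1 / N%:R))
  (Num.min (a / C3 pb * (a / (2 * expR 1 * N%:R * Pmax pb)))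
  (Num.min (a / C3 pb * (eps / (8 * expR 1 * N%:R * C1 pb N * Pmax pb)))
           (eps / (4 * C1 pb N * C3 pb)))).
Proof.
have C10 := C1_gt0 N1.
have p1 : 0 < a / C3 pb * (1 / N%:R) by positivity.
have p2 : 0 < a / C3 pb * (a / (2 * expR 1 * N%:R * Pmax pb)) by positivity.
have p3 : 0 < a / C3 pb * (eps / (8 * expR 1 * N%:R * C1 pb N * Pmax pb)).
  by positivity.
have p4 : 0 < eps / (4 * C1 pb N * C3 pb) by positivity.
rewrite /accuracy !min_sqrt_sq ?sqr_sqrtr// ?le_min ?ltW//.
Qed.

(** [C3 v / (4 a)] is the relative error added by one stage. The first three entries of the minimum
    make its [N]-fold sum at most 1, at most [a / Pmax] as [okP] requires, and small enough to move
    a gain by at most [eps / 4]. *)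
Lemma accuracy_bounds : [/\ 0 < v, N%:R * (C3 pb * v / (4 * a)) <= 1,
  N%:R * (C3 pb * v / (4 * a)) * Pmax pb <= a &
  C1 pb N * (N%:R * (C3 pb * v / (4 * a)) * Pmax pb) <= eps / 4].
Proof.
have C10 := C1_gt0 N1.
have ee : 1 <= expR 1 :> R by have := expR_ge1Dx (1 : R); lra.
have v1 : v <= a / C3 pb * (1 / N%:R) by rewrite accuracy_sqE ge_min lexx.
have v2 : v <= a / C3 pb * (a / (2 * expR 1 * N%:R * Pmax pb)).
  by rewrite accuracy_sqE !ge_min lexx orbT.
have v3 : v <= a / C3 pb * (eps / (8 * expR 1 * N%:R * C1 pb N * Pmax pb)).
  by rewrite accuracy_sqE !ge_min lexx !orbT.
have w (x : R) : 0 <= x -> x / (4 * expR 1) <= x.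
  move=> x0; rewrite ler_pdivrMr ?mulr_gt0// ler_peMr//.
  by rewrite (le_trans ee)// ler_peMl// ?ler1n// ltW.
have mono x : v <= x -> C3 pb * v / (4 * a) <= C3 pb * x / (4 * a).
  move=> vx; apply: ler_wpM2r; last by apply: ler_wpM2l; rewrite // ltW.
  by rewrite invr_ge0 ltW// mulr_gt0.
split.
- by rewrite accuracy_sqE !lt_min; apply/and4P; split; positivity.
- apply: (@le_trans _ _ (N%:R * (C3 pb * (a / C3 pb * (1 / N%:R)) / (4 * a)))).
    by rewrite ler_wpM2l// mono.
  rewrite [leLHS](_ : _ = 4^-1); last by field; rewrite !gt_eqF.
  by rewrite invf_le1// ler1n.
- apply: (@le_trans _ _ (N%:R * (C3 pb * (a / C3 pb * (a / (2 * expR 1 * N%:R * Pmax pb)))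
      / (4 * a)) * Pmax pb)).
    by rewrite ler_wpM2r ?(ltW Pm0)// ler_wpM2l// mono.
  rewrite [leLHS](_ : _ = a / 2 / (4 * expR 1)); last by field; rewrite !gt_eqF.
  by apply: le_trans (w _ _) _; move: a0; lra.
- apply: (@le_trans _ _ (C1 pb N * (N%:R * (C3 pb * (a / C3 pb *
      (eps / (8 * expR 1 * N%:R * C1 pb N * Pmax pb))) / (4 * a)) * Pmax pb))).
    by rewrite ler_wpM2l ?(ltW C10)// ler_wpM2r ?(ltW Pm0)// ler_wpM2l// mono.
  rewrite [leLHS](_ : _ = eps / 8 / (4 * expR 1)); last by field; rewrite !gt_eqF.
  by apply: le_trans (w _ _) _; move: eps0; lra.
Qed.

End late_stage.

(** The entries of the squared accuracies with [eps] and [N] factored out and [C1] replaced by its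
    uniform bound. The first one is for stage 0, and [eps^2 <= eps <= 1] gives all of them a common
    scale. *)
Definition acc_const : R := Num.min (1 / 16) (Num.min (a / C3 pb)
  (Num.min (a / C3 pb * (a / (2 * expR 1 * Pmax pb)))
  (Num.min (a / C3 pb * (1 / (8 * expR 1 * C1max * Pmax pb)))
           (1 / (4 * C1max * C3 pb))))).

Lemma acc_const_gt0 : 0 < acc_const.
Proof.
by have C10 := C1max_gt0; rewrite !lt_min; apply/and5P; split; positivity.
Qed.

Lemma accuracy_gt0 h : (h < N)%N -> 0 < accuracy pb eps N h.
Proof.
case: h => [|h] hN; first by rewrite divr_gt0.
have N1 : (1 < N)%N by exact: leq_ltn_trans hN.
have [v0 _ _ _] := accuracy_bounds N1; rewrite -[_ h.+1]/(accuracy pb eps N 1).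
have : 0 <= accuracy pb eps N 1 by rewrite !le_min !sqrtr_ge0.
by rewrite le_eqVlt => /predU1P[E|//]; move: v0; rewrite -E expr0n ltxx.
Qed.

Lemma accuracy_sq_ge h : (h < N)%N ->
  acc_const * eps ^+ 2 / N%:R <= accuracy pb eps N h ^+ 2.
Proof.
move=> hN; have NR : 1 <= N%:R :> R by rewrite ler1n (leq_ltn_trans _ hN).
have Np : 0 < N%:R :> R by exact: lt_le_trans NR.
have c0 := acc_const_gt0; have e2 : 0 <= eps ^+ 2 := sqr_ge0 _.
have E1 := eps_lt1 Heps; have E2 : eps ^+ 2 <= eps by rewrite expr2 ler_piMl// ltW.
have red c x : 0 < c -> acc_const <= c -> eps ^+ 2 * c / N%:R <= x ->
    acc_const * eps ^+ 2 / N%:R <= x.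
  move=> cp cc; apply: le_trans; rewrite ler_wpM2r ?invr_ge0 ?(ltW Np)// mulrC.
  by rewrite ler_wpM2l.
case: h hN => [|h] hN.
  apply: (red (1 / 16)); [by []|by rewrite ge_min lexx|].
  rewrite /accuracy expr_div_n -(natrX _ 4 2) ler_pdivrMr//.
  by rewrite [leLHS](_ : _ = eps ^+ 2 / 16) ?ler_peMr ?divr_ge0// div1r.
have N1 : (1 < N)%N by exact: leq_ltn_trans hN.
rewrite -[accuracy _ _ _ h.+1]/(accuracy pb eps N 1) accuracy_sqE//.
have C10 := C1_gt0 N1; have /andP[_ C1m] := C1_le N; have Cm0 := C1max_gt0.
rewrite !le_min; apply/and4P; split.
- apply: (red (a / C3 pb)); [by positivity|by rewrite !ge_min lexx !orbT|].
  rewrite mul1r; apply: ler_wpM2r; first by rewrite invr_ge0 ltW.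
  by rewrite ler_piMl ?(le_trans E2 (ltW E1))// ltW// divr_gt0.
- apply: (red (a / C3 pb * (a / (2 * expR 1 * Pmax pb))));
    [by positivity|by rewrite !ge_min lexx !orbT|].
  rewrite [leRHS](_ : _ = 1 * (a / C3 pb * (a / (2 * expR 1 * Pmax pb))) / N%:R).
    rewrite ler_wpM2r ?invr_ge0 ?(ltW Np)// ler_wpM2r//; last by rewrite ltW// (le_lt_trans E2).
    by apply: ltW; positivity.
  by field; rewrite !gt_eqF.
- apply: (red (a / C3 pb * (1 / (8 * expR 1 * C1max * Pmax pb))));
    [by positivity|by rewrite !ge_min lexx !orbT|].
  apply: (@le_trans _ _ (a / C3 pb * (eps / (8 * expR 1 * N%:R * C1max * Pmax pb)))).
    rewrite [leRHS](_ : _ = eps * (a / C3 pb * (1 / (8 * expR 1 * C1max * Pmax pb))) / N%:R).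
      rewrite ler_wpM2r ?invr_ge0 ?(ltW Np)// ler_wpM2r//.
      by apply: ltW; positivity.
    by field; rewrite !gt_eqF.
  have ac0 : 0 <= a / C3 pb by rewrite ltW// divr_gt0.
  rewrite ler_wpM2l// ler_wpM2l ?(ltW eps0)//.
  rewrite lef_pV2 ?posrE; [|by positivity|by positivity].
  by rewrite ler_wpM2r ?(ltW Pm0)// ler_wpM2l// !mulr_ge0// ltW.
- apply: (red (1 / (4 * C1max * C3 pb)));
    [by positivity|by rewrite !ge_min lexx !orbT|].
  apply: (@le_trans _ _ (eps / (4 * C1max * C3 pb))).
    have D0 : 0 <= (4 * C1max * C3 pb)^-1 by rewrite invr_ge0 ltW//; positivity.
    rewrite ler_pdivrMr// mulrA mulr1 -[leLHS]mulr1; apply: ler_pM => //.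
      exact: mulr_ge0.
    exact: ler_wpM2r.
  rewrite ler_wpM2l ?(ltW eps0)// lef_pV2 ?posrE; [|by positivity|by positivity].
  by rewrite ler_wpM2r ?(ltW c30)// ler_wpM2l.
Qed.

Variables (zeta : R) (K0 : nat -> 'M[R]_(m, n)).
Variable z : nat -> nat -> n.-tuple R * m.-tuple R.

Local Notation Pb := (Pback pb eps zeta K0 z).
Local Notation Kt := (rhpg_K pb eps zeta K0 z).
Local Notation Pt := (rhpg_P pb eps zeta K0 z).

Definition good_stage h : Prop :=
  fdot (Kt h - gain pb (Pt h.+1)) (Kt h - gain pb (Pt h.+1)) <=
  accuracy pb eps N h ^+ 2.

Local Notation c := (C3 pb * accuracy pb eps N 1 ^+ 2 / (4 * a)).

(** Relative errors add up along the stages. The restriction [k < N] excludes stage 0, which has its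
    own accuracy and whose gain is the output. *)
Lemma rhpg_close k : (k < N)%N -> (forall h, (N - k <= h < N)%N -> good_stage h) ->
  okP pb (Pb k) /\ rel_close (k%:R * c) (Pb k) (Pk k).
Proof.
elim: k => [|k IH] kN good.
  have c0 : rel_close (0%:R * c) QN QN by move=> y; rewrite mul0r subr0 addr0 mul1r lexx.
  split => //; apply: (rel_close_okP n_gt0 m_gt0 Hpb HQN (k := 0) _ c0).
  - exact: (iter_ric_psd Hpb HQN 0).
  - by rewrite mul0r.
  - by rewrite !mul0r ltW.
have N1 : (1 < N)%N by exact: leq_ltn_trans kN.
have [v0 Nc NcP _] := accuracy_bounds N1.
have c0 : 0 <= c by rewrite ltW//; positivity.
have kc j : (j < N)%N -> j%:R * c <= N%:R * c.
  by move=> jN; rewrite ler_wpM2r// ler_nat ltnW.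
have [okk relk] : okP pb (Pb k) /\ rel_close (k%:R * c) (Pb k) (Pk k).
  apply: IH => [|h /andP[h1 h2]]; first exact: ltnW.
  by apply: good; rewrite h2 andbT (leq_trans _ h1)// leq_sub2l.
have NkE : (N - (N - k.+1).+1)%N = k.
  by rewrite subnSK ?(ltnW kN)// subKn// ltnW// ltnW.
have gk : good_stage (N - k.+1).
  by apply: good; rewrite leqnn/= ltn_subrL /= (leq_ltn_trans _ kN).
rewrite /good_stage /rhpg_K /rhpg_P NkE in gk.
have accE : accuracy pb eps N (N - k.+1) = accuracy pb eps N 1.
  by rewrite /accuracy; move: kN; rewrite -subn_gt0; case: (N - k.+1)%N.
rewrite accE in gk.
have rel : rel_close (k.+1%:R * c) (Pb k.+1) (Pk k.+1).
  rewrite -natr1 mulrDl mul1r.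
  apply: (rel_close_step n_gt0 m_gt0 Hpb HQN okk _ relk gk).
  by rewrite mulr_ge0//= (le_trans (kc _ (ltnW kN))).
split => //; apply: (rel_close_okP n_gt0 m_gt0 Hpb HQN (k := k.+1) _ rel).
- exact: (policy_cost_psd (setting_posQ Hpb) (setting_posR Hpb) _ (proj1 okk)).
- by rewrite mulr_ge0.
- by apply: le_trans NcP; rewrite ler_wpM2r ?(ltW Pm0)// kc.
Qed.

Let half_prod (t1 t2 t3 t4 t5 t6 e : R) : 2 * t1 * t2 * t3 * t4 * t5 * t6 <= e ->
  t3 * t4 * t5 * (t2 * t1 * t6) <= e / 2.
Proof.
have -> : t3 * t4 * t5 * (t2 * t1 * t6) = 2 * t1 * t2 * t3 * t4 * t5 * t6 / 2 by field.
by move=> h; rewrite ler_wpM2r.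
Qed.

(** The budget is [eps / 4] for the optimization error of stage 0, [eps / 4] for the accumulated
    value errors and [eps / 2] for the finite horizon. *)
Lemma rhpg_gain_error : (forall h, (h < N)%N -> good_stage h) ->
  specnorm (Kt 0 - Kstar pb) <= eps.
Proof.
move=> good; have N0 := horizon_gt0 n_gt0 m_gt0 Hpb Heps.
have N1N : (N.-1 < N)%N by rewrite prednK.
have [okt rel] := rhpg_close N1N (fun h H => good h (proj2 (andP H))).
have ps := iter_ric_psd Hpb HQN N.-1.
have psP := posdef_psd (setting_posP Hpb).
have P1E : Pt 1 = Pb N.-1 by rewrite /rhpg_P subn1.
have -> : Kt 0 - Kstar pb = (Kt 0 - gain pb (Pt 1)) +
    ((gain pb (Pb N.-1) - gain pb (Pk N.-1)) + (gain pb (Pk N.-1) - Kstar pb)).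
  by rewrite P1E !addrA !subrK.
rewrite [leRHS](_ : _ = eps / 4 + (eps / 4 + eps / 2)); last by field.
apply: le_trans (specnormD _ _) _; apply: lerD.
  apply: le_trans (specnorm_fdot _) _.
  have e4 : 0 <= eps / 4 by rewrite ltW// divr_gt0.
  rewrite -[leRHS](ger0_norm e4) -sqrtr_sqr; apply: ler_wsqrtr.
  exact: (good 0%N N0).
apply: le_trans (specnormD _ _) _; apply: lerD.
  (* For horizon 1 the value matrix is [Q_N] itself and the middle term vanishes; [accuracy_bounds]
     needs a longer horizon. *)
  have [N1|N1] := ltnP 1 N; last first.
    have -> : N.-1 = 0%N by apply/eqP; rewrite -leqn0 -ltnS prednK.
    rewrite subrr; apply: specnorm_le => [|y]; rewrite ?divr_ge0 ?(ltW eps0)//.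
    by rewrite mul0mx vnorm0 mulr_ge0 ?vnorm_ge0 ?divr_ge0 ?(ltW eps0).
  have [v0 Nc NcP NcC] := accuracy_bounds N1.
  have c0 : 0 <= c by rewrite ltW//; positivity.
  have d0 : 0 <= N%:R * c by rewrite mulr_ge0.
  apply: le_trans (gain_sub_le m_gt0 Hpb (proj1 okt) ps) _.
  apply: le_trans NcC; apply: ler_pM; rewrite ?specnorm_ge0//.
  + by rewrite divr_ge0 ?mulr_ge0 ?specnorm_ge0// ltW.
  + rewrite /C1 ler_wpM2r ?invr_ge0 ?(ltW lR)// ler_wpM2r ?specnorm_ge0//.
    rewrite -subn1; exact: (le_bigmax _ (fun t : 'I_N => specnorm (A - B *m Kric pb N t))
      (Ordinal N0)).
  apply: sym_specnorm_le => [||y].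
  + by rewrite mulr_ge0// ltW.
  + by rewrite linearB /= (proj1 (proj1 okt)) (proj1 ps).
  rewrite quadformB ler_norml.
  have r3 : N.-1%:R * c * quadform (Pk N.-1) y <= N%:R * c * Pmax pb * fdot y y.
    rewrite -(mulrA _ (Pmax pb)); apply: ler_pM.
    - by rewrite mulr_ge0.
    - exact: (proj2 ps).
    - by rewrite ler_wpM2r// ler_nat leq_pred.
    - exact: ric_le_Pmax.
  move: (rel y) r3; set q := quadform (Pk _) y; set x := quadform (Pb _) y.
  set de := N.-1%:R * c; set b := _ * fdot y y => /andP[r1 r2] r3.
  by apply/andP; split; lra.
apply: le_trans (gain_sub_le m_gt0 Hpb ps psP) _.
have dec := horizon_decay n_gt0 m_gt0 Hpb Heps.
set s := starnorm _ _ in dec; set ds := starnorm (Pstar pb) (QN - Pstar pb).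
have s0 : 0 <= s ^+ (2 * N.-1) by rewrite exprn_ge0// starnorm_ge0.
have b0 : 0 <= cond (Pstar pb) * ds * s ^+ (2 * N.-1).
  by rewrite !mulr_ge0// ?starnorm_ge0// specnorm_ge0.
have sp : specnorm (Pk N.-1 - Pstar pb) <= cond (Pstar pb) * ds * s ^+ (2 * N.-1).
  apply: psd_specnorm_le => // [|y]; last exact: ric_sub_Pstar.
  split; first by rewrite linearB /= (proj1 ps) (proj1 psP).
  by move=> y; rewrite quadformB subr_ge0; exact: Pstar_le_ric.
have k0 : 0 <= specnorm (AKstar pb) * specnorm B / lambda_min Rc.
  by rewrite divr_ge0 ?mulr_ge0 ?specnorm_ge0// ltW.
apply: le_trans (ler_wpM2l k0 sp) _.
exact: half_prod dec.
Qed.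

End algorithm_run.

(** * The success event *)

Section run_probability.
Context {R : realType} {n m : nat} (pb : lqr R n m).
Hypotheses (n_gt0 : (0 < n)%N) (m_gt0 : (0 < m)%N) (Hpb : lqr_setting pb).
Hypothesis HQN : possemidef (termQ pb - Pstar pb).
Variables (M eps zeta : R) (K0 : nat -> 'M[R]_(m, n)).
Hypotheses (Heps : 0 < eps < eps_bound pb) (zeta_gt0 : 0 < zeta) (zeta_lt1 : zeta < 1).
Hypothesis HK0 : forall h, specnorm (K0 h) <= M.
Context {d} {T : measurableType d} (Pr : probability T R).
Variable Z : nat -> nat -> {mfun T >-> (n.-tuple R * m.-tuple R)%type}.
Hypothesis HZ : fresh_samples Pr (initD pb) Z.

Local Notation N := (horizon pb eps).
Let X (k : nat * nat) : T -> n.-tuple R * m.-tuple R := Z k.1 k.2.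
(** The empty second alternative makes this the past at iteration 0 of stage [h], in the form used
    by [stage_bad]. *)
Let J h : set (nat * nat) := [set k | (h < k.1)%N \/ k.1 = h /\ (k.2 < 0)%N].
Local Notation past h := (g_sigma_algebraType (past_system X (J h))).
Local Notation acc := (accuracy pb eps N).

Let Pb k w := Pback pb eps zeta K0 (fun h i => Z h i w) k.
Let good j w := good_stage pb eps zeta K0 (fun h i => Z h i w) j.

Let mX k : measurable_fun setT (X k). Proof. exact: measurable_funPT. Qed.

Let mxmeas_stage_gain {d'} {U : measurableType d'} (FP : U -> 'M[R]_n)
    (FZ : nat -> U -> n.-tuple R * m.-tuple R) h : mxmeas FP ->
  (forall i, measurable_fun setT (FZ i)) ->
  mxmeas (fun u => stage_gain pb eps zeta K0 (fun _ i => FZ i u) h (FP u)).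
Proof. by move=> mFP mFZ; exact: mxmeas_sgd_iterations. Qed.

Let mZ h j i : (h < j)%N -> measurable_fun setT (Z j i : past h -> _).
Proof.
move=> hj; have Jk : J h (j, i) by left.
exact: (measurable_past (X := X) Jk).
Qed.

Section observed.
(** The map [g] lets one proof give measurability both for the past sigma-algebra and for the full
    one: it is the identity from either space. *)
Context {d'} {U : measurableType d'} (g : U -> T) (h : nat).
Hypothesis mZg : forall j i, (h <= j)%N -> measurable_fun setT (fun u => Z j i (g u)).

Let mPb k : (h <= N - k)%N -> mxmeas (fun u => Pb k (g u)).
Proof.
elim: k => [|k IH] hk; first exact: mxmeas_cst.
have mk : mxmeas (fun u => Pb k (g u)).
  by apply: IH; apply: leq_trans hk _; rewrite leq_sub2l.
have mK := mxmeas_stage_gain (N - k.+1) mk (fun i => mZg i hk).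
have c1 k1 l (C : 'M[R]_(k1, l)) : mxmeas (fun _ : U => C) := mxmeas_cst C.
have mBK := mxmeasB (c1 _ _ (sysA pb)) (mxmeasM (c1 _ _ (sysB pb)) mK).
apply: mxmeasD => //; apply: mxmeasD; apply: mxmeasM => //.
  by apply: mxmeasM => //; exact: mxmeas_tr.
by apply: mxmeasM => //; exact: mxmeas_tr.
Qed.

Lemma mxmeas_rhpg_P j : (h <= j <= N)%N ->
  mxmeas (fun u => rhpg_P pb eps zeta K0 (fun h i => Z h i (g u)) j).
Proof. by move=> /andP[hj jN]; apply: mPb; rewrite subKn. Qed.

Lemma measurable_good_stage j : (h <= j)%N -> measurable [set u | (j < N)%N -> good j (g u)].
Proof.
move=> hj; have [jN|jN] := ltnP j N; last first.
  by rewrite (_ : [set u | _] = setT)//; apply/seteqP; split.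
have mPj : mxmeas (fun u => rhpg_P pb eps zeta K0 (fun h i => Z h i (g u)) j.+1).
  by apply: mxmeas_rhpg_P; rewrite jN andbT leqW.
have mE := mxmeasB (mxmeas_stage_gain j mPj (fun i => mZg i hj)) (mxmeas_gain pb mPj).
rewrite (_ : [set u | _] = setT `&` [set u | good j (g u)]).
  exact: (measurable_fun_ler (measurable_fdot mE mE) (measurable_cst (acc j ^+ 2))
    measurableT (Y := [set true])).
by rewrite setTI; apply/seteqP; split => u => [|gu _]; [apply|].
Qed.

Lemma measurable_good_stages b : (h <= b)%N ->
  measurable [set u | forall j, (b <= j < N)%N -> good j (g u)].
Proof.
move=> hb; rewrite (_ : [set u | _] =
    \bigcap_(j in [set j | (b <= j)%N]) [set u | (j < N)%N -> good j (g u)]).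
  apply: bigcap_measurable => [|j bj]; first by exists b => /=.
  by apply: measurable_good_stage; exact: leq_trans bj.
apply/seteqP; split => u Gu j; first by move=> bj jN; apply: Gu; rewrite bj.
by move=> /andP[bj jN]; exact: Gu.
Qed.

End observed.

Let Gd h : set T := [set w | forall j, (h < j < N)%N -> good j w].

Let mP h : (h < N)%N ->
  mxmeas ((fun w => rhpg_P pb eps zeta K0 (fun h i => Z h i w) h.+1) : past h -> 'M[R]_n).
Proof.
move=> hN; apply: (mxmeas_rhpg_P (g := id : past h -> T) (h := h.+1)) => [j i hj|].
  exact: mZ.
by rewrite leqnn.
Qed.

Let mGd h : measurable (Gd h : set (past h)).
Proof.
apply: (measurable_good_stages (g := id : past h -> T) (h := h.+1)) => // j i hj.
exact: mZ.
Qed.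

Let Gd_ok h w : (h < N)%N -> Gd h w ->
  okP pb (rhpg_P pb eps zeta K0 (fun h i => Z h i w) h.+1).
Proof.
move=> hN Gw; apply: (proj1 (rhpg_close n_gt0 m_gt0 Hpb HQN Heps _ _)).
  by rewrite ltn_subrL /= (leq_ltn_trans _ hN).
by move=> j; rewrite subKn//; exact: Gw.
Qed.

Let stage_fail h : (h < N)%N -> (Pr (Gd h `&` ~` good h) <= zeta%:E)%E.
Proof.
move=> hN; have a0 := accuracy_gt0 n_gt0 m_gt0 Hpb HQN Heps hN.
(* Its rounding is the deterministic bound [Tm] on the random number of iterations. *)
pose r := iter_const pb M * zeta ^- 3 / acc h ^+ 2 + 1.
have Gd_N w : Gd h w -> (iterations pb zeta
    (rhpg_P pb eps zeta K0 (fun h i => Z h i w) h.+1) (K0 h) (acc h) <= nat_ceil r)%N.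
  move=> Gw; rewrite leqNgt; apply/negP; rewrite -(ltr_nat R) => lt.
  have := iterations_le n_gt0 m_gt0 Hpb zeta_gt0 zeta_lt1 a0 (Gd_ok hN Gw) (HK0 h).
  by move=> /(lt_le_trans lt); rewrite -lt_nat_ceil ltnn.
have := stage_bad n_gt0 m_gt0 Hpb HZ zeta_gt0 a0 (mP hN) (@mGd h)
  (fun w => @Gd_ok h w hN) Gd_N.
congr (_ <= _)%E; congr (Pr _); apply/seteqP; split => w [Gw bad]; split => //.
  by move=> /=; rewrite /good /good_stage => gw; move: bad; rewrite /= ltNge gw.
by rewrite /= ltNge; apply/negP.
Qed.

Let Ek k : set T := [set w | forall j, (N - k <= j < N)%N -> good j w].

Let mEk k : measurable (Ek k).
Proof.
exact: (measurable_good_stages (g := id : T -> T) (h := 0) (fun j i _ => mX (j, i))).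
Qed.

(** A failure is charged to the stage executed first among the failing ones, since [stage_fail]
    presupposes that the stages executed before it succeeded. *)
Let fail_le k : (k <= N)%N -> (Pr (~` Ek k) <= (k%:R * zeta)%:E)%E.
Proof.
elim: k => [|k IH] kN.
  rewrite (_ : ~` Ek 0 = set0) ?measure0 ?mul0r//.
  rewrite (_ : Ek 0 = setT) ?setCT//; apply/seteqP; split => // w _ j.
  by rewrite subn0 => /andP[Nj /leq_trans/(_ Nj)]; rewrite ltnn.
set h := (N - k.+1)%N; have hN : (h < N)%N by rewrite ltn_subrL /= (leq_trans _ kN).
have hE : h.+1 = (N - k)%N by rewrite subnSK.
have mg : measurable (Gd h `&` ~` good h).
  have mGT : measurable (Gd h).
    have -> : Gd h = Ek k by rewrite /Gd /Ek -hE.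
    exact: mEk.
  apply: measurableI => //; apply: measurableC.
  have := measurable_good_stage (g := id : T -> T) (h := 0) (j := h) (fun j i _ => mX (j, i)).
  rewrite (_ : [set u | _] = good h); last first.
    by apply/seteqP; split => w => [|gw _]; [apply|].
  by apply.
apply: (@le_trans _ _ (Pr (~` Ek k `|` (Gd h `&` ~` good h)))).
  apply: le_measure; rewrite ?inE; [exact: measurableC| |].
    by apply: measurableU => //; exact: measurableC.
  move=> w nE; have [Ew|nEw] := pselect (Ek k w); last by left.
  right; split => [j|gh]; first by rewrite hE => /Ew.
  apply: nE => j /andP[hj jN]; move: hj; rewrite -/h leq_eqVlt => /predU1P[<-//|hj].
  by apply: Ew; rewrite -hE hj.
apply: le_trans (measureU2 _ (measurableC (mEk k)) mg) _.
apply: le_trans (leeD (IH (ltnW kN)) (stage_fail hN)) _.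
by rewrite -EFinD -natr1 mulrDl mul1r.
Qed.

Lemma rhpg_success : exists E : set T, [/\ measurable E,
  ((1 - N%:R * zeta)%:E <= Pr E)%E &
  forall w, E w -> forall h, (h < N)%N ->
    good_stage pb eps zeta K0 (fun h i => Z h i w) h].
Proof.
exists (Ek N); split; first exact: mEk.
  rewrite -[Ek N]setCK (probability_setC _ (measurableC (mEk N))) EFinB.
  by apply: leeB => //; exact: fail_le.
by move=> w Ew h hN; apply: Ew; rewrite subnn.
Qed.

(** Two factors [N] appear, from the number of stages and from the [1/N] in the squared accuracies,
    whence the squared logarithm. The 1 added to the constant pays for rounding each [T_h]. *)
Lemma sample_count_le z : (forall h, (h < N)%N -> good_stage pb eps zeta K0 z h) ->
  (sample_count pb eps zeta K0 z)%:R <=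
  (iter_const pb M / acc_const pb + 1) * horizon_const pb ^+ 2 *
    zeta ^- 3 * eps ^- 2 * ln (1 / eps) ^+ 2.
Proof.
move=> gd; have e0 := eps_gt0 Heps; have e1 := eps_lt1 Heps.
have ac0 := acc_const_gt0 n_gt0 m_gt0 Hpb; have ic0 := iter_const_ge0 n_gt0 m_gt0 Hpb M.
have N0 := horizon_gt0 n_gt0 m_gt0 Hpb Heps.
have NR : 1 <= N%:R :> R by rewrite ler1n.
have Np : 0 < N%:R :> R by rewrite ltr0n.
have z3 : 1 <= zeta ^- 3 by rewrite -exprVn exprn_ege1// invf_ge1// ltW.
have e2 : 1 <= eps ^- 2 by rewrite -exprVn exprn_ege1// invf_ge1// ltW.
have z30 : 0 <= zeta ^- 3 by exact: le_trans z3.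
have e20 : 0 <= eps ^- 2 by exact: le_trans e2.
have ze : 1 <= zeta ^- 3 * eps ^- 2 by rewrite -[leLHS]mulr1 ler_pM.
set c := iter_const pb M / acc_const pb.
have c0 : 0 <= c by rewrite divr_ge0// ltW.
have Tle h : (h < N)%N -> (rhpg_T pb eps zeta K0 z h)%:R <=
    (c + 1) * (zeta ^- 3 * eps ^- 2) * N%:R.
  move=> hN; have a0 := accuracy_gt0 n_gt0 m_gt0 Hpb HQN Heps hN.
  have okp : okP pb (rhpg_P pb eps zeta K0 z h.+1).
    apply: (proj1 (rhpg_close n_gt0 m_gt0 Hpb HQN Heps _ _)).
      by rewrite ltn_subrL /= (leq_ltn_trans _ hN).
    by move=> j /andP[_ jN]; exact: gd.
  apply: le_trans (iterations_le n_gt0 m_gt0 Hpb zeta_gt0 zeta_lt1 a0 okp (HK0 h)) _.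
  have ag := accuracy_sq_ge n_gt0 m_gt0 Hpb HQN Heps hN.
  have l0 : 0 < acc_const pb * eps ^+ 2 / N%:R.
    by rewrite divr_gt0// mulr_gt0// exprn_gt0.
  have iag : (acc h ^+ 2)^-1 <= (acc_const pb * eps ^+ 2 / N%:R)^-1.
    by rewrite lef_pV2// posrE ?exprn_gt0.
  have z0 : 0 <= iter_const pb M * zeta ^- 3 by rewrite mulr_ge0.
  apply: le_trans (lerD (ler_wpM2l z0 iag) (lexx 1)) _.
  rewrite 2!mulrDl mul1r; apply: lerD; last first.
    by rewrite -[leLHS]mulr1 ler_pM.
  rewrite le_eqVlt; apply/orP; left; apply/eqP; rewrite /c; field.
  by rewrite !gt_eqF.
rewrite /sample_count natr_sum.
apply: (@le_trans _ _ (\sum_(h < N) (c + 1) * (zeta ^- 3 * eps ^- 2) * N%:R)).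
  by apply: ler_sum => h _; exact: Tle.
rewrite sumr_const card_ord.
have -> : (c + 1) * (zeta ^- 3 * eps ^- 2) * N%:R *+ N =
    (c + 1) * (zeta ^- 3 * eps ^- 2) * N%:R ^+ 2 by rewrite -mulr_natr -mulrA expr2.
have hl := horizon_le n_gt0 m_gt0 Hpb Heps.
have hl2 : N%:R ^+ 2 <= horizon_const pb ^+ 2 * ln (1 / eps) ^+ 2.
  by rewrite -exprMn ler_sqr ?nnegrE ?(le_trans _ hl).
have k0 : 0 <= (c + 1) * (zeta ^- 3 * eps ^- 2).
  by rewrite mulr_ge0 ?addr_ge0// mulr_ge0.
apply: le_trans (ler_wpM2l k0 hl2) _.
by rewrite le_eqVlt; apply/orP; left; apply/eqP; ring.
Qed.

End run_probability.

Theorem corollary5p2 (R : realType) (n m : nat) (pb : lqr R n m)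
    (n_gt0 : (0 < n)%N) (m_gt0 : (0 < m)%N) (Hpb : lqr_setting pb)
    (HQN : possemidef (termQ pb - Pstar pb)) (M : R) :
  exists (C eps0 : R) (p q : nat), 0 < eps0 /\
  forall (eps zeta : R) (K0 : nat -> 'M[R]_(m, n)),
    0 < eps < eps0 -> 0 < zeta < 1 -> (forall h, specnorm (K0 h) <= M) ->
  forall (d : measure_display) (T : measurableType d) (P : probability T R)
      (Z : nat -> nat -> {mfun T >-> (n.-tuple R * m.-tuple R)%type}),
    fresh_samples P (initD pb) Z ->
  exists E : set T,
    [/\ measurable E,
        ((1 - (horizon pb eps)%:R * zeta)%:E <= P E)%E &
        forall w : T, E w ->
          let z := fun h i => Z h i w in
          specnorm (rhpg_K pb eps zeta K0 z 0 - Kstar pb) <= eps /\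
          (sample_count pb eps zeta K0 z)%:R
            <= C * zeta ^- q * eps ^- 2 * ln (1 / eps) ^+ p].
Proof.
exists ((iter_const pb M / acc_const pb + 1) * horizon_const pb ^+ 2), (eps_bound pb), 2%N, 3%N.
split; first exact: eps_bound_gt0.
move=> eps zeta K0 Heps /andP[z0 z1] HK0 d T P Z HZ.
have [E [mE PE gE]] := rhpg_success n_gt0 m_gt0 Hpb HQN Heps z0 z1 HK0 HZ.
exists E; split => // w Ew z; split.
  exact: rhpg_gain_error (gE w Ew).
exact: (sample_count_le n_gt0 m_gt0 Hpb HQN Heps z0 z1 HK0 (gE w Ew)).
Qed.
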